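(* Let $(X;A_1,A_2)$ and $(Y;B_1,B_2)$ be excisive triads of diffeological spaces and let $\phi\colon (X;A_1,A_2)\to(Y;B_1,B_2)$ be a smooth map of triads (that is, $\phi\colon X\to Y$ is smooth with $\phi(A_1)\subset B_1$ and $\phi(A_2)\subset B_2$) such that the restrictions $$\phi\colon A_1\to B_1,\qquad \phi\colon A_2\to B_2,\qquad \phi\colon A_1\cap A_2\to B_1\cap B_2$$ are weak homotopy equivalences. Then $\phi\colon X\to Y$ is a weak homotopy equivalence.
   Context: Subsets of diffeological spaces carry the subspace diffeology. The $D$-topology of a diffeological space $X$ is the final topology with respect to the plots of $X$; interiors are taken in the $D$-topology. If $A_1,A_2$ are subspaces of a diffeological space $X$, then $(X;A_1,A_2)$ is an excisive triad if $X$ is the union of the interiors of $A_1$ and $A_2$ ($A_2$ is not required to be contained in $A_1$). $I=[0,1]$, and $I^n$, $\partial I^n$ have the subspace diffeology of $\mathbf{R}^n$. $\pi_n(X,x_0)=[I^n,\partial I^n;X,x_0]$ is the set of smooth homotopy classes of smooth maps of pairs $(I^n,\partial I^n)\to(X,x_0)$, homotopies being smooth maps $H\colon I^n\times I\to X$ with $H(\partial I^n\times I)=\{x_0\}$; for $n=0$ this is the set $\pi_0X$ of path components. A smooth map $\phi\colon X\to Y$ is an $N$-equivalence if for all $x\in X$ the map $\phi_*\colon\pi_n(X,x)\to\pi_n(Y,\phi(x))$ is injective for $0\le n<N$ and surjective for $0\le n\le N$ (for $n=0$ this is a condition on $\pi_0X\to\pi_0Y$). It is a weak homotopy equivalence if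 it is an $N$-equivalence for all $N$. *)

(* Defs.v *)
From HB Require Import structures.
From mathcomp Require Import all_boot all_order all_algebra.
From mathcomp Require Import all_classical all_reals all_analysis.

Set Implicit Arguments.
Unset Strict Implicit.
Unset Printing Implicit Defensive.

Import Order.TTheory GRing.Theory Num.Theory.
Import numFieldNormedType.Exports.

Local Open Scope classical_set_scope.
Local Open Scope ring_scope.

Definition restriction (T U : Type) (A : set T) (B : set U) (f : T -> U)
  (fAB : set_fun A B f) : A -> B := sigLR (mkfun_fun fAB).

Lemma val_restriction (T U : Type) (A : set T) (B : set U) (f : T -> U)
  (fAB : set_fun A B f) (a : A) : val (restriction fAB a) = f (val a).
Proof. by []. Qed.

Lemma set_funI (T U : Type) (A1 A2 : set T) (B1 B2 : set U) (f : T -> U) :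
  set_fun A1 B1 f -> set_fun A2 B2 f -> set_fun (A1 `&` A2) (B1 `&` B2) f.
Proof. by move=> f1 f2 x [/f1 ? /f2]. Qed.

(* For open D in a finite-dimensional V this is k-fold Frechet
   differentiability on D; the values of f outside D are irrelevant.  *)
Fixpoint ndifferentiable (R : realType) (V W : normedModType R) (k : nat)
    (D : set V) (f : V -> W) : Prop :=
  if k is k'.+1 then
    (forall x, D x -> differentiable f x) /\
    (forall v, ndifferentiable k' D ('D_v f))
  else True.

Definition smooth_on (R : realType) (V W : normedModType R) (D : set V)
    (f : V -> W) : Prop :=
  forall k, ndifferentiable k D f.

Section ndifferentiable_theory.
Variable R : realType.
Implicit Types V W : normedModType R.

Lemma near0_differentiable V W (h : V -> W) x :
  (\near x, h x = 0) -> differentiable h x.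
Proof.
move=> hx.
have hx0 : h x = 0 by exact: (nbhs_singleton hx).
have E : h \o shift x = cst (h x) + (\0 : {linear V -> W}) +o_ 0 id.
  apply/eqaddoP => _/posnumP[e].
  have : \forall y \near (0 : V), h (y + x) = 0.
    by move: hx; rewrite (near_shift 0) subr0.
  apply: filterS => y /= hy.
  by rewrite !fctE /= hy hx0 /cst !addr0 subr0 normr0 mulr_ge0.
have dh : 'd h x = (\0 : {linear V -> W}) :> (V -> W).
  by apply: diff_unique => // y; exact: cst_continuous.
apply/diff_locallyP; rewrite dh; split => // y; exact: cst_continuous.
Qed.

Lemma near_eq_differentiable V W (f g : V -> W) x :
  (\near x, f x = g x) -> differentiable f x -> differentiable g x.
Proof.
move=> fg df; have -> : g = f + (g - f) by rewrite addrC subrK.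
apply: differentiableD => //; apply: near0_differentiable.
by apply: filterS fg => y e; rewrite !fctE e subrr.
Qed.

Lemma eq_ndifferentiable V W k (D : set V) (f g : V -> W) : open D ->
  (forall x, D x -> f x = g x) -> ndifferentiable k D f ->
  ndifferentiable k D g.
Proof.
move=> oD; elim: k f g => // k IH f g fg [df ddf].
have nfg x : D x -> \near x, f x = g x.
  by move=> Dx; apply: filterS (open_nbhs_nbhs (conj oD Dx)).
split => [x Dx|v]; first exact: near_eq_differentiable (nfg _ Dx) (df _ Dx).
by apply: IH (ddf v) => x /nfg; exact: near_eq_derive.
Qed.

Lemma sub_ndifferentiable V W k (D E : set V) (f : V -> W) : E `<=` D ->
  ndifferentiable k D f -> ndifferentiable k E f.
Proof.
move=> ED; elim: k f => // k IH f [df ddf].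
by split=> [x /ED/df//|v]; exact: IH (ddf v).
Qed.

Lemma ndifferentiableW V W k (D : set V) (f : V -> W) :
  ndifferentiable k.+1 D f -> ndifferentiable k D f.
Proof.
elim: k f => // k IH f [df ddf]; split => // v; exact: IH (ddf v).
Qed.

Lemma ndifferentiable_local V W k (D : set V) (f : V -> W) :
  (forall x, D x -> exists2 E, E x & ndifferentiable k E f) ->
  ndifferentiable k D f.
Proof.
elim: k f => // k IH f loc; split => [x /loc [E Ex [df _]]|v]; first exact: df.
by apply: IH => x /loc[E Ex [_ /(_ v) ddf]]; exists E.
Qed.

Lemma ndifferentiable_cst V W k (D : set V) (w : W) :
  ndifferentiable k D (cst w).
Proof.
elim: k w => // k IH w; split => [x _|v]; first exact: differentiable_cst.
rewrite (_ : 'D_v (cst w) = cst 0) //; apply/funext => x.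
by rewrite derive_cst.
Qed.

Lemma ndifferentiableD V W k (D : set V) (f g : V -> W) : open D ->
  ndifferentiable k D f -> ndifferentiable k D g ->
  ndifferentiable k D (f + g).
Proof.
move=> oD; elim: k f g => // k IH f g [df ddf] [dg ddg].
split=> [x Dx|v]; first by apply: differentiableD; [exact: df|exact: dg].
apply: (eq_ndifferentiable oD _ (IH _ _ (ddf v) (ddg v))) => x Dx.
by rewrite deriveD//; apply: diff_derivable; [exact: df|exact: dg].
Qed.

Lemma ndifferentiable_sum V W k (D : set V) n (f : 'I_n -> V -> W) : open D ->
  (forall i, ndifferentiable k D (f i)) ->
  ndifferentiable k D (\sum_(i < n) f i).
Proof.
move=> oD df; elim/big_rec: _ => [|i g _ dg]; first exact: ndifferentiable_cst.
exact: ndifferentiableD.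
Qed.

Lemma scale_is_bilinear W :
  bilinear_for
    (GRing.Scale.Law.clone _ _ *:%R _) (GRing.Scale.Law.clone _ _ *:%R _)
    (@GRing.scale R W : R -> W -> W).
Proof.
split=> [u'|u] a x y /=; first by rewrite scalerDl scalerA.
by rewrite scalerDr !scalerA mulrC.
Qed.
HB.instance Definition _ W := bilinear_isBilinear.Build R R W W _ _
  (@GRing.scale R W) (@scale_is_bilinear W).

Lemma is_diff_scale V W (a : V -> R) (f : V -> W) x :
  differentiable a x -> differentiable f x ->
  is_diff x (fun y => a y *: f y) (fun v => a x *: 'd f x v + 'd a x v *: f x).
Proof.
move=> da df.
have cs : continuous (fun p : R * W => p.1 *: p.2) by exact: scale_continuous.
have dp := differentiable_pair da df.
have ds := differentiable_bilin (f := @GRing.scale R W) (a x, f x) cs.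
have -> : (fun y => a y *: f y)
  = (fun p : R * W => p.1 *: p.2) \o (fun y => (a y, f y)) by [].
split; first exact: differentiable_comp.
rewrite diff_comp// (diff_bilin (f := @GRing.scale R W) (a x, f x) cs).
by rewrite diff_pair.
Qed.

Lemma ndifferentiable_scale V W k (D : set V) (a : V -> R) (f : V -> W) :
  open D -> ndifferentiable k D a -> ndifferentiable k D f ->
  ndifferentiable k D (fun y => a y *: f y).
Proof.
move=> oD; elim: k a f => // k IH a f dda ddf.
have [da Da] := dda; have [df Df] := ddf.
split=> [x Dx|v]; first by have [] := is_diff_scale (da _ Dx) (df _ Dx).
have h := ndifferentiableD oD (IH _ _ (ndifferentiableW dda) (Df v))
                              (IH _ _ (Da v) (ndifferentiableW ddf)).
apply: (eq_ndifferentiable oD _ h) => x Dx.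
have [d e] := is_diff_scale (da _ Dx) (df _ Dx).
by rewrite [in RHS]deriveE// e !fctE !deriveE//; [exact: da|exact: df].
Qed.

Lemma ndifferentiable_linear V W W' k (D : set V) (f : V -> W)
  (L : {linear W -> W'}) : open D -> continuous L ->
  ndifferentiable k D f -> ndifferentiable k D (L \o f).
Proof.
move=> oD cL; elim: k f => // k IH f [df ddf].
split=> [x Dx|v].
  by apply: differentiable_comp; [exact: df|exact: linear_differentiable].
apply: (eq_ndifferentiable oD _ (IH _ (ddf v))) => x Dx.
have dL : differentiable L (f x) by exact: linear_differentiable.
rewrite /= [in RHS]deriveE; last by apply: differentiable_comp => //; exact: df.
rewrite (diff_comp (df _ Dx) dL) [RHS]/= (diff_lin (f x) cL).
by rewrite (deriveE _ (df _ Dx)).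
Qed.

Lemma ndifferentiable_coord V n k (D : set V) (f : V -> 'rV[R]_n) i : open D ->
  ndifferentiable k D f -> ndifferentiable k D (fun x => f x 0 i : R).
Proof.
move=> oD df.
have lin : linear (fun M : 'rV[R]_n => M 0 i : R) by move=> a u v; rewrite !mxE.
pose LM := GRing.isLinear.Build _ _ _ _ _ lin.
pose L : {linear 'rV[R]_n -> R} := HB.pack (fun M : 'rV[R]_n => M 0 i : R) LM.
by apply: (@ndifferentiable_linear _ _ _ k D f L) => //; exact: coord_continuous.
Qed.

Lemma ndifferentiable_comp V W n k (D : set V) (E : set 'rV[R]_n)
    (h : V -> 'rV[R]_n) (f : 'rV[R]_n -> W) : open D -> set_fun D E h ->
  ndifferentiable k D h -> ndifferentiable k E f ->
  ndifferentiable k D (f \o h).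
Proof.
move=> oD hDE; elim: k f => // k IH f ddh [df ddf]; have [dh Dh] := ddh.
have dfh x : D x -> differentiable f (h x) by move=> /hDE/df.
split=> [x Dx|v]; first by apply: differentiable_comp; [exact: dh|exact: dfh].
have H : ndifferentiable k D (\sum_(i < n)
    (fun x => ('D_v h x) 0 i *: ('D_(delta_mx 0 i) f \o h) x)).
  apply: ndifferentiable_sum => // i; apply: ndifferentiable_scale => //.
    exact: ndifferentiable_coord (Dh v).
  exact: IH (ndifferentiableW ddh) (ddf _).
apply: (eq_ndifferentiable oD _ H) => x Dx.
have dfx := dfh _ Dx; have dhx := dh _ Dx.
rewrite [in RHS]deriveE; last exact: differentiable_comp.
rewrite diff_comp//= fct_sumE [X in 'd f (h x) X]row_sum_delta linear_sum.
by apply: eq_bigr => i _; rewrite linearZ/= !deriveE.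
Qed.

End ndifferentiable_theory.

(* The domain of a plot is an open subset U of R^n, with n = 0 and U empty
   allowed; plots are functions on the subtype U, so X may be empty. *)
HB.mixin Record isDiffeological (R : realType) (X : Type) := {
  plot : forall (n : nat) (U : set 'rV[R]_n), (U -> X) -> Prop ;
  plot_open : forall n (U : set 'rV[R]_n) (p : U -> X), plot n U p -> open U ;
  plot_cst : forall n (U : set 'rV[R]_n) (x : X),
    open U -> plot n U (fun _ : U => x) ;
  plot_local : forall n (U : set 'rV[R]_n) (p : U -> X), open U ->
    (forall u : U, exists V : set 'rV[R]_n, exists2 VU : set_fun V U id,
       V (val u) & plot n V (p \o restriction VU)) ->
    plot n U p ;
  plot_comp : forall m n (V : set 'rV[R]_m) (U : set 'rV[R]_n) (p : U -> X)
      (h : 'rV[R]_m -> 'rV[R]_n) (hVU : set_fun V U h),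
    plot n U p -> open V -> smooth_on V h -> plot m V (p \o restriction hVU)
}.

#[short(type="diffeologicalType")]
HB.structure Definition Diffeological (R : realType) :=
  {X of isDiffeological R X}.
Arguments plot {R s n U} p : rename.

Definition smooth (R : realType) (X Y : diffeologicalType R) (f : X -> Y) :
    Prop :=
  forall n (U : set 'rV[R]_n) (p : U -> X), plot p -> plot (f \o p).

Section euclidean.
Variables (R : realType) (d : nat).

Definition euclidean_plot n (U : set 'rV[R]_n) (p : U -> 'rV[R]_d) : Prop :=
  open U /\ smooth_on U (valL_ 0 p).

Lemma valLE n (U : set 'rV[R]_n) (p : U -> 'rV[R]_d) x (Ux : x \in U) :
  valL_ 0 p x = p (SigSub Ux).
Proof. by rewrite -[LHS](sigLE U (valL_ 0 p) _ Ux) valLK. Qed.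

Lemma euclidean_plot_cst n (U : set 'rV[R]_n) (x : 'rV[R]_d) :
  open U -> euclidean_plot (fun _ : U => x).
Proof.
move=> oU; split=> // k.
apply: (eq_ndifferentiable oU _ (ndifferentiable_cst k U x)) => y.
by move=> /mem_set Uy; rewrite valLE.
Qed.

Lemma euclidean_plot_local n (U : set 'rV[R]_n) (p : U -> 'rV[R]_d) :
  open U ->
  (forall u : U, exists V : set 'rV[R]_n, exists2 VU : set_fun V U id,
     V (val u) & euclidean_plot (p \o restriction VU)) ->
  euclidean_plot p.
Proof.
move=> oU loc; split=> // k; apply: ndifferentiable_local => x /mem_set Ux.
have [V [VU /= Vx [oV sV]]] := loc (SigSub Ux); exists V => //.
apply: (eq_ndifferentiable oV _ (sV k)) => y Vy.
rewrite (valLE _ (mem_set Vy)) (valLE _ (mem_set (VU _ Vy)))/=.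
by congr p; exact: val_inj.
Qed.

Lemma euclidean_plot_comp m n (V : set 'rV[R]_m) (U : set 'rV[R]_n)
    (p : U -> 'rV[R]_d) (h : 'rV[R]_m -> 'rV[R]_n) (hVU : set_fun V U h) :
  euclidean_plot p -> open V -> smooth_on V h ->
  euclidean_plot (p \o restriction hVU).
Proof.
move=> [oU sp] oV sh; split=> // k.
have H := ndifferentiable_comp oV hVU (sh k) (sp k).
apply: (eq_ndifferentiable oV _ H) => y Vy.
rewrite -[LHS]/(valL_ 0 p (h y)) (valLE _ (mem_set Vy)).
rewrite (valLE _ (mem_set (hVU _ Vy)))/=.
by congr p; exact: val_inj.
Qed.

HB.instance Definition _ := isDiffeological.Build R 'rV[R]_d
  (fun n (U : set 'rV[R]_n) (p : U -> 'rV[R]_d) (H : euclidean_plot p) => H.1)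
  euclidean_plot_cst euclidean_plot_local euclidean_plot_comp.

End euclidean.

Section subspace.
Variables (R : realType) (X : diffeologicalType R) (A : set X).

Definition subspace_plot n (U : set 'rV[R]_n) (p : U -> A) : Prop :=
  plot (set_val \o p).

Lemma subspace_plot_open n (U : set 'rV[R]_n) (p : U -> A) :
  subspace_plot p -> open U.
Proof. exact: plot_open. Qed.

Lemma subspace_plot_cst n (U : set 'rV[R]_n) (a : A) :
  open U -> subspace_plot (fun _ : U => a).
Proof. exact: plot_cst. Qed.

Lemma subspace_plot_local n (U : set 'rV[R]_n) (p : U -> A) : open U ->
  (forall u : U, exists V : set 'rV[R]_n, exists2 VU : set_fun V U id,
     V (val u) & subspace_plot (p \o restriction VU)) ->
  subspace_plot p.
Proof. exact: plot_local. Qed.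

Lemma subspace_plot_comp m n (V : set 'rV[R]_m) (U : set 'rV[R]_n)
    (p : U -> A) (h : 'rV[R]_m -> 'rV[R]_n) (hVU : set_fun V U h) :
  subspace_plot p -> open V -> smooth_on V h ->
  subspace_plot (p \o restriction hVU).
Proof. exact: plot_comp. Qed.

HB.instance Definition _ := isDiffeological.Build R (set_type A)
  subspace_plot_open subspace_plot_cst subspace_plot_local subspace_plot_comp.

End subspace.

Section product.
Variables (R : realType) (X Y : diffeologicalType R).

Definition product_plot n (U : set 'rV[R]_n) (p : U -> X * Y) : Prop :=
  plot (fst \o p) /\ plot (snd \o p).

Lemma product_plot_open n (U : set 'rV[R]_n) (p : U -> X * Y) :
  product_plot p -> open U.
Proof. by move=> [/plot_open]. Qed.

Lemma product_plot_cst n (U : set 'rV[R]_n) (x : X * Y) :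
  open U -> product_plot (fun _ : U => x).
Proof. by move=> oU; split; exact: plot_cst. Qed.

Lemma product_plot_local n (U : set 'rV[R]_n) (p : U -> X * Y) : open U ->
  (forall u : U, exists V : set 'rV[R]_n, exists2 VU : set_fun V U id,
     V (val u) & product_plot (p \o restriction VU)) ->
  product_plot p.
Proof.
move=> oU loc; split; apply: plot_local => // u;
  by have [V [VU Vu [? ?]]] := loc u; exists V, VU.
Qed.

Lemma product_plot_comp m n (V : set 'rV[R]_m) (U : set 'rV[R]_n)
    (p : U -> X * Y) (h : 'rV[R]_m -> 'rV[R]_n) (hVU : set_fun V U h) :
  product_plot p -> open V -> smooth_on V h ->
  product_plot (p \o restriction hVU).
Proof.
by move=> [p1 p2] oV sh; split; [exact: plot_comp p1 _ _|exact: plot_comp p2 _ _].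
Qed.

HB.instance Definition _ := isDiffeological.Build R (X * Y)%type
  product_plot_open product_plot_cst product_plot_local product_plot_comp.

End product.

(* the carrier of X, as a topological space for the D-topology *)
Definition Dspace (R : realType) (X : diffeologicalType R) : Type := X.

Section Dtopology.
Variables (R : realType) (X : diffeologicalType R).

(* [p @^-1` O] is a subset of U, open in the subspace topology of U. *)
Definition Dopen : set_system (Dspace X) := [set O |
  forall n (U : set 'rV[R]_n) (p : U -> X), plot p -> open (p @^-1` O)].

Lemma DopenT : Dopen setT.
Proof. by move=> n U p _; rewrite preimage_setT; exact: openT. Qed.

Lemma DopenI : setI_closed Dopen.
Proof.
by move=> A B oA oB n U p pp; rewrite preimage_setI; apply: openI;
  [exact: oA|exact: oB].
Qed.

Lemma Dopen_bigcup (I : Type) (f : I -> set (Dspace X)) :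
  (forall i, Dopen (f i)) -> Dopen (\bigcup_i f i).
Proof.
move=> of_ n U p pp; rewrite preimage_bigcup; apply: bigcup_open => i _.
exact: of_.
Qed.

HB.instance Definition _ := gen_eqMixin (Dspace X).
HB.instance Definition _ := gen_choiceMixin (Dspace X).
HB.instance Definition _ := isOpenTopological.Build (Dspace X)
  DopenT DopenI Dopen_bigcup.

Definition excisive_triad (A1 A2 : set X) : Prop :=
  interior (A1 : set (Dspace X)) `|` interior (A2 : set (Dspace X)) = setT.

End Dtopology.

Definition cube (R : realType) (n : nat) : set 'rV[R]_n :=
  [set x | forall i, 0 <= x ord0 i <= 1].
Arguments cube : clear implicits.

Definition cube_boundary (R : realType) (n : nat) : set (cube R n) :=
  [set x : cube R n | exists i, val x ord0 i = 0 \/ val x ord0 i = 1].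

(* The unit interval I is [cube R 1], with endpoints [I0] and [I1]. *)
Lemma cube_const_mx (R : realType) (t : R) : 0 <= t <= 1 ->
  (const_mx t : 'rV[R]_1) \in cube R 1.
Proof. by move=> t01; apply/mem_set => i; rewrite mxE. Qed.

Definition I0 (R : realType) : cube R 1 :=
  SigSub (cube_const_mx (introT andP (conj (lexx 0) ler01))).

Definition I1 (R : realType) : cube R 1 :=
  SigSub (cube_const_mx (introT andP (conj ler01 (lexx 1)))).

Section homotopy.
Variables (R : realType) (X : diffeologicalType R).

Definition smooth_path (x y : X) : Prop :=
  exists g : cube R 1 -> X, [/\ smooth g, g (I0 R) = x & g (I1 R) = y].

Definition path_component (x : X) : set X := [set y | smooth_path x y].

Definition pi0 : set (set X) := range path_component.

Variables (n : nat) (x0 : X).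

(* smooth maps of pairs (I^n, boundary of I^n) -> (X, x0) *)
Definition pair_map : set (cube R n -> X) :=
  [set f | smooth f /\ forall x, cube_boundary x -> f x = x0].

Definition pair_homotopic (f g : cube R n -> X) : Prop :=
  exists H : cube R n * cube R 1 -> X,
    [/\ smooth H, forall x, H (x, I0 R) = f x, forall x, H (x, I1 R) = g x
      & forall x t, cube_boundary x -> H (x, t) = x0].

Definition pin_class (f : cube R n -> X) : set (cube R n -> X) :=
  [set g | pair_map g /\ pair_homotopic f g].

Definition pin : set (set (cube R n -> X)) := pin_class @` pair_map.

End homotopy.
Arguments pi0 {R} X.
Arguments pin {R X} n x0.

Section equivalence.
Variables (R : realType) (X Y : diffeologicalType R) (phi : X -> Y).

(* The induced maps on classes: the class of phi \o f, for any f in C. *)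
Definition pi0_map (C : set X) : set Y :=
  \bigcup_(x in C) path_component (phi x).

Definition pin_map (n : nat) (x0 : X) (C : set (cube R n -> X)) :
    set (cube R n -> Y) :=
  \bigcup_(f in C) pin_class (phi x0) (phi \o f).
Arguments pin_map : clear implicits.

(* In degree 0 the condition does not depend on a base point: it is imposed on
   pi_0(X) -> pi_0(Y) even when X is empty, so that then Y is empty too. *)
Definition N_equivalence (N : nat) : Prop :=
  [/\ smooth phi,
      ((0 < N)%N -> set_inj (pi0 X) pi0_map),
      set_surj (pi0 X) (pi0 Y) pi0_map,
      (forall (n : nat) (x : X), (0 < n < N)%N ->
         set_inj (pin n x) (pin_map n x))
    & (forall (n : nat) (x : X), (0 < n <= N)%N ->
         set_surj (pin n x) (pin n (phi x)) (pin_map n x))].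

Definition weak_homotopy_equivalence : Prop := forall N, N_equivalence N.

End equivalence.

(* Main.v *)
(* A relative lifting problem for a map A -> B consists of f : I^q -> B, a map
   g : bd I^q -> A and a homotopy on bd I^q from f to phi g.  If phi is a weak
   equivalence, then such a problem has a solution, up to reparametrization: being
   solvable is invariant under homotopies of problems, so g can be contracted on
   all faces of I^q but one, then made constant by injectivity on pi_(q-1), after
   which surjectivity on pi_q solves the problem.

   Given f : I^n -> Y and a lift g to X on the boundary, the cube is cut into a
   grid so fine that each small cube is mapped by f into some B_i, and its boundary
   part by g into A_i for the same i.  The lift is then extended over the skeleta
   of the grid, solving on each face a lifting problem for the intersection of the
   A_i -> B_i over all small cubes containing that face, which is A_1 -> B_1,
   A_2 -> B_2 or the map between the intersections.  With g constant this gives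
   surjectivity on pi_n; with f a homotopy and g its two ends, injectivity. *)

Require Import Defs.
From mathcomp Require Import all_boot all_order all_algebra.
From mathcomp Require Import all_classical all_reals all_analysis.
From mathcomp Require Import ring lra.

Set Implicit Arguments.
Unset Strict Implicit.
Unset Printing Implicit Defensive.

Import Order.TTheory GRing.Theory Num.Theory.
Import numFieldNormedType.Exports.

Local Open Scope classical_set_scope.
Local Open Scope ring_scope.

(** * Calculus *)

(** The obstacle throughout is smoothness: maps that agree along a common face need not glue to a
    smooth map, and a smooth retraction of a cylinder onto its bottom and sides is not at hand. The
    remedy is to precompose with functions that are constant near the places of gluing, so that the
    pieces agree on overlapping open sets; the collars created in this way are also the room in
    which homotopies are run. The price is a reparametrization, which accumulates from one
    construction to the next. It does no harm in the end, because the reparametrizations of [0, 1]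
    form a convex set, and each is joined to the identity by linear interpolation. A lift over a
    skeleton covers [f] only up to a homotopy, which the next face sees on its sides; this is why a
    lifting problem carries a homotopy on the boundary and not an equality. A face must be solved
    inside an intersection because it will lie on the boundary of larger faces, each of which is
    confined to the sets of the small cubes around it. *)

Section ndiff.
Variable R : realType.
Implicit Types U V W : normedModType R.

Lemma ndifferentiable_pair V W1 W2 k (D : set V) (f : V -> W1) (g : V -> W2) :
  open D -> ndifferentiable k D f -> ndifferentiable k D g ->
  ndifferentiable k D (fun x => (f x, g x)).
Proof.
move=> oD; elim: k f g => // k IH f g [df ddf] [dg ddg].
split=> [x Dx|v]; first by apply: differentiable_pair; [exact: df|exact: dg].
apply: (eq_ndifferentiable oD _ (IH _ _ (ddf v) (ddg v))) => x Dx.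
have dfx := df _ Dx; have dgx := dg _ Dx.
rewrite [in RHS]deriveE; last exact: differentiable_pair.
by rewrite diff_pair// !deriveE.
Qed.

Lemma ndifferentiable_fst V W1 W2 k (D : set V) (f : V -> W1 * W2) :
  open D -> ndifferentiable k D f -> ndifferentiable k D (fst \o f).
Proof.
move=> oD df; apply: ndifferentiable_linear => //.
by move=> x; exact: cvg_fst.
Qed.

Lemma ndifferentiable_snd V W1 W2 k (D : set V) (f : V -> W1 * W2) :
  open D -> ndifferentiable k D f -> ndifferentiable k D (snd \o f).
Proof.
move=> oD df; apply: ndifferentiable_linear => //.
by move=> x; exact: cvg_snd.
Qed.

Lemma ndifferentiableN V k (D : set V) (a : V -> R) : open D ->
  ndifferentiable k D a -> ndifferentiable k D (fun x => - a x).
Proof.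
move=> oD da; have := ndifferentiable_scale oD (ndifferentiable_cst k D (-1:R^o)) da.
by apply: eq_ndifferentiable => // x _; rewrite /cst scaleN1r.
Qed.

Lemma ndifferentiableM V k (D : set V) (a b : V -> R) : open D ->
  ndifferentiable k D a -> ndifferentiable k D b ->
  ndifferentiable k D (fun x => a x * b x).
Proof. by move=> oD da db; exact: (@ndifferentiable_scale R V R^o). Qed.

(** The derivative of [1 / a] is a polynomial in [1 / a] and the derivative of [a], so the induction
    hypothesis for the inverse itself applies to it. *)
Lemma ndifferentiableV V k (D : set V) (a : V -> R) : open D ->
  (forall x, D x -> a x != 0) ->
  ndifferentiable k D a -> ndifferentiable k D (fun x => (a x)^-1).
Proof.
move=> oD a0; elim: k => // k IH dda; have [da Da] := dda.
have dV := IH (ndifferentiableW dda).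
split=> [x Dx|v].
  by apply: differentiableV; [exact: da| exact: a0].
have h := ndifferentiableN oD (ndifferentiableM oD (ndifferentiableM oD dV dV) (Da v)).
apply: (eq_ndifferentiable oD _ h) => x Dx.
have ax := a0 _ Dx; have dax := da _ Dx.
rewrite (deriveV ax (diff_derivable (v := v) dax)).
by rewrite /GRing.scale/= -mulNr; congr (- _ * _); rewrite -expr2 exprVn.
Qed.

(* These flat functions are closed under derivation up to linear combinations,
   which makes their smoothness an induction. *)
Definition flat k (t : R) : R := if 0 < t then t ^- k * expR (- t^-1) else 0.

(** The term of degree k + 2 of the exponential series at 1 / t bounds exp (1 / t) from below. The
    quadratic bound is what differentiability at 0 requires. *)
Lemma flat_le k : exists2 C : R, 0 < C & forall t, `|flat k t| <= C * t ^+ 2.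
Proof.
exists (k.+2`!%:R); first by rewrite ltr0n fact_gt0.
move=> t; rewrite /flat; case: ifPn => [t0|_]; last first.
  by rewrite normr0 mulr_ge0// ?sqr_ge0.
rewrite ger0_norm; last by rewrite mulr_ge0 ?expR_ge0// invr_ge0 exprn_ge0 ?ltW.
rewrite expRN ler_pdivrMr ?expR_gt0//.
have tV0 : 0 <= t^-1 by rewrite invr_ge0 ltW.
have H : t^-1 ^+ k.+2 / k.+2`!%:R <= expR t^-1.
  by apply: le_trans (expR_ge1Dxn k.+1 tV0); rewrite lerDr.
rewrite ler_pdivrMr ?ltr0n ?fact_gt0// exprVn in H.
have := ler_wpM2l (sqr_ge0 t) H.
have -> : t ^+ 2 / t ^+ k.+2 = t ^- k.
  by rewrite -(addn2 k) exprD invfM mulrCA divff ?mulr1// sqrf_eq0 gt_eqF.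
by move=> H'; rewrite -mulrA mulrCA [_%:R * _]mulrC.
Qed.

Lemma is_derive_flat (k : nat) (t : R) :
  is_derive t (1 : R) (flat k) (flat k.+2 t - k%:R * flat k.+1 t).
Proof.
have [t0|t0|->] := ltgtP t 0.
- rewrite /flat ltNge (ltW t0)/= mulr0 subrr.
  apply: (@near_eq_is_derive _ _ _ (cst 0)).
  by near=> y; rewrite /flat ifF//; apply/negbTE; rewrite -leNgt ltW//;
    near: y; exact: lt_nbhsl.
- have -> : flat k.+2 t = t ^- k.+2 * expR (- t^-1) by rewrite /flat t0.
  have -> : flat k.+1 t = t ^- k.+1 * expR (- t^-1) by rewrite /flat t0.
  apply: (@near_eq_is_derive R R R
    ((fun t => t^-1) ^+ k * (expR \o (fun t => - t^-1)))).
    near=> y; rewrite /flat ifT ?fctE ?exprVn//; near: y; exact: lt_nbhsr.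
  have tn0 : t != 0 by rewrite gt_eqF.
  have dV : is_derive t 1 (fun y : R => y^-1) (- t ^- 2).
    by have := is_deriveV tn0 (is_derive_id t (1 : R)); rewrite /GRing.scale/= mulr1.
  have dX := is_deriveX k dV.
  have dE : is_derive t 1 (expR \o (fun y => - y^-1)) (expR (- t^-1) * t ^- 2).
    apply: is_derive1_comp; have := is_deriveN dV; rewrite opprK//.
  have dM := is_deriveM dX dE; apply: (is_derive_eq dM) => /=.
  rewrite /GRing.scale/= !fctE -?exprVn.
  move: {dM dX dE dV} (t^-1) => s.
  by case: k => [|k]; rewrite /= ?exprS ?expr0; ring.
- have f0 j : flat j 0 = 0 by rewrite /flat ltxx.
  rewrite !f0 mulr0 subr0.
  have [C C0 HC] := flat_le k.
  (* At 0 the quadratic bound makes [flat k] negligible against t, so its differential there is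
     zero. *)
  have E : flat k \o shift 0 = cst (flat k 0) + (\0 : {linear R -> R}) +o_ (0:R) id.
    apply/eqaddoP => _/posnumP[e].
    have : \forall y \near (0 : R), `|y| <= e%:num / C.
      by apply: nbhs0_le; rewrite divr_gt0.
    apply: filterS => y /= hy; rewrite !fctE /= addr0 f0 /cst !addr0 subr0.
    apply: le_trans (HC _) _; rewrite -real_normK ?num_real//.
    by rewrite expr2 mulrA ler_wpM2r// mulrC -ler_pdivlMr.
  have dh : 'd (flat k) (0:R) = (\0 : {linear R -> R}) :> (R -> R).
    by apply: diff_unique => // y; exact: cst_continuous.
  have df : differentiable (flat k) (0 : R).
    by apply/diff_locallyP; rewrite dh; split => // y; exact: cst_continuous.
  apply: DeriveDef; first exact: diff_derivable.
  by rewrite deriveE// dh.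
Unshelve. all: by end_near. Qed.

Lemma ndifferentiable_flat V k (D : set V) (a : V -> R) m : open D ->
  ndifferentiable k D a -> ndifferentiable k D (flat m \o a).
Proof.
move=> oD; elim: k m => // k IH m dda; have [da Da] := dda.
have df t : differentiable (flat m) t.
  by apply/derivable1_diffP; have [] := is_derive_flat m t.
split=> [x Dx|v]; first by apply: differentiable_comp; [exact: da|exact: df].
have h := ndifferentiableM oD (Da v) (ndifferentiableD oD
  (IH m.+2 (ndifferentiableW dda))
  (ndifferentiableN oD (ndifferentiableM oD (ndifferentiable_cst k D (m%:R : R))
     (IH m.+1 (ndifferentiableW dda))))).
apply: (eq_ndifferentiable oD _ h) => x Dx.
have dax := da _ Dx; have dfx := df (a x).
rewrite [in RHS]deriveE; last exact: differentiable_comp.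
rewrite diff_comp//= diff1E// derive1E -deriveE//.
by have [_ ->] := is_derive_flat m (a x).
Qed.

End ndiff.

(** * Smooth cutoff functions *)

Section step.
Variable R : realType.
Implicit Types t : R.

Lemma flat_ge0 k t : 0 <= flat k t.
Proof.
rewrite /flat; case: ifPn => // t0.
by rewrite mulr_ge0 ?expR_ge0// invr_ge0 exprn_ge0 ?ltW.
Qed.

Lemma flat_gt0 k t : 0 < t -> 0 < flat k t.
Proof. by move=> t0; rewrite /flat t0 mulr_gt0 ?expR_gt0// invr_gt0 exprn_gt0. Qed.

Lemma flat_eq0 k t : t <= 0 -> flat k t = 0.
Proof. by rewrite /flat leNgt => /negbTE ->. Qed.

(** The usual smooth transition function built from exp (- 1 / t) = [flat 0 t]. It is constant below
    1/3 and above 2/3, and every later gluing happens in these two ranges. *)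
Definition step t : R :=
  flat 0 (t - 3^-1) / (flat 0 (t - 3^-1) + flat 0 (2 / 3 - t)).

Lemma step_denom_gt0 t : 0 < flat 0 (t - 3^-1) + flat 0 (2 / 3 - t).
Proof.
have [t13|t13] := ltP (3^-1) t.
  by apply: ltr_wpDr; rewrite ?flat_ge0// flat_gt0// subr_gt0.
by apply: ltr_wpDl; rewrite ?flat_ge0// flat_gt0// subr_gt0; lra.
Qed.

Lemma step0 t : t <= 3^-1 -> step t = 0.
Proof. by move=> t13; rewrite /step flat_eq0 ?mul0r// subr_le0. Qed.

Lemma step1 t : 2 / 3 <= t -> step t = 1.
Proof.
move=> t23; have := step_denom_gt0 t.
rewrite /step [flat 0 (2 / 3 - t)]flat_eq0 ?subr_le0// addr0 => /gt_eqF h.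
by rewrite divff// h.
Qed.

Lemma step_ge0 t : 0 <= step t.
Proof. by rewrite divr_ge0 ?addr_ge0 ?flat_ge0. Qed.

Lemma step_le1 t : step t <= 1.
Proof. by rewrite ler_pdivrMr ?step_denom_gt0// mul1r lerDl flat_ge0. Qed.

End step.

(** * Smooth maps between normed spaces *)

Section smooth_maps.
Variable R : realType.
Implicit Types U V W : normedModType R.

(* Smoothness of maps between normed spaces is tested on smooth maps from open
   subsets of the spaces 'rV[R]_m, the domains of plots. *)
Definition sm V W (c : V -> W) : Prop :=
  forall m (U : set 'rV[R]_m) (h : 'rV[R]_m -> V),
    open U -> smooth_on U h -> smooth_on U (c \o h).

Lemma sm_id V : sm (@id V). Proof. by []. Qed.

Lemma sm_comp U V W (b : V -> W) (c : U -> V) : sm b -> sm c -> sm (b \o c).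
Proof. by move=> sb sc m D h oD sh; apply: sb => //; exact: sc. Qed.

Lemma sm_cst V W (w : W) : sm (fun _ : V => w).
Proof. by move=> m D h oD sh k; exact: ndifferentiable_cst. Qed.

Lemma sm_fst V W1 W2 (c : V -> W1 * W2) : sm c -> sm (fun v => (c v).1).
Proof. by move=> sc m D h oD sh k; apply: ndifferentiable_fst => //; exact: sc. Qed.

Lemma sm_snd V W1 W2 (c : V -> W1 * W2) : sm c -> sm (fun v => (c v).2).
Proof. by move=> sc m D h oD sh k; apply: ndifferentiable_snd => //; exact: sc. Qed.

Lemma sm_pair V W1 W2 (b : V -> W1) (c : V -> W2) :
  sm b -> sm c -> sm (fun v => (b v, c v)).
Proof.
move=> sb sc m D h oD sh k.
by apply: (ndifferentiable_pair oD (f := b \o h) (g := c \o h)); [exact: sb|exact: sc].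
Qed.

Lemma sm_coord V n (c : V -> 'rV[R]_n) i : sm c -> sm (fun v => c v ord0 i : R).
Proof.
move=> sc m D h oD sh k.
by apply: (ndifferentiable_coord i oD (f := c \o h)); exact: sc.
Qed.

Lemma sm_row V n (c : V -> 'I_n -> R) :
  (forall i, sm (fun v => c v i)) -> sm (fun v => \row_i c v i).
Proof.
move=> sc m D h oD sh k.
have H : ndifferentiable k D (\sum_(i < n)
    (fun x => c (h x) i *: (delta_mx 0 i : 'rV[R]_n))).
  apply: ndifferentiable_sum => // i; apply: ndifferentiable_scale => //.
    exact: sc.
  exact: ndifferentiable_cst.
apply: (eq_ndifferentiable oD _ H) => x Dx.
by rewrite fct_sumE /= [RHS]row_sum_delta; apply: eq_bigr => i _; rewrite mxE.
Qed.

Lemma smD V (a b : V -> R) : sm a -> sm b -> sm (fun v => a v + b v).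
Proof.
move=> sa sb m D h oD sh k.
by apply: (ndifferentiableD oD (f := a \o h) (g := b \o h)); [exact: sa|exact: sb].
Qed.

Lemma smN V (a : V -> R) : sm a -> sm (fun v => - a v).
Proof.
by move=> sa m D h oD sh k; apply: (ndifferentiableN oD (a := a \o h)); exact: sa.
Qed.

Lemma smM V (a b : V -> R) : sm a -> sm b -> sm (fun v => a v * b v).
Proof.
move=> sa sb m D h oD sh k.
by apply: (ndifferentiableM oD (a := a \o h) (b := b \o h)); [exact: sa|exact: sb].
Qed.

Lemma smV V (a : V -> R) : (forall v, a v != 0) -> sm a -> sm (fun v => (a v)^-1).
Proof.
move=> a0 sa m D h oD sh k.
by apply: (ndifferentiableV oD (a := a \o h)) => [x _|]; [exact: a0|exact: sa].
Qed.

Lemma sm_flat V (a : V -> R) k : sm a -> sm (fun v => flat k (a v)).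
Proof.
move=> sa m D h oD sh i.
by apply: (ndifferentiable_flat k oD (a := a \o h)); exact: sa.
Qed.

Lemma sm_step V (a : V -> R) : sm a -> sm (fun v => step (a v)).
Proof.
move=> sa; apply: smM; first by apply/sm_flat/smD => //; exact: sm_cst.
apply: smV => [v|]; first by rewrite gt_eqF ?step_denom_gt0.
apply: smD; apply: sm_flat; apply: smD => //; try exact: sm_cst.
exact: smN.
Qed.

Lemma sm_sum V I (r : seq I) (P : pred I) (a : I -> V -> R) :
  (forall i, sm (a i)) -> sm (fun v => \sum_(i <- r | P i) a i v).
Proof.
move=> sa; elim: r => [|i r IH].
  by under eq_fun do rewrite big_nil; exact: sm_cst.
under eq_fun do rewrite big_cons; case: (P i) => //.
exact: smD.
Qed.

Lemma sm_prod V I (r : seq I) (P : pred I) (a : I -> V -> R) :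
  (forall i, sm (a i)) -> sm (fun v => \prod_(i <- r | P i) a i v).
Proof.
move=> sa; elim: r => [|i r IH].
  by under eq_fun do rewrite big_nil; exact: sm_cst.
under eq_fun do rewrite big_cons; case: (P i) => //.
exact: smM.
Qed.

Lemma smooth_on_continuous V n (U : set 'rV[R]_n) (h : 'rV[R]_n -> V) x :
  smooth_on U h -> U x -> {for x, continuous h}.
Proof. by move=> /(_ 1) [dh _] /dh; exact: differentiable_continuous. Qed.

Lemma smooth_on_preimage_open V n (U : set 'rV[R]_n) (h : 'rV[R]_n -> V) O :
  open U -> smooth_on U h -> open O -> open (U `&` h @^-1` O).
Proof.
move=> oU sh oO; rewrite openE => x [Ux Ox]; apply: filterI.
  exact: open_nbhs_nbhs.
by apply: (smooth_on_continuous sh Ux); exact: open_nbhs_nbhs.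
Qed.

End smooth_maps.

Section topen.
Variable R : realType.
Implicit Types V W : normedModType R.

(** Openness for the final topology of the smooth maps that test [sm]. Sets cut out by strict
    inequalities between a smooth function and a constant have it. *)
Definition topen V (O : set V) : Prop :=
  forall m (U : set 'rV[R]_m) (h : 'rV[R]_m -> V),
    open U -> smooth_on U h -> open (U `&` h @^-1` O).

Lemma topen_lt V (a : V -> R) c : sm a -> topen [set v | a v < c].
Proof.
move=> sa m U h oU sh.
exact: (smooth_on_preimage_open oU (sa _ _ _ oU sh) (@open_lt R c)).
Qed.

Lemma topen_gt V (a : V -> R) c : sm a -> topen [set v | c < a v].
Proof.
move=> sa m U h oU sh.
exact: (smooth_on_preimage_open oU (sa _ _ _ oU sh) (@open_gt R c)).
Qed.

Lemma topenI V (O P : set V) : topen O -> topen P -> topen (O `&` P).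
Proof.
move=> oO oP m U h oU sh; rewrite preimage_setI -(setIid U) setIACA.
by apply: openI; [exact: oO|exact: oP].
Qed.

Lemma topen_forall V n (O : 'I_n -> set V) :
  (forall i, topen (O i)) -> topen [set v | forall i, O i v].
Proof.
move=> oO m U h oU sh; rewrite openE => x [Ux Ox]; apply: filterI.
  exact: open_nbhs_nbhs.
apply: (@filter_forall _ _ (fun i y => O i (h y)) (nbhs x)) => i.
apply: filterS (open_nbhs_nbhs (conj (oO i m U h oU sh) _)).
  by move=> y [].
by split => //; exact: Ox.
Qed.

End topen.

(** * Smooth maps from subsets of normed spaces to diffeological spaces *)

Section smooth_on_subsets.
Variables (R : realType).
Implicit Types (V W : normedModType R) (X Y : diffeologicalType R).

(* [f] is total, but only its restriction to the subspace [T] matters. *)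
Definition smon V X (T : set V) (f : V -> X) : Prop :=
  forall m (U : set 'rV[R]_m) (h : 'rV[R]_m -> V),
    open U -> smooth_on U h -> (forall u, U u -> T (h u)) ->
    plot (fun u : U => f (h (val u))).

Lemma smon_comp V W X (S : set V) (T : set W) (f : W -> X) (c : V -> W) :
  smon T f -> sm c -> (forall v, S v -> T (c v)) -> smon S (fun v => f (c v)).
Proof.
move=> sf sc ST m U h oU sh hS.
by apply: (sf m U (c \o h)) => // [|u /hS/ST//]; exact: sc.
Qed.

Lemma sub_smon V X (S T : set V) (f : V -> X) : S `<=` T -> smon T f -> smon S f.
Proof. by move=> ST sf m U h oU sh hS; apply: sf => // u /hS/ST. Qed.

Lemma smon_smooth V X Y (T : set V) (f : V -> X) (phi : X -> Y) :
  smooth phi -> smon T f -> smon T (fun v => phi (f v)).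
Proof. by move=> sphi sf m U h oU sh hT; exact: (sphi _ _ _ (sf m U h oU sh hT)). Qed.

Lemma smon_cst V X (T : set V) (x : X) : smon T (fun _ => x).
Proof. by move=> m U h oU sh hT; exact: plot_cst. Qed.

(** This is the locality axiom of plots, pulled back along a test map. Near each point [f] may be
    traded for another function [g] whose smoothness is known. *)
Lemma smon_local V X (T : set V) (f : V -> X) :
  (forall v, T v -> exists Q (g : V -> X), [/\ topen Q, Q v, smon (T `&` Q) g
     & forall w, T w -> Q w -> f w = g w]) ->
  smon T f.
Proof.
move=> loc m U h oU sh hT; apply: plot_local => // u.
have Uu : U (val u) := set_valP u.
have [Q [g [oQ Ou sg fg]]] := loc _ (hT _ Uu).
set U' := U `&` h @^-1` Q.
have VU : set_fun U' U id by move=> x [].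
exists U', VU => //.
have oU' : open U' by exact: oQ.
have sh' : smooth_on U' h by move=> k; apply: sub_ndifferentiable (sh k) => x [].
have hT' w : U' w -> (T `&` Q) (h w) by move=> [/hT].
have := sg m U' h oU' sh' hT'.
rewrite (_ : (fun _ => _) = (fun u0 : U => f (h (val u0))) \o restriction VU)//.
apply/funext => w /=.
have [Uw Ow] : U' (val w) := set_valP w.
by rewrite -fg//; exact: hT.
Qed.

Lemma smon_glue V X (T : set V) (f g h : V -> X) (O P : set V) :
  topen O -> topen P -> (forall v, T v -> O v \/ P v) ->
  smon (T `&` O) g -> smon (T `&` P) h ->
  (forall v, T v -> O v -> f v = g v) -> (forall v, T v -> P v -> f v = h v) ->
  smon T f.
Proof.
move=> oO oP TOP sg sh fg fh; apply: smon_local => v Tv.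
by have [Ov|Pv] := TOP _ Tv; [exists O, g|exists P, h].
Qed.

End smooth_on_subsets.

(** * Cubes *)

Ltac solve_sm := repeat first
  [ exact: sm_id | exact: sm_cst | assumption | apply: sm_row => ?
  | apply: sm_coord | apply: sm_fst | apply: sm_snd | apply: sm_pair
  | apply: sm_step | apply: smM | apply: smN | apply: smD
  | apply: sm_prod => ? | apply: sm_sum => ?
  | match goal with h : sm _ |- _ => apply: (sm_comp h) end ].

Section cubes.
Variable R : realType.

Lemma step01 (t : R) : 0 <= step t <= 1.
Proof. by rewrite step_ge0 step_le1. Qed.

Definition I01 : set R := [set t | 0 <= t <= 1].

Definition bd n : set 'rV[R]_n :=
  [set x | cube R n x /\ exists i, x ord0 i = 0 \/ x ord0 i = 1].

Definition box n : set ('rV[R]_n * R) := [set p | cube R n p.1 /\ I01 p.2].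

Definition pan n : set ('rV[R]_n * R) :=
  [set p | box p /\ (p.2 = 0 \/ bd p.1)].

Definition pw n (r : R -> R) (x : 'rV[R]_n) : 'rV[R]_n := \row_i r (x ord0 i).

(** These conditions are preserved by convex combinations, so linear interpolation to the identity
    stays among reparametrizations. *)
Definition repar (r : R -> R) : Prop :=
  [/\ sm r, r 0 = 0, r 1 = 1 & forall t, I01 t -> I01 (r t)].

Lemma sm_repar (V : normedModType R) (r : R -> R) (a : V -> R) :
  sm r -> sm a -> sm (fun v => r (a v)).
Proof. by move=> sr sa; exact: (sm_comp sr sa). Qed.

Lemma sm_pw (V : normedModType R) n (r : R -> R) (a : V -> 'rV[R]_n) :
  sm r -> sm a -> sm (fun v => pw r (a v)).
Proof. by move=> sr sa; apply: sm_row => i; apply: sm_repar => //; solve_sm. Qed.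

Lemma cube_pw n (r : R -> R) (x : 'rV[R]_n) :
  (forall i, I01 (r (x ord0 i))) -> cube R n (pw r x).
Proof. by move=> H i; rewrite mxE; exact: H. Qed.

Lemma repar_sm r : repar r -> sm r.
Proof. by case. Qed.

Lemma repar_cube n r (x : 'rV[R]_n) : repar r -> cube R n x -> cube R n (pw r x).
Proof. by move=> [_ _ _ Ir] cx; apply: cube_pw => i; apply: Ir; exact: cx. Qed.

Lemma repar_bd n r (x : 'rV[R]_n) : repar r -> bd x -> bd (pw r x).
Proof.
move=> rr [cx [i xi]]; split; first exact: repar_cube.
by have [_ r0 r1 _] := rr; exists i; rewrite mxE; case: xi => ->; [left|right].
Qed.

Lemma repar_pan n r r' (p : 'rV[R]_n * R) : repar r -> repar r' ->
  pan p -> pan (pw r p.1, r' p.2).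
Proof.
move=> rr rr' [[cp Ip] H]; split; first split => /=; first exact: repar_cube.
  by have [_ _ _] := rr'; exact.
by have [_ r0 _ _] := rr'; case: H => [->|/(repar_bd rr)]; [left|right].
Qed.

Lemma repar_comp r r' : repar r -> repar r' -> repar (r \o r').
Proof.
move=> [sr r0 r1 Ir] [sr' r0' r1' Ir']; split => /=; rewrite ?r0' ?r1'//.
  exact: sm_comp.
by move=> t /Ir'/Ir.
Qed.

Lemma repar_id : repar id.
Proof. by split. Qed.

(** These serve to place a small box inside the cylinder: [2 * t - 1] sends the upper half of
    [0, 1], and [3 * t - 1] its middle third, onto [0, 1]. *)
Definition step2 (t : R) := step (2 * t - 1).
Definition step3 (t : R) := step (3 * t - 1).

Lemma repar_step : repar (@step R).
Proof.
split; [exact: (@sm_step R R id (@sm_id R R))| | |move=> t _; exact: step01].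
- by rewrite step0// invr_ge0.
- by rewrite step1// ler_pdivrMr// mul1r ler_nat.
Qed.

Lemma repar_step2 : repar step2.
Proof.
split; [by rewrite /step2; solve_sm| | |move=> t _; exact: step01].
- by rewrite /step2 step0//; lra.
- by rewrite /step2 step1//; lra.
Qed.

Lemma repar_step3 : repar step3.
Proof.
split; [by rewrite /step3; solve_sm| | |move=> t _; exact: step01].
- by rewrite /step3 step0//; lra.
- by rewrite /step3 step1//; lra.
Qed.

Lemma cube_step n (x : 'rV[R]_n) : cube R n (pw (@step R) x).
Proof. by apply: cube_pw => i; exact: step01. Qed.

Lemma bd_step n (x : 'rV[R]_n) i :
  (x ord0 i <= 3^-1 \/ 2 / 3 <= x ord0 i) -> bd (pw (@step R) x).
Proof.
move=> H; split; first exact: cube_step.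
by exists i; rewrite mxE; case: H => [/step0|/step1]; [left|right].
Qed.

(* A smooth substitute for the distance to the unit cube. *)
Definition lam (t : R) := step (- t) + step (t - 1).
Definition dst n (x : 'rV[R]_n) := 1 - \prod_i (1 - lam (x ord0 i)).

Lemma sm_lam (V : normedModType R) (a : V -> R) : sm a -> sm (fun v => lam (a v)).
Proof. by move=> sa; rewrite /lam; solve_sm. Qed.

Lemma sm_dst (V : normedModType R) n (a : V -> 'rV[R]_n) :
  sm a -> sm (fun v => dst (a v)).
Proof. by move=> sa; rewrite /dst; solve_sm; apply: sm_lam; solve_sm. Qed.

Lemma lam01 t : 0 <= lam t <= 1.
Proof.
have /andP[a0 a1] := step01 (- t); have /andP[b0 b1] := step01 (t - 1).
rewrite /lam addr_ge0//=.
have [t0|t0] := leP t 1; first by rewrite [step (t - 1)]step0 ?addr0//; lra.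
by rewrite [step (- t)]step0 ?add0r//; lra.
Qed.

Lemma lam_eq0 t : - 3^-1 <= t <= 4 / 3 -> lam t = 0.
Proof. by move=> /andP[t0 t1]; rewrite /lam !step0 ?addr0//; lra. Qed.

Lemma lam_eq1 t : t <= - (2 / 3) \/ 5 / 3 <= t -> lam t = 1.
Proof.
move=> [t0|t0]; rewrite /lam.
  by rewrite step1 ?[step (t - 1)]step0 ?addr0//; lra.
by rewrite step0 ?[step (t - 1)]step1 ?add0r//; lra.
Qed.

Lemma dst01 n (x : 'rV[R]_n) : 0 <= dst x <= 1.
Proof.
have H i : 0 <= 1 - lam (x ord0 i) <= 1 by have /andP[] := lam01 (x ord0 i); lra.
have : 0 <= \prod_i (1 - lam (x ord0 i)) <= 1.
  by apply/andP; split; [apply: prodr_ge0|apply: prodr_ile1] => i _; have /andP[] := H i.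
by rewrite /dst; lra.
Qed.

Lemma dst_eq0 n (x : 'rV[R]_n) :
  (forall i, - 3^-1 <= x ord0 i <= 4 / 3) -> dst x = 0.
Proof.
by move=> H; rewrite /dst big1 ?subrr// => i _; rewrite lam_eq0 ?subr0//; exact: H.
Qed.

Lemma cube_dst n (x : 'rV[R]_n) : cube R n x -> dst x = 0.
Proof. by move=> cx; apply: dst_eq0 => i; have /andP[] := cx i; lra. Qed.

Lemma dst_eq1 n (x : 'rV[R]_n) i :
  x ord0 i <= - (2 / 3) \/ 5 / 3 <= x ord0 i -> dst x = 1.
Proof.
by move=> H; rewrite /dst (bigD1 i)//= lam_eq1// subrr mul0r subr0.
Qed.

(** The thresholds of [dst] and [step] are matched: as soon as the collar parameter is nonzero,
    [step] has already pressed the point onto the boundary, where a homotopy given only there can be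
    applied. *)
Lemma dst_bd n (x : 'rV[R]_n) : dst x <> 0 -> bd (pw (@step R) x).
Proof.
move=> H; have [i Hi] : exists i, ~ (- 3^-1 <= x ord0 i <= 4 / 3).
  by apply: contrapT => /forallNP H'; apply/H/dst_eq0 => i; exact: contrapT (H' i).
apply: (@bd_step _ _ i); have [xi|xi] := leP (x ord0 i) 3^-1; [by left|right].
by rewrite leNgt; apply/negP => xi'; apply: Hi; apply/andP; split; lra.
Qed.

(* A smooth substitute for the maximum on [0, 1]. *)
Definition osum (s t : R) := 1 - (1 - s) * (1 - t).

Lemma osum01 s t : I01 s -> I01 t -> I01 (osum s t).
Proof.
rewrite /I01/= /osum => /andP[s0 s1] /andP[t0 t1].
have : 0 <= (1 - s) * (1 - t) by rewrite mulr_ge0// subr_ge0.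
have : (1 - s) * (1 - t) <= 1 by apply: mulr_ile1; lra.
by move=> *; apply/andP; split; lra.
Qed.

Lemma osum0 t : osum 0 t = t. Proof. by rewrite /osum; ring. Qed.
Lemma osumr0 t : osum t 0 = t. Proof. by rewrite /osum; ring. Qed.
Lemma osum1 t : osum 1 t = 1. Proof. by rewrite /osum; ring. Qed.
Lemma osumr1 t : osum t 1 = 1. Proof. by rewrite /osum; ring. Qed.

Lemma sm_osum (V : normedModType R) (a b : V -> R) :
  sm a -> sm b -> sm (fun v => osum (a v) (b v)).
Proof. by move=> sa sb; rewrite /osum; solve_sm. Qed.

End cubes.
Arguments I01 {R}.
Arguments bd {R}.
Arguments box {R}.
Arguments pan {R}.

(** * Lifting problems *)

Section lifting.
Variables (R : realType) (X Y : diffeologicalType R) (phi : X -> Y).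
Variables (A : set X) (B : set Y).
Notation step := (@step R).
Notation step2 := (@step2 R).
Notation step3 := (@step3 R).

(* [F] is a map f on the bottom of [pan n], together with a homotopy from its
   restriction to the boundary to [phi \o g] on the sides. *)
Record problem n (F : 'rV[R]_n * R -> Y) (g : 'rV[R]_n -> X) : Prop := Problem {
  problem_smonF : smon (pan n) F ;
  problem_smong : smon (bd n) g ;
  problem_inB : forall p, pan n p -> B (F p) ;
  problem_inA : forall x, bd n x -> A (g x) ;
  problem_top : forall x, bd n x -> F (x, 1) = phi (g x) }.

Record extension n (F : 'rV[R]_n * R -> Y) (g : 'rV[R]_n -> X)
    (H : 'rV[R]_n * R -> Y) (G : 'rV[R]_n -> X) : Prop := Extension {
  extension_smonH : smon (box n) H ;
  extension_smonG : smon (cube R n) G ;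
  extension_inB : forall p, box n p -> B (H p) ;
  extension_inA : forall x, cube R n x -> A (G x) ;
  extension_top : forall x, cube R n x -> H (x, 1) = phi (G x) ;
  extension_pan : forall p, pan n p -> H p = F p ;
  extension_bd : forall x, bd n x -> G x = g x }.

Record homotopy n (T : 'rV[R]_n * R * R -> Y) (k : 'rV[R]_n * R -> X) : Prop :=
    Homotopy {
  homotopy_smonT : smon [set p | pan n p.1 /\ I01 p.2] T ;
  homotopy_smonk : smon [set p | bd n p.1 /\ I01 p.2] k ;
  homotopy_inB : forall p s, pan n p -> I01 s -> B (T (p, s)) ;
  homotopy_inA : forall x s, bd n x -> I01 s -> A (k (x, s)) ;
  homotopy_top : forall x s, bd n x -> I01 s -> T (x, 1, s) = phi (k (x, s)) }.

Definition extends n (F : 'rV[R]_n * R -> Y) (g : 'rV[R]_n -> X) : Prop :=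
  exists H G, extension F g H G.

Lemma I01_0 : I01 (0 : R). Proof. by rewrite /I01/= lexx ler01. Qed.
Lemma I01_1 : I01 (1 : R). Proof. by rewrite /I01/= lexx ler01. Qed.

Lemma I01_onem (t : R) : I01 t -> I01 (1 - t).
Proof. by rewrite /I01/= => /andP[t0 t1]; apply/andP; split; lra. Qed.

Definition aff n (x : 'rV[R]_n) := pw (fun t => 3 * t - 1) x.

Lemma pw_step3 n (x : 'rV[R]_n) : pw step3 x = pw step (aff x).
Proof. by apply/rowP => i; rewrite !mxE. Qed.

Lemma sm_aff (V : normedModType R) n (c : V -> 'rV[R]_n) :
  sm c -> sm (fun v => aff (c v)).
Proof. by move=> sc; apply: sm_row => i; solve_sm. Qed.

Lemma dst_aff_bd n (x : 'rV[R]_n) : bd n x -> dst (aff x) = 1.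
Proof.
move=> [cx [i xi]]; apply: (@dst_eq1 _ _ _ i); rewrite mxE.
by case: xi => ->; [left|right]; lra.
Qed.

(* The extension at the end of a homotopy is put in a small cube, and the homotopy
   is run backwards in the collar around it, on the sides and below. *)
Section collar.
Variables (n : nat) (T : 'rV[R]_n * R * R -> Y) (k : 'rV[R]_n * R -> X).
Variables (H : 'rV[R]_n * R -> Y) (G : 'rV[R]_n -> X).
Hypotheses (hTk : homotopy T k).
Hypothesis (ext : extension (fun p => T (p, 1)) (fun x => k (x, 1)) H G).

Let c (p : 'rV[R]_n * R) := (pw step3 p.1, step2 p.2).
(** The collar time, equal to 0 on the small box and to 1 on the pan. Wherever it is nonzero, [c]
    takes values in the pan, so that [T] at time [1 - d] makes sense. *)
Let d (p : 'rV[R]_n * R) := osum (dst (aff p.1)) (step (1 - 2 * p.2)).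

Let sm_c : sm c.
Proof.
rewrite /c; apply: sm_pair; [apply: sm_pw|apply: sm_repar]; try solve_sm;
  by [have [] := repar_step3 R|have [] := repar_step2 R].
Qed.

Let sm_d : sm d.
Proof. by rewrite /d; apply: sm_osum; [apply/sm_dst/sm_aff; solve_sm|solve_sm]. Qed.

Let d01 p : I01 (d p).
Proof. by apply: osum01; [exact: dst01|exact: step01]. Qed.

Let box_c p : box n (c p).
Proof. by split => /=; [rewrite pw_step3; exact: cube_step|exact: step01]. Qed.

Let pan_c p : d p <> 0 -> pan n (c p).
Proof.
move=> dp; split; first exact: box_c.
have [d0|d0] := pselect (dst (aff p.1) = 0); last first.
  by right => /=; rewrite pw_step3; exact: dst_bd.
left => /=; rewrite /step2 step0// leNgt; apply/negP => p0; apply: dp.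
by rewrite /d d0 step0 ?osum0//; lra.
Qed.

Let H' p := if d p == 0 then H (c p) else T (c p, 1 - d p).
Let G' x := if dst (aff x) == 0 then G (pw step3 x)
  else k (pw step3 x, 1 - dst (aff x)).

(** Both branches are [T] at time 1 where [d] vanishes and [c] is in the pan: here the extension
    meets the homotopy. *)
Let H'E p : pan n (c p) -> H' p = T (c p, 1 - d p).
Proof.
move=> pc; rewrite /H'; case: eqP => // ->.
by rewrite subr0 (extension_pan ext).
Qed.

Let G'E x : bd n (pw step3 x) -> G' x = k (pw step3 x, 1 - dst (aff x)).
Proof.
move=> pc; rewrite /G'; case: eqP => // ->.
by rewrite subr0 (extension_bd ext).
Qed.

Let smon_T (S : set ('rV[R]_n * R)) : (forall p, S p -> pan n (c p)) ->
  smon S (fun p => T (c p, 1 - d p)).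
Proof.
move=> S_c; apply: (smon_comp (homotopy_smonT hTk) (c := fun p => (c p, 1 - d p))).
  by solve_sm.
by move=> p Sp; split => /=; [exact: S_c|exact: I01_onem].
Qed.

Let smon_k (S : set 'rV[R]_n) : (forall x, S x -> bd n (pw step3 x)) ->
  smon S (fun x => k (pw step3 x, 1 - dst (aff x))).
Proof.
move=> S_c; apply: (smon_comp (homotopy_smonk hTk)
  (c := fun x => (pw step3 x, 1 - dst (aff x)))).
  apply: sm_pair; first by apply: sm_pw; [have [] := repar_step3 R|solve_sm].
  by solve_sm; apply/sm_dst/sm_aff; solve_sm.
by move=> x Sp; split => /=; [exact: S_c|apply: I01_onem; exact: dst01].
Qed.

Let side_bd (x : 'rV[R]_n) i :
  aff x ord0 i < 3^-1 \/ 2 / 3 < aff x ord0 i -> bd n (pw step3 x).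
Proof.
rewrite pw_step3 => h; apply: (bd_step (i := i)).
by case: h => h; [left|right]; exact: ltW.
Qed.

Let smon_H' : smon (box n) H'.
Proof.
apply: smon_local => p bp.
have sa i : sm (fun p : 'rV[R]_n * R => aff p.1 ord0 i).
  by apply: sm_coord; apply: sm_aff; solve_sm.
have pan_local (Q : set ('rV[R]_n * R)) : topen Q -> Q p ->
    (forall q, Q q -> pan n (c q)) ->
    exists Q (g : 'rV[R]_n * R -> Y), [/\ topen Q, Q p, smon (box n `&` Q) g
     & forall w, box n w -> Q w -> H' w = g w].
  move=> oQ Qp Qc; exists Q, (fun p => T (c p, 1 - d p)); split => //.
    by apply: smon_T => q [_]; exact: Qc.
  by move=> q _ /Qc; exact: H'E.
have [[i pi]|ni1] := pselect (exists i, aff p.1 ord0 i < 3^-1).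
  apply: (pan_local [set q | aff q.1 ord0 i < 3^-1]) => //.
    exact: (topen_lt (sa i)).
  move=> q /= qi; split; first exact: box_c.
  by right => /=; apply: (@side_bd _ i); left.
have [[i pi]|ni2] := pselect (exists i, 2 / 3 < aff p.1 ord0 i).
  apply: (pan_local [set q | 2 / 3 < aff q.1 ord0 i]) => //.
    exact: (topen_gt (sa i)).
  move=> q /= qi; split; first exact: box_c.
  by right => /=; apply: (@side_bd _ i); right.
have [pt|pt] := ltP (- 3^-1) (1 - 2 * p.2).
  apply: (pan_local [set q | - 3^-1 < 1 - 2 * q.2]) => //.
    by apply: (topen_gt (a := fun q : 'rV[R]_n * R => 1 - 2 * q.2)); solve_sm.
  move=> q /= qi; split; first exact: box_c.
  by left => /=; rewrite /step2 step0//; lra.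
(* What remains are points with all coordinates of [aff p.1] in [1/3, 2/3] and height at least 2/3.
   On the larger open set [O] the collar time is identically 0. *)
pose O := [set q : 'rV[R]_n * R | forall i,
  - 3^-1 < aff q.1 ord0 i < 4 / 3] `&` [set q | 1 - 2 * q.2 < 3^-1].
exists O, (fun q => H (c q)); split.
- apply: topenI.
    apply: (@topen_forall _ _ _
      (fun i => [set q : 'rV[R]_n * R | - 3^-1 < aff q.1 ord0 i < 4 / 3])) => i.
    rewrite (_ : [set q : 'rV[R]_n * R | _] =
      [set q | - 3^-1 < aff q.1 ord0 i] `&` [set q | aff q.1 ord0 i < 4 / 3]).
      by apply: topenI; [exact: (topen_gt (sa i))|exact: (topen_lt (sa i))].
    by apply/seteqP; split => q /= => [/andP[]|[? ?]]//; apply/andP.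
  by apply: (topen_lt (a := fun q : 'rV[R]_n * R => 1 - 2 * q.2)); solve_sm.
- split => /=; last by lra.
  move=> i; have h1 : ~~ (aff p.1 ord0 i < 3^-1) by apply/negP => h; apply: ni1; exists i.
  have h2 : ~~ (2 / 3 < aff p.1 ord0 i) by apply/negP => h; apply: ni2; exists i.
  by rewrite -leNgt in h1; rewrite -leNgt in h2; apply/andP; split; lra.
- apply: (smon_comp (extension_smonH ext) sm_c) => q _; exact: box_c.
- move=> q _ [/= Oq qt]; rewrite /H' ifT//.
  rewrite /d step0 ?osumr0 1?dst_eq0//; last by lra.
  by move=> i; have /andP[h1 h2] := Oq i; apply/andP; split; exact: ltW.
Qed.

Let smon_G' : smon (cube R n) G'.
Proof.
apply: smon_local => p bp.
have sa i : sm (fun p : 'rV[R]_n => aff p ord0 i).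
  by apply: sm_coord; apply: sm_aff; solve_sm.
have pan_local (Q : set ('rV[R]_n)) : topen Q -> Q p ->
    (forall q, Q q -> bd n (pw step3 q)) ->
    exists Q (g : 'rV[R]_n -> X), [/\ topen Q, Q p, smon (cube R n `&` Q) g
     & forall w, cube R n w -> Q w -> G' w = g w].
  move=> oQ Qp Qc; exists Q, (fun x => k (pw step3 x, 1 - dst (aff x))); split => //.
    by apply: smon_k => q [_]; exact: Qc.
  by move=> q _ /Qc; exact: G'E.
have [[i pi]|ni1] := pselect (exists i, aff p ord0 i < 3^-1).
  apply: (pan_local [set q | aff q ord0 i < 3^-1]) => //.
    exact: (topen_lt (sa i)).
  by move=> q /= qi; apply: (@side_bd _ i); left.
have [[i pi]|ni2] := pselect (exists i, 2 / 3 < aff p ord0 i).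
  apply: (pan_local [set q | 2 / 3 < aff q ord0 i]) => //.
    exact: (topen_gt (sa i)).
  by move=> q /= qi; apply: (@side_bd _ i); right.
pose O := [set q : 'rV[R]_n | forall i, - 3^-1 < aff q ord0 i < 4 / 3].
exists O, (fun q => G (pw step3 q)); split.
- apply: (@topen_forall _ _ _
    (fun i => [set q : 'rV[R]_n | - 3^-1 < aff q ord0 i < 4 / 3])) => i.
  rewrite (_ : [set q : 'rV[R]_n | _] =
    [set q | - 3^-1 < aff q ord0 i] `&` [set q | aff q ord0 i < 4 / 3]).
    by apply: topenI; [exact: (topen_gt (sa i))|exact: (topen_lt (sa i))].
  by apply/seteqP; split => q /= => [/andP[]|[? ?]]//; apply/andP.
- move=> i; have h1 : ~~ (aff p ord0 i < 3^-1) by apply/negP => h; apply: ni1; exists i.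
  have h2 : ~~ (2 / 3 < aff p ord0 i) by apply/negP => h; apply: ni2; exists i.
  by rewrite -leNgt in h1; rewrite -leNgt in h2; apply/andP; split; lra.
- apply: (smon_comp (extension_smonG ext) (c := fun q => pw step3 q)).
    by apply: sm_pw; [have [] := repar_step3 R|solve_sm].
  by move=> q _; rewrite pw_step3; exact: cube_step.
- move=> q _ /= Oq; rewrite /G' ifT// dst_eq0//.
  by move=> i; have /andP[h1 h2] := Oq i; apply/andP; split; exact: ltW.
Qed.

Lemma collar_extension :
  extension (fun p => T ((pw step3 p.1, step2 p.2), 0))
    (fun x => k (pw step3 x, 0)) H' G'.
Proof.
have cube3 (x : 'rV[R]_n) : cube R n (pw step3 x).
  by rewrite pw_step3; exact: cube_step.
split.
- exact: smon_H'.
- exact: smon_G'.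
- move=> p _; rewrite /H'; case: eqP => [_|dp].
    by apply: (extension_inB ext); exact: box_c.
  by apply: (homotopy_inB hTk); [exact: pan_c|exact: I01_onem].
- move=> x _; rewrite /G'; case: eqP => [_|dx].
    exact: (extension_inA ext).
  apply: (homotopy_inA hTk); first by rewrite pw_step3; exact: dst_bd.
  by apply: I01_onem; exact: dst01.
(* On the lid the term of [d] coming from the height vanishes, so [H'] and [G'] branch on the same
   condition. *)
- move=> x cx; rewrite /H' /G' /d /c /=.
  have -> : step (1 - 2 * 1) = 0 by rewrite step0//; lra.
  rewrite osumr0; have -> : step2 1 = 1 by have [] := repar_step2 R.
  case: eqP => [_|dx]; first exact: (extension_top ext).
  apply: (homotopy_top hTk); first by rewrite pw_step3; exact: dst_bd.
  by apply: I01_onem; exact: dst01.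
- move=> p pp; have dp : d p = 1.
    have [_ [p0|/dst_aff_bd p0]] := pp; last by rewrite /d p0 osum1.
    by rewrite /d p0 mulr0 subr0 step1 ?osumr1//; lra.
  by rewrite /H' dp oner_eq0 subrr.
- by move=> x /dst_aff_bd dx; rewrite /G' dx oner_eq0 subrr.
Qed.

End collar.

End lifting.

(** * Invariance of solvability under homotopy and reparametrization *)

Section solving.
Variables (R : realType) (X Y : diffeologicalType R) (phi : X -> Y).
Variables (A : set X) (B : set Y).
Hypotheses (phi_smooth : smooth phi) (phiAB : forall x, A x -> B (phi x)).
Notation step := (@step R).
Notation step2 := (@step2 R).
Notation step3 := (@step3 R).
Notation problem := (problem phi A B).
Notation extension := (extension phi A B).
Notation homotopy := (homotopy phi A B).
Notation extends := (extends phi A B).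

Definition solvable n (F : 'rV[R]_n * R -> Y) (g : 'rV[R]_n -> X) : Prop :=
  exists r r', [/\ repar r, repar r' &
    extends (fun p => F (pw r p.1, r' p.2)) (fun x => g (pw r x))].

Lemma pw_comp n r r' (x : 'rV[R]_n) : pw r (pw r' x) = pw (r \o r') x.
Proof. by apply/rowP => i; rewrite !mxE. Qed.

Lemma pw_id n (x : 'rV[R]_n) : pw id x = x.
Proof. by apply/rowP => i; rewrite !mxE. Qed.

Lemma eq_extension n F F' g g' H (G : 'rV[R]_n -> X) :
  (forall p, pan n p -> F p = F' p) -> (forall x, bd n x -> g x = g' x) ->
  extension F g H G -> extension F' g' H G.
Proof.
move=> FF' gg' [? ? ? ? ? Fe ge]; split => // [p pp|x bx].
  by rewrite -FF'// Fe.
by rewrite -gg'// ge.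
Qed.

Lemma eq_solvable n F F' g (g' : 'rV[R]_n -> X) :
  (forall p, pan n p -> F p = F' p) -> (forall x, bd n x -> g x = g' x) ->
  solvable F g -> solvable F' g'.
Proof.
move=> FF' gg' [r [r' [rr rr' [H [G e]]]]]; exists r, r'; split => //.
exists H, G; apply: eq_extension e => [p pp|x bx]; [apply: FF'|apply: gg'].
  exact: repar_pan.
exact: repar_bd.
Qed.

Lemma extends_solvable n F (g : 'rV[R]_n -> X) : extends F g -> solvable F g.
Proof.
move=> [H [G e]]; exists id, id; split; try exact: repar_id.
by exists H, G; apply: eq_extension e => [[x t] _|x _] /=; rewrite pw_id.
Qed.

Lemma solvable_repar n r r' F (g : 'rV[R]_n -> X) : repar r -> repar r' ->
  solvable (fun p => F (pw r p.1, r' p.2)) (fun x => g (pw r x)) ->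
  solvable F g.
Proof.
move=> rr rr' [s [s' [rs rs' [H [G e]]]]].
exists (r \o s), (r' \o s'); split; try exact: repar_comp.
by exists H, G; apply: eq_extension e => [[x t] _|x _] /=; rewrite pw_comp.
Qed.

Lemma problem_repar n r r' F (g : 'rV[R]_n -> X) : repar r -> repar r' ->
  problem F g -> problem (fun p => F (pw r p.1, r' p.2)) (fun x => g (pw r x)).
Proof.
move=> rr rr' [sF sg FB gA Fg].
have sr := repar_sm rr.
have sr' := repar_sm rr'.
split.
- apply: (smon_comp sF (c := fun p => (pw r p.1, r' p.2))).
    by solve_sm.
  by move=> p; exact: repar_pan.
- apply: (smon_comp sg (c := fun p => pw r p)); first by solve_sm.
  by move=> x; exact: repar_bd.
- by move=> p pp; apply/FB/repar_pan.
- by move=> x bx; apply/gA/repar_bd.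
- by move=> x bx /=; have [_ _ -> _] := rr'; apply/Fg/repar_bd.
Qed.

Lemma homotopy_problem n T (k : 'rV[R]_n * R -> X) s : homotopy T k -> I01 s ->
  problem (fun p => T (p, s)) (fun x => k (x, s)).
Proof.
move=> [sT sk TB kA Tk] Is; split.
- by apply: (smon_comp sT (c := fun p => (p, s))); [solve_sm|split].
- by apply: (smon_comp sk (c := fun p => (p, s))); [solve_sm|split].
- by move=> p pp; exact: TB.
- by move=> x bx; exact: kA.
- by move=> x bx; exact: Tk.
Qed.

Lemma homotopy_repar n r r' T (k : 'rV[R]_n * R -> X) :
  repar r -> repar r' -> homotopy T k ->
  homotopy (fun p => T ((pw r p.1.1, r' p.1.2), p.2)) (fun p => k (pw r p.1, p.2)).
Proof.
move=> rr rr' [sT sk TB kA Tk].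
have sr := repar_sm rr.
have sr' := repar_sm rr'.
split.
- apply: (smon_comp sT (c := fun p => (pw r p.1.1, r' p.1.2, p.2))).
    by solve_sm.
  by move=> p [pp Ip]; split => //=; exact: repar_pan.
- apply: (smon_comp sk (c := fun p => (pw r p.1, p.2))); first by solve_sm.
  by move=> x [bx Ix]; split => //=; exact: repar_bd.
- by move=> p s pp Is /=; apply: TB => //; exact: repar_pan.
- by move=> x s bx Is; apply: kA => //; exact: repar_bd.
- by move=> x s bx Is /=; have [_ _ -> _] := rr'; apply: Tk => //; exact: repar_bd.
Qed.

Lemma solvable_homotopy n T k F0 F1 g0 (g1 : 'rV[R]_n -> X) : homotopy T k ->
  (forall p, pan n p -> T (p, 0) = F0 p) -> (forall x, bd n x -> k (x, 0) = g0 x) ->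
  (forall p, pan n p -> T (p, 1) = F1 p) -> (forall x, bd n x -> k (x, 1) = g1 x) ->
  solvable F1 g1 -> solvable F0 g0.
Proof.
move=> hTk T0 k0 T1 k1 [r [r' [rr rr' [H [G e]]]]].
(* The reparametrization that solves the end problem is first applied to the whole homotopy, so that
   its end is literally the extended problem. *)
have e' := eq_extension (g' := fun x => k (pw r x, 1))
  (F' := fun p => T ((pw r p.1, r' p.2), 1)) _ _ e.
have {}e' := collar_extension (homotopy_repar rr rr' hTk)
  (e' (fun p pp => esym (T1 _ (repar_pan rr rr' pp)))
      (fun x bx => esym (k1 _ (repar_bd rr bx)))).
apply: (eq_solvable T0 k0).
exists (r \o step3), (r' \o step2); split.
- exact/repar_comp/repar_step3.
- exact/repar_comp/repar_step2.
- eexists; eexists; apply: eq_extension e' => [[x t] pp|x bx] /=.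
    by rewrite pw_comp.
  by rewrite pw_comp.
Qed.

Definition lin (s a b : R) := (1 - s) * a + s * b.

Lemma lin01 s a b : I01 s -> I01 a -> I01 b -> I01 (lin s a b).
Proof.
rewrite /I01/lin/= => /andP[s0 s1] /andP[a0 a1] /andP[b0 b1].
have h : 0 <= 1 - s by rewrite subr_ge0.
have := mulr_ge0 h a0; have := mulr_ge0 s0 b0.
have := ler_wpM2l h a1; have := ler_wpM2l s0 b1.
by rewrite !mulr1 => *; apply/andP; split; lra.
Qed.

Lemma lin_repar_bd n r (x : 'rV[R]_n) s : repar r -> I01 s -> bd n x ->
  bd n (\row_i lin s (x ord0 i) (r (x ord0 i))).
Proof.
move=> [_ r0 r1 rI] Is [cx [i xi]]; split.
  by move=> j; rewrite mxE; apply: lin01 => //; [exact: cx|apply: rI; exact: cx].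
exists i; rewrite mxE; case: xi => ->; rewrite ?r0 ?r1 /lin; [left|right]; ring.
Qed.

Lemma sm_lin (V : normedModType R) (s a b : V -> R) :
  sm s -> sm a -> sm b -> sm (fun v => lin (s v) (a v) (b v)).
Proof. by move=> *; rewrite /lin; solve_sm. Qed.

(** The unknown reparametrizations are undone by linear interpolation to the identity, and only the
    fixed ones of the collar construction remain. Having the same ones for every problem is what
    makes solutions on neighbouring faces of a grid compatible. *)
Lemma solvable_extends n F (g : 'rV[R]_n -> X) : problem F g -> solvable F g ->
  extends (fun p => F (pw step3 p.1, step2 p.2)) (fun x => g (pw step3 x)).
Proof.
move=> [sF sg FB gA Fg] [r [r' [rr rr' [H [G e]]]]].
have sr := repar_sm rr.
have sr' := repar_sm rr'.
pose l s (x : 'rV[R]_n) := \row_i lin s (x ord0 i) (r (x ord0 i)).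
have lpan p s : pan n p -> I01 s -> pan n (l s p.1, lin s p.2 (r' p.2)).
  move=> [[cp Ip] pp] Is; have [_ r0 r1 rI] := rr; have [_ r0' r1' rI'] := rr'.
  split; first split => /=.
  - move=> i; rewrite mxE; apply: lin01 => //; [exact: cp|apply: rI; exact: cp].
  - by apply: lin01 => //; exact: rI'.
  - case: pp => [->|bp]; [left|right]; last exact: lin_repar_bd.
    by rewrite /= r0' /lin; ring.
pose T (p : 'rV[R]_n * R * R) := F (l p.2 p.1.1, lin p.2 p.1.2 (r' p.1.2)).
pose k (p : 'rV[R]_n * R) := g (l p.2 p.1).
have l0 x : l 0 x = x.
  by apply/rowP => i; rewrite mxE /lin subr0 mul1r mul0r addr0.
have l1 x : l 1 x = pw r x.
  by apply/rowP => i; rewrite !mxE /lin subrr mul1r mul0r add0r.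
have sl (V : normedModType R) (b : V -> R) (c : V -> 'rV[R]_n) :
    sm b -> sm c -> sm (fun v => l (b v) (c v)).
  by move=> sb sc; apply: sm_row => i; apply: sm_lin => //; [solve_sm|apply: sm_repar; solve_sm].
have hTk : homotopy T k.
  split.
  - apply: (smon_comp sF (c := fun p => (l p.2 p.1.1, lin p.2 p.1.2 (r' p.1.2)))).
      by apply: sm_pair; [apply: sl|apply: sm_lin]; solve_sm; apply: sm_repar; solve_sm.
    by move=> p [pp Ip]; exact: (lpan p.1).
  - apply: (smon_comp sg (c := fun p => l p.2 p.1)); first by apply: sl; solve_sm.
    by move=> p [bp Ip]; exact: lin_repar_bd.
  - by move=> p s pp Is; apply: FB; exact: (lpan p).
  - by move=> x s bx Is; apply: gA; exact: lin_repar_bd.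
  - move=> x s bx Is; rewrite /T /k /=; have [_ _ -> _] := rr'.
    rewrite -Fg; last exact: lin_repar_bd.
    by rewrite /lin; congr (F (_, _)); ring.
have e' : extension (fun p => T (p, 1)) (fun x => k (x, 1)) H G.
  apply: eq_extension e => [[x t] _|x _]; rewrite /T /k /= l1//.
  by rewrite /lin subrr mul1r mul0r add0r.
have := collar_extension hTk e' => e''.
eexists; eexists; apply: eq_extension e'' => [[x t] _|x _]; rewrite /T /k /= l0//.
by rewrite /lin subr0 mul1r mul0r addr0.
Qed.

(* A homotopy of the lift on the boundary is absorbed by lengthening the
   cylinder [bd n x I] at its top end. *)
Lemma solvable_collar n F g (k : 'rV[R]_n * R -> X) : problem F g ->
  smon [set p | bd n p.1 /\ I01 p.2] k ->
  (forall x s, bd n x -> I01 s -> A (k (x, s))) ->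
  (forall x, bd n x -> k (x, 0) = g x) ->
  (forall F', problem F' (fun x => k (x, 1)) -> solvable F' (fun x => k (x, 1))) ->
  solvable F g.
Proof.
move=> [sF sg FB gA Fg] sk kA k0 hsol.
have [_ step_0 step_1 _] := repar_step R.
(* [W x] follows [F] on [0, 1] and [phi \o k] on [1, 2], each slowed down by [step], so that on the
   sides it is constant for heights between 2/3 and 4/3. At time s, [T] uses the heights up to 1 +
   s. *)
pose W (x : 'rV[R]_n) u := if u < 1 then F (x, step u) else phi (k (x, step (u - 1))).
pose T (p : 'rV[R]_n * R * R) := W p.1.1 (p.1.2 * (1 + p.2)).
have panW (x : 'rV[R]_n) t s : pan n (x, t) -> I01 s -> 2^-1 < t * (1 + s) -> bd n x.
  by move=> [_ [/= ->|//]]; rewrite mul0r => _ h; exfalso; lra.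
have WF x t : bd n x -> t < 4 / 3 -> W x t = F (x, step t).
  move=> bx t4; rewrite /W; case: ltP => // t1.
  rewrite [step (t - 1)]step0 ?k0 ?[step t]step1 ?Fg//; lra.
have Wk x t : bd n x -> 2 / 3 < t -> W x t = phi (k (x, step (t - 1))).
  move=> bx t4; rewrite /W; case: ltP => // t1.
  rewrite [step (t - 1)]step0 ?k0 ?[step t]step1 ?Fg//; lra.
have W0 x t s : pan n (x, t) -> I01 s -> t * (1 + s) < 4 / 3 ->
    W x (t * (1 + s)) = F (x, step (t * (1 + s))).
  move=> [_ [/= ->|bx]] _; last exact: WF.
  by rewrite mul0r /W ltr01.
have panF x t u : pan n (x, t) -> pan n (x, step (t * (1 + u))).
  move=> [[cx _] H]; split; first by split => //; exact: step01.
  by case: H => [/= ->|]; [left; rewrite mul0r|right].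
have hTk : homotopy T (fun p => k (p.1, step p.2)).
  split.
  - apply: (@smon_glue _ _ _ _ _ (fun p : 'rV[R]_n * R * R => F (p.1.1, step (p.1.2 * (1 + p.2))))
       (fun p : 'rV[R]_n * R * R => phi (k (p.1.1, step (p.1.2 * (1 + p.2) - 1))))
       [set p : 'rV[R]_n * R * R | p.1.2 * (1 + p.2) < 4 / 3] [set p : 'rV[R]_n * R * R | 2 / 3 < p.1.2 * (1 + p.2)]).
    + by apply: (topen_lt (a := fun p : 'rV[R]_n * R * R => p.1.2 * (1 + p.2))); solve_sm.
    + by apply: (topen_gt (a := fun p : 'rV[R]_n * R * R => p.1.2 * (1 + p.2))); solve_sm.
    + move=> p _ /=; have [|] := ltP (p.1.2 * (1 + p.2)) (4 / 3); first by left.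
      by right; lra.
    + apply: (smon_comp sF (c := fun p : 'rV[R]_n * R * R => (p.1.1, step (p.1.2 * (1 + p.2))))).
        by solve_sm.
      by move=> [[x t] s] [[/= pp Is] _]; exact: panF.
    + apply: (smon_smooth phi_smooth).
      apply: (smon_comp sk (c := fun p : 'rV[R]_n * R * R => (p.1.1, step (p.1.2 * (1 + p.2) - 1)))).
        by solve_sm.
      move=> [[x t] s] [[/= pp Is] ts]; split; last exact: step01.
      by apply: panW pp Is _; lra.
    + by move=> [[x t] s] [/= pp Is] ts; exact: W0.
    + move=> [[x t] s] [/= pp Is] ts; apply: Wk => //.
      by apply: panW pp Is _; lra.
  - apply: (smon_comp sk (c := fun p => (p.1, step p.2))); first by solve_sm.
    by move=> p [bp Ip]; split => //; exact: step01.
  - move=> [x t] s pp Is; rewrite /T /=.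
    have [ts|ts] := ltP (t * (1 + s)) (4 / 3); first by rewrite W0//; exact/FB/panF.
    have bx : bd n x by apply: panW pp Is _; lra.
    by rewrite Wk//; [apply/phiAB/kA => //; exact: step01|lra].
  - by move=> x s bx Is; apply: kA => //; exact: step01.
  - move=> x s bx Is; rewrite /T /= mul1r Wk//; last by case/andP: Is => s0 s1; lra.
    by congr (phi (k (_, step _))); ring.
have := homotopy_problem hTk (I01_1 R); rewrite /= step_1 => /hsol hT1.
(* At time 0, [T] is [F] with its height slowed down by [step]; the reparametrization accounts for
   that. *)
apply: (solvable_repar (repar_id R) (repar_step R)).
apply: (solvable_homotopy hTk _ _ _ _ hT1) => [[x t] pp|x bx|//|x bx] /=.
- rewrite /T /= pw_id W0 ?addr0 ?mulr1//; first exact: I01_0.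
  by have [[_ /= /andP[]]] := pp; lra.
- by rewrite step_0 pw_id k0.
- by rewrite step_1.
Qed.

End solving.

(** * Solving lifting problems for weak equivalences *)

Section last_coordinate.
Variable R : realType.

Definition snoc n (y : 'rV[R]_n) (z : R) : 'rV[R]_n.+1 :=
  \row_i (if unlift ord_max i is Some j then y ord0 j else z).
Definition init n (x : 'rV[R]_n.+1) : 'rV[R]_n := \row_j x ord0 (lift ord_max j).
Definition lst n (x : 'rV[R]_n.+1) : R := x ord0 ord_max.

Lemma snoc_lift n (y : 'rV[R]_n) z j : snoc y z ord0 (lift ord_max j) = y ord0 j.
Proof. by rewrite mxE liftK. Qed.

Lemma snoc_max n (y : 'rV[R]_n) z : snoc y z ord0 ord_max = z.
Proof. by rewrite mxE unlift_none. Qed.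

Lemma init_snoc n (y : 'rV[R]_n) z : init (snoc y z) = y.
Proof. by apply/rowP => j; rewrite mxE snoc_lift. Qed.

Lemma lst_snoc n (y : 'rV[R]_n) z : lst (snoc y z) = z.
Proof. exact: snoc_max. Qed.

Lemma ord_maxP n (i : 'I_n.+1) : i = ord_max \/ exists j, i = lift ord_max j.
Proof. by case: (unliftP ord_max i) => [j|] ->; [right; exists j|left]. Qed.

Lemma snoc_init_lst n (x : 'rV[R]_n.+1) : snoc (init x) (lst x) = x.
Proof.
apply/rowP => i; have [->|[j ->]] := ord_maxP i; first exact: snoc_max.
by rewrite snoc_lift mxE.
Qed.

Lemma cube_snoc n (y : 'rV[R]_n) z : cube R n y -> I01 z -> cube R n.+1 (snoc y z).
Proof.
move=> cy Iz i; have [->|[j ->]] := ord_maxP i; first by rewrite snoc_max.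
by rewrite snoc_lift; exact: cy.
Qed.

Lemma cube_init n (x : 'rV[R]_n.+1) : cube R n.+1 x -> cube R n (init x).
Proof. by move=> cx j; rewrite mxE; exact: cx. Qed.

Lemma cube_lst n (x : 'rV[R]_n.+1) : cube R n.+1 x -> I01 (lst x).
Proof. by move=> cx; exact: cx. Qed.

Lemma bd_snocl n (y : 'rV[R]_n) z : bd n y -> I01 z -> bd n.+1 (snoc y z).
Proof.
move=> [cy [i yi]] Iz; split; first exact: cube_snoc.
by exists (lift ord_max i); rewrite snoc_lift.
Qed.

Lemma bd_snoc0 n (y : 'rV[R]_n) : cube R n y -> bd n.+1 (snoc y 0).
Proof.
move=> cy; split; first by apply: cube_snoc => //; exact: I01_0.
by exists ord_max; rewrite snoc_max; left.
Qed.

Lemma bd_snoc1 n (y : 'rV[R]_n) : cube R n y -> bd n.+1 (snoc y 1).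
Proof.
move=> cy; split; first by apply: cube_snoc => //; exact: I01_1.
by exists ord_max; rewrite snoc_max; right.
Qed.

Lemma bdP n (x : 'rV[R]_n.+1) : bd n.+1 x -> [\/ lst x = 0, lst x = 1 | bd n (init x)].
Proof.
move=> [cx [i]]; have [->|[j ->]] := ord_maxP i.
  by case; [constructor 1|constructor 2].
by move=> xi; constructor 3; split; [exact: cube_init|exists j; rewrite mxE].
Qed.

Lemma pw_snoc n (f : R -> R) (y : 'rV[R]_n) z : pw f (snoc y z) = snoc (pw f y) (f z).
Proof.
apply/rowP => i; rewrite mxE; have [->|[j ->]] := ord_maxP i.
  by rewrite !snoc_max.
by rewrite !snoc_lift mxE.
Qed.

Lemma sm_snoc (V : normedModType R) n (c : V -> 'rV[R]_n) (z : V -> R) :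
  sm c -> sm z -> sm (fun v => snoc (c v) (z v)).
Proof.
by move=> sc sz; apply: sm_row => i; case: (unlift ord_max i) => [j|]; solve_sm.
Qed.

Lemma sm_init (V : normedModType R) n (c : V -> 'rV[R]_n.+1) :
  sm c -> sm (fun v => init (c v)).
Proof. by move=> sc; solve_sm. Qed.

Lemma sm_lst (V : normedModType R) n (c : V -> 'rV[R]_n.+1) :
  sm c -> sm (fun v => lst (c v)).
Proof. by move=> sc; exact: sm_coord. Qed.

(** The dilation about 1/2 taking [0, 1] onto [- s, 1 + s]. At s = 1 it carries the boundary of the
    cube to where [dst] is 1. *)
Definition stretch (s t : R) : R := 2^-1 + (1 + 2 * s) * (t - 2^-1).

Lemma stretch0 t : stretch 0 t = t.
Proof. by rewrite /stretch mulr0 addr0 mul1r addrC subrK. Qed.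

Lemma stretchl s : stretch s 0 = - s.
Proof. by rewrite /stretch; field. Qed.

Lemma stretchr s : stretch s 1 = 1 + s.
Proof. by rewrite /stretch; field. Qed.

Lemma sm_stretch (V : normedModType R) n (s : V -> R) (c : V -> 'rV[R]_n) :
  sm s -> sm c -> sm (fun v => pw (stretch (s v)) (c v)).
Proof. by move=> ss sc; apply: sm_row => i; rewrite /stretch; solve_sm. Qed.

Lemma pw_stretch0 n (x : 'rV[R]_n) : pw (stretch 0) x = x.
Proof. by apply/rowP => i; rewrite mxE stretch0. Qed.

Lemma stretch_bd n (x : 'rV[R]_n) s : bd n x -> I01 s ->
  bd n (pw (@step R) (pw (stretch s) x)).
Proof.
move=> [cx [i xi]] /andP[s0 s1]; apply: (bd_step (i := i)); rewrite mxE.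
by case: xi => ->; rewrite ?stretchl ?stretchr; [left|right]; lra.
Qed.

Lemma dst_stretch n (x : 'rV[R]_n) i : x ord0 i = 0 \/ x ord0 i = 1 ->
  dst (pw (stretch 1) x) = 1.
Proof.
move=> xi; apply: (dst_eq1 (i := i)); rewrite mxE.
by case: xi => ->; rewrite ?stretchl ?stretchr; [left|right]; lra.
Qed.

Lemma bd_dst_stretch n (x : 'rV[R]_n) : bd n x -> dst (pw (stretch 1) x) = 1.
Proof. by move=> [_ [i]]; exact: dst_stretch. Qed.

Lemma repar_stretch : repar (@step R \o stretch 1).
Proof.
split => /=.
- by rewrite /stretch /comp; solve_sm.
- by rewrite stretchl step0//; lra.
- by rewrite stretchr step1//; lra.
- by move=> t _; exact: step01.
Qed.

End last_coordinate.

(** * From the conditions on homotopy groups to solutions *)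

Section solve.
Variables (R : realType) (X Y : diffeologicalType R) (phi : X -> Y).
Variables (A : set X) (B : set Y).
Hypotheses (phi_smooth : smooth phi) (phiAB : forall x, A x -> B (phi x)).
Notation step := (@step R).
Notation problem := (problem phi A B).
Notation solvable := (solvable phi A B).

Definition pi0_lifting : Prop := forall b, B b -> exists a (p : R -> Y),
  [/\ A a, smon I01 p, forall t, I01 t -> B (p t), p 0 = b & p 1 = phi a].

(** Triviality of the kernel on pi_n, for maps into [X] with values in [A]. As [bd 0] is empty, for
    n = 0 it is full injectivity on pi_0. *)
Definition null_lifting n : Prop := forall a (u : 'rV[R]_n -> X) N, A a ->
  smon (cube R n) u -> (forall y, cube R n y -> A (u y)) ->
  (forall y, bd n y -> u y = a) ->
  smon (box n) N -> (forall p, box n p -> B (N p)) ->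
  (forall y, cube R n y -> N (y, 0) = phi (u y)) ->
  (forall y, cube R n y -> N (y, 1) = phi a) ->
  (forall y s, bd n y -> I01 s -> N (y, s) = phi a) ->
  exists M : 'rV[R]_n * R -> X,
    [/\ smon (box n) M /\ (forall p, box n p -> A (M p)),
      forall y, cube R n y -> M (y, 0) = u y,
      forall y, cube R n y -> M (y, 1) = a
    & forall y s, bd n y -> I01 s -> M (y, s) = a].

Definition class_lifting n : Prop := forall a (f : 'rV[R]_n -> Y), A a ->
  smon (cube R n) f -> (forall y, cube R n y -> B (f y)) ->
  (forall y, bd n y -> f y = phi a) ->
  exists (b : 'rV[R]_n -> X) N,
    [/\ smon (cube R n) b /\ (forall y, cube R n y -> A (b y)),
        forall y, bd n y -> b y = a,
        smon (box n) N /\ (forall p, box n p -> B (N p)),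
        forall y, cube R n y -> N (y, 0) = f y /\ N (y, 1) = phi (b y)
      & forall y s, bd n y -> I01 s -> N (y, s) = phi a].

(** The pan has a single point here, since [bd 0] is empty; the problem asks only for a path from
    its image to the image of [A]. *)
Lemma solvable0 F (g : 'rV[R]_0 -> X) : pi0_lifting -> problem F g -> solvable F g.
Proof.
move=> hpi0 [sF sg FB gA Fg]; apply: extends_solvable.
have nobd x : ~ bd 0 x by move=> [_ [[]]].
have c0 (x : 'rV[R]_0) : cube R 0 x by move=> [].
have pan0 : pan 0 ((0 : 'rV[R]_0), (0 : R)).
  by split; [split => //; exact: I01_0|left].
have [a [p [Aa sp pB p0 p1]]] := hpi0 _ (FB _ pan0).
exists (fun q => p q.2), (fun=> a); split => //.
- apply: (smon_comp sp (c := snd)); first by solve_sm.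
  by move=> q [].
- exact: smon_cst.
- by move=> q [_ Iq]; exact: pB.
- by move=> [x t] [_ [/= ->|/nobd//]]; rewrite p0; congr (F (_, _)); apply/rowP => -[].
- by move=> x /nobd.
Qed.

(* The lift is contracted to a point on all faces but the last one,
   [lst x = 1], which is stretched to swallow the whole boundary. *)
Lemma solvable_contract n F (g : 'rV[R]_n.+1 -> X) : problem F g ->
  (forall a F' g', A a -> problem F' g' ->
     (forall x, bd n.+1 x -> lst x = 0 \/ bd n (init x) -> g' x = a) ->
     solvable F' g') ->
  solvable F g.
Proof.
move=> Fg hsol; apply: (solvable_repar (repar_step R) (repar_step R)).
pose d (x : 'rV[R]_n.+1) s :=
  osum (dst (pw (stretch s) (init x))) (s * (1 - lst x)).
(* [d] is 0 at s = 0 on the cube, and 1 at s = 1 on the bottom and side faces. As it grows, the last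
   coordinate sinks to 0 first, being 0 from d = 1/3 on, and the others start to shrink only after d
   = 2/3. A point of a side face thus slides down that face and then contracts to the origin inside
   the bottom face. *)
pose c (p : 'rV[R]_n.+1 * R) : 'rV[R]_n.+1 :=
  snoc (pw (fun t => step (2 - 2 * d p.1 p.2) * t) (pw step (pw (stretch p.2) (init p.1))))
       (step (1 - 2 * d p.1 p.2) * step (lst p.1)).
have sd : sm (fun p : 'rV[R]_n.+1 * R => d p.1 p.2).
  apply: sm_osum; first by apply/sm_dst/sm_stretch; [solve_sm|apply: sm_init; solve_sm].
  by solve_sm; apply: sm_lst; solve_sm.
have sc : sm c.
  apply: sm_snoc; last by solve_sm; apply: sm_lst; solve_sm.
  by apply: sm_row => i; rewrite /stretch; solve_sm.
have cube_c x s : cube R n.+1 (c (x, s)).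
  have mul01 (a b : R) : 0 <= a <= 1 -> 0 <= b <= 1 -> 0 <= a * b <= 1.
    by move=> /andP[a0 a1] /andP[b0 b1]; rewrite mulr_ge0//= mulr_ile1.
  by apply: cube_snoc; [apply: cube_pw => i; rewrite mxE|]; apply: mul01; exact: step01.
have c_side x s : bd n (pw step (pw (stretch s) (init x))) -> bd n.+1 (c (x, s)).
  move=> [cy [i yi]]; split; first exact: cube_c.
  have [ds|ds] := leP (d x s) 2^-1.
    exists (lift ord_max i); rewrite snoc_lift mxE /=.
    by rewrite [step (2 - _)]step1 ?mul1r//; lra.
  by exists ord_max; rewrite snoc_max/= step0 ?mul0r; [left|lra].
have bd_c x s : bd n.+1 x -> I01 s -> bd n.+1 (c (x, s)).
  move=> bx Is; have [x0|x1|/stretch_bd xb] := bdP bx; last exact/c_side/xb.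
    split; first exact: cube_c.
    exists ord_max; left; rewrite snoc_max /= x0 [step 0]step0 ?mulr0//; lra.
  have [d0|d0] := pselect (dst (pw (stretch s) (init x)) = 0).
    split; first exact: cube_c.
    exists ord_max; right; rewrite snoc_max /= /d d0 x1 subrr mulr0 osum0.
    by rewrite !step1 ?mulr1//; lra.
  by apply: c_side; exact: dst_bd.
have [sF sg FB gA Ftop] := Fg.
have bd0 : bd n.+1 (0 : 'rV[R]_n.+1).
  split; last by exists ord0; rewrite mxE; left.
  by move=> i; rewrite mxE; exact: I01_0.
apply: (solvable_collar phi_smooth phiAB (k := fun p => g (c p))).
- exact: (problem_repar (repar_step R) (repar_step R)).
- apply: (smon_comp sg sc) => -[x s] [bx Is]; exact: bd_c.
- by move=> x s bx Is; apply/gA/bd_c.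
- move=> x [cx _]; congr g; rewrite /c /d /= pw_stretch0.
  have -> : dst (init x) = 0 by apply/cube_dst/cube_init.
  have step_1 : step 1 = 1 by rewrite step1//; lra.
  have step_2 : step 2 = 1 by rewrite step1//; lra.
  rewrite mul0r osum0 mulr0 !subr0 step_1 step_2 mul1r.
  rewrite -[in RHS](snoc_init_lst x) pw_snoc; congr snoc.
  by apply/rowP => i; rewrite !mxE mul1r.
- move=> F' Fg'; apply: (hsol (g 0)) => //; first exact: gA.
  move=> x bx xJ; congr g; rewrite /c /=.
  have -> : d x 1 = 1.
    rewrite /d; case: xJ => [->|/bd_dst_stretch ->]; last by rewrite osum1.
    by rewrite subr0 mulr1 osumr1.
  have -> : step (2 - 2 * 1) = 0 by rewrite step0//; lra.
  have -> : step (1 - 2 * 1) = 0 by rewrite step0//; lra.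
  apply/rowP => i; rewrite [RHS]mxE mul0r; have [->|[j ->]] := ord_maxP i.
    by rewrite snoc_max.
  by rewrite snoc_lift mxE mul0r.
Qed.

(** The pan is a disc whose rim is the boundary of the cube. So [F] on the pan is a null-homotopy of
    the image of the class that [g] defines on the last face. Injectivity lifts it to a contraction
    [M] of [g] on that face, along which [g] is made constant. *)
Lemma solvable_face n F a (g : 'rV[R]_n.+1 -> X) : null_lifting n ->
  problem F g -> A a ->
  (forall x, bd n.+1 x -> lst x = 0 \/ bd n (init x) -> g x = a) ->
  (forall F' g', problem F' g' -> (forall x, bd n.+1 x -> g' x = a) ->
     solvable F' g') ->
  solvable F g.
Proof.
move=> hnull Fg Aa ga hsol; have [sF sg FB gA Ftop] := Fg.
pose r := step \o stretch 1.
have rr : repar r := repar_stretch R.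
have sr := repar_sm rr.
have [_ r0 r1 _] := rr.
have cr m (y : 'rV[R]_m) : cube R m (pw r y).
  by apply: cube_pw => i; exact: step01.
have br m (y : 'rV[R]_m) : bd m y -> bd m (pw r y) by exact: repar_bd.
(* [c] bends a cube of dimension n + 1 into the pan: its boundary goes to the rim at height 1, the
   collar runs down the sides, and the middle goes to the bottom. *)
pose c (p : 'rV[R]_n * R) : 'rV[R]_n.+1 * R :=
  (pw r (snoc p.1 (1 - p.2)), dst (pw (stretch 1) (snoc p.1 (1 - p.2)))).
have sc : sm c.
  have ss : sm (fun p : 'rV[R]_n * R => snoc p.1 (1 - p.2)) by apply: sm_snoc; solve_sm.
  by apply: sm_pair; [apply: sm_pw|apply/sm_dst/sm_stretch; solve_sm].
have pan_c p : pan n.+1 (c p).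
  split; first by split; [exact: cr|exact: dst01].
  have [d0|d0] := pselect ((c p).2 = 0); [by left|right].
  by rewrite /c /= -pw_comp; exact: dst_bd.
have c_top p : (exists i, snoc p.1 (1 - p.2) ord0 i = 0 \/ snoc p.1 (1 - p.2) ord0 i = 1) ->
    c p = (snoc (pw r p.1) (r (1 - p.2)), 1).
  by move=> [i hi]; rewrite /c (dst_stretch hi) pw_snoc.
have [M [[sM MA] M0 M1 Mb]] : exists M : 'rV[R]_n * R -> X,
    [/\ smon (box n) M /\ (forall p, box n p -> A (M p)),
      forall y, cube R n y -> M (y, 0) = g (snoc (pw r y) 1),
      forall y, cube R n y -> M (y, 1) = a
    & forall y s, bd n y -> I01 s -> M (y, s) = a].
  apply: (hnull a (fun y => g (snoc (pw r y) 1)) (fun p => F (c p))) => //.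
  - apply: (smon_comp sg (c := fun y => snoc (pw r y) 1)).
      by apply: sm_snoc; solve_sm.
    by move=> y _; exact: bd_snoc1.
  - by move=> y cy; apply: gA; exact: bd_snoc1.
  - move=> y yb; apply: ga; first exact: bd_snoc1.
    by right; rewrite init_snoc; exact: br.
  - by apply: (smon_comp sF sc) => p _; exact: pan_c.
  - by move=> p _; exact: FB.
  - move=> y cy; rewrite c_top /=; last by exists ord_max; rewrite snoc_max subr0; right.
    by rewrite subr0 r1 Ftop//; exact: bd_snoc1.
  - move=> y cy; rewrite c_top /=; last by exists ord_max; rewrite snoc_max subrr; left.
    have h0 : bd n.+1 (snoc (pw r y) 0) by exact: bd_snoc0.
    by rewrite subrr r0 Ftop ?ga//; left; rewrite lst_snoc.
  - move=> y s yb Is; rewrite c_top /=; last first.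
      by have [_ [i yi]] := yb; exists (lift ord_max i); rewrite snoc_lift.
    have h : bd n.+1 (snoc (pw r y) (r (1 - s))).
      by apply: bd_snocl; [exact: br|exact: step01].
    by rewrite Ftop ?ga//; right; rewrite init_snoc; exact: br.
apply: (solvable_repar rr (repar_id R)).
have I01_k (x : 'rV[R]_n.+1) s : cube R n.+1 x -> I01 s -> I01 (1 - (1 - s) * lst x).
  move=> /cube_lst/andP[x0 x1] /andP[s0 s1]; apply: I01_onem.
  by rewrite /I01/= mulr_ge0 ?subr_ge0//= mulr_ile1//; lra.
(* At s = 0 the contraction is taken at time [1 - lst x], which gives back the reparametrized [g] on
   the last face and [a] on the others; at s = 1 it is taken at time 1, where it is [a]
   everywhere. *)
apply: (solvable_collar phi_smooth phiAB
  (k := fun p : 'rV[R]_n.+1 * R => M (init p.1, 1 - (1 - p.2) * lst p.1))).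
- exact: (problem_repar rr (repar_id R)).
- apply: (smon_comp sM (c := fun p : 'rV[R]_n.+1 * R => (init p.1, 1 - (1 - p.2) * lst p.1))).
    by solve_sm; apply: sm_lst; solve_sm.
  by move=> [x s] [[/= cx _] Is]; split; [exact: cube_init|exact: I01_k].
- move=> x s [cx _] Is; apply: MA.
  by split; [exact: cube_init|exact: I01_k].
- move=> x bx; have [cx _] := bx; have cix := cube_init cx.
  rewrite /= -[in RHS](snoc_init_lst x) pw_snoc subr0 mul1r.
  have [x0|x1|xb] := bdP bx.
  + rewrite x0 subr0 M1// ga ?r0//; first exact: bd_snoc0.
    by left; rewrite lst_snoc.
  + by rewrite x1 subrr M0// r1.
  + rewrite Mb//; last by apply: I01_onem; exact: cube_lst.
    rewrite ga//; first by apply: bd_snocl; [exact: br|exact: step01].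
    by right; rewrite init_snoc; exact: br.
- move=> F' Fg'; apply: hsol => // x [cx _] /=.
  by rewrite subrr mul0r subr0 M1//; exact: cube_init.
Qed.

(** A dilation draws the sides of the pan into its bottom. Afterwards the sides carry the constant
    path at [phi a], and the bottom represents an element of pi_n (B, phi a), to which surjectivity
    applies. *)
Lemma solvable_const n F a (g : 'rV[R]_n -> X) : class_lifting n ->
  problem F g -> A a -> (forall x, bd n x -> g x = a) -> solvable F g.
Proof.
move=> hclass [sF sg FB gA Ftop] Aa ga.
pose c (p : 'rV[R]_n * R * R) : 'rV[R]_n * R :=
  (pw step (pw (stretch p.2) p.1.1), osum p.1.2 (dst (pw (stretch p.2) p.1.1))).
have ss : sm (fun p : 'rV[R]_n * R * R => pw (stretch p.2) p.1.1).
  by apply: sm_stretch; solve_sm.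
have sc : sm c.
  apply: sm_pair; last by apply: sm_osum; [solve_sm|exact: sm_dst].
  by apply: sm_pw => //; exact: (@sm_step R R id).
have pan_c p s : pan n p -> I01 s -> pan n (c (p, s)).
  move=> [[cp Ip] pp] Is; split.
    by split; [exact: cube_step|apply: osum01 => //; exact: dst01].
  case: pp => [p0|/stretch_bd bp]; last by right; exact: bp.
  rewrite /c /= p0 osum0.
  have [d0|d0] := pselect (dst (pw (stretch s) p.1) = 0); [by left|right].
  exact: dst_bd.
have Ftop' x : bd n x -> F (x, 1) = phi a by move=> bx; rewrite Ftop// ga.
pose T p := F (c p).
have hT : homotopy phi A B T (fun=> a).
  split => //.
  - by apply: (smon_comp sF sc) => -[p s] [pp Is]; exact: pan_c.
  - exact: smon_cst.
  - by move=> p s pp Is; apply: FB; exact: pan_c.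
  - by move=> x s bx Is; rewrite /T /c /= osum1 Ftop'//; exact: stretch_bd.
have pan0 x : cube R n x -> pan n (x, 0).
  by move=> cx; split; [split => //; exact: I01_0|left].
have [b [N [[sb bA] ba [sN NB] N01 Nb]]] :
    exists (b : 'rV[R]_n -> X) N,
    [/\ smon (cube R n) b /\ (forall y, cube R n y -> A (b y)),
        forall y, bd n y -> b y = a,
        smon (box n) N /\ (forall p, box n p -> B (N p)),
        forall y, cube R n y -> N (y, 0) = T (y, 0, 1) /\ N (y, 1) = phi (b y)
      & forall y s, bd n y -> I01 s -> N (y, s) = phi a].
  apply: (hclass a (fun y => T (y, 0, 1))) => //.
  - apply: (smon_comp sF (c := fun y => c (y, 0, 1))).
      by apply: (sm_comp sc); solve_sm.
    by move=> y cy; apply: pan_c; [exact: pan0|exact: I01_1].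
  - by move=> y cy; apply: FB; apply: pan_c; [exact: pan0|exact: I01_1].
  - move=> y yb; rewrite /T /c /= osum0 bd_dst_stretch// Ftop'//.
    by apply: stretch_bd => //; exact: I01_1.
apply: (solvable_repar (repar_step R) (repar_id R)).
apply: (solvable_homotopy hT (F1 := fun p => T (p, 1)) (g1 := fun=> a)) => //.
- move=> [x t] [[/= cx It] _]; rewrite /T /c /= pw_stretch0.
  by rewrite (cube_dst cx) osumr0.
- by move=> x bx; rewrite ga//; exact/repar_bd/bx/repar_step.
- apply: extends_solvable; exists N, b; split => //.
  + by move=> x cx; have [] := N01 _ cx.
  + move=> [x t] [[/= cx It] [/= ->|/= bx]]; first by have [] := N01 _ cx.
    rewrite Nb// /T /c /= bd_dst_stretch// osumr1 Ftop'//.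
    by apply: stretch_bd => //; exact: I01_1.
Qed.

Lemma problem_extends : pi0_lifting -> (forall n, null_lifting n) ->
  (forall n, class_lifting n.+1) ->
  forall n F (g : 'rV[R]_n -> X), problem F g ->
    extends phi A B (fun p => F (pw (@step3 R) p.1, step2 p.2))
      (fun x => g (pw (@step3 R) x)).
Proof.
move=> h0 hnull hclass n F g Fg; apply: solvable_extends => //.
case: n F g Fg => [|n] F g Fg; first exact: solvable0.
apply: solvable_contract => // a {}F {}g Aa {}Fg ga.
apply: (solvable_face (hnull n) Fg Aa ga) => {}F {}g {}Fg {}ga.
exact: (solvable_const (hclass n) Fg Aa ga).
Qed.

End solve.

(** * Smooth homotopies and homotopy groups *)

Section totalization.
Variable R : realType.
Implicit Types X : diffeologicalType R.

(* [x0] is a junk value. *)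
Definition ext (T X : Type) (A : set T) (x0 : X) (f : A -> X) (x : T) : X :=
  if pselect (A x) is left Ax then f (SigSub (mem_set Ax)) else x0.

Lemma extE (T X : Type) (A : set T) (x0 : X) (f : A -> X) x (Ax : x \in A) :
  ext x0 f x = f (SigSub Ax).
Proof.
rewrite /ext; case: pselect => [Ax'|]; last by move=> /(_ (set_mem Ax)).
by congr f; exact: val_inj.
Qed.

Lemma ext_val (T X : Type) (A : set T) (x0 : X) (f : A -> X) (a : A) :
  ext x0 f (val a) = f a.
Proof. by rewrite (extE _ _ (valP a)); congr f; exact: val_inj. Qed.

Lemma smon_val X n (T : set 'rV[R]_n) (f : 'rV[R]_n -> X) :
  smon T f -> smooth (fun x : T => f (val x)).
Proof.
move=> sf m U p [oU sp]; pose h := valL_ 0 (val \o p : U -> 'rV[R]_n).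
have hE (u : U) : h (val u) = val (p u).
  rewrite /h (valLE _ (valP u)) /=; congr (val (p _)); exact: val_inj.
have hT u : U u -> T (h u).
  by move=> Uu; rewrite -[u]/(val (SigSub (mem_set Uu))) hE; exact: set_valP.
have := sf m U h oU sp hT; congr plot; apply/funext => u /=.
by rewrite hE.
Qed.

Lemma plot_val n m (T : set 'rV[R]_n) (U : set 'rV[R]_m) (p : U -> T) h :
  open U -> smooth_on U h -> (forall u : U, val (p u) = h (val u)) ->
  plot p.
Proof.
move=> oU sh ph; split => // k.
apply: (eq_ndifferentiable oU _ (sh k)) => u Uu.
by rewrite (valLE _ (mem_set Uu)); exact: esym (ph (SigSub (mem_set Uu))).
Qed.

Lemma smooth_ext X n (T : set 'rV[R]_n) (x0 : X) (f : T -> X) :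
  smooth f -> smon T (ext x0 f).
Proof.
move=> sf m U h oU sh hT.
pose p (u : U) : T := SigSub (mem_set (hT _ (set_valP u))).
have pp : plot p by exact: (plot_val oU sh).
have := sf _ _ _ pp; congr plot; apply/funext => u /=.
by rewrite (extE _ _ (mem_set (hT _ (set_valP u)))).
Qed.

Lemma cube_const (t : R) : I01 t -> cube R 1 (const_mx t).
Proof. by move=> It i; rewrite mxE. Qed.

Definition ext2 X n (x0 : X) (f : cube R n * cube R 1 -> X) (p : 'rV[R]_n * R) : X :=
  match pselect (cube R n p.1), pselect (I01 p.2) with
  | left c, left c' =>
      f (SigSub (mem_set c), SigSub (mem_set (cube_const c')))
  | _, _ => x0
  end.

Lemma ext2E X n (x0 : X) (f : cube R n * cube R 1 -> X) (x : cube R n) (t : cube R 1) :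
  ext2 x0 f (val x, val t ord0 ord0) = f (x, t).
Proof.
rewrite /ext2/=; case: pselect => [cx|]; last by move=> /(_ (set_valP x)).
case: pselect => [ct|]; last by move=> /(_ (set_valP t ord0)).
congr (f (_, _)); apply: val_inj => //=.
by apply/rowP => i; rewrite !mxE (ord1 i).
Qed.

Lemma smooth_ext2 X n (x0 : X) (f : cube R n * cube R 1 -> X) :
  smooth f -> smon (box n) (ext2 x0 f).
Proof.
move=> sf m U h oU sh hT.
pose p1 (u : U) : cube R n := SigSub (mem_set (hT _ (set_valP u)).1).
pose p2 (u : U) : cube R 1 := SigSub (mem_set (cube_const (hT _ (set_valP u)).2)).
have pp1 : plot p1.
  by apply: (plot_val (h := fun u => (h u).1) oU) => // k; apply: ndifferentiable_fst.
have pp2 : plot p2.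
  apply: (plot_val (h := fun u => const_mx (h u).2) oU) => //.
  have -> : (fun u => const_mx (h u).2) = (fun q => \row_(i < 1) q.2) \o h.
    by apply/funext => u; apply/rowP => i; rewrite !mxE.
  by apply: (_ : sm (fun q : 'rV[R]_n * R => \row_(i < 1) q.2)) => //; solve_sm.
have := sf _ _ (fun u => (p1 u, p2 u)) (conj pp1 pp2); congr plot.
apply/funext => u /=; rewrite -(ext2E x0) /=.
by congr (ext2 x0 f); rewrite mxE; case: (h (val u)).
Qed.

Lemma smon_val2 X n (f : 'rV[R]_n * R -> X) : smon (box n) f ->
  smooth (fun q : cube R n * cube R 1 => f (val q.1, val q.2 ord0 ord0)).
Proof.
move=> sf m U p [[oU sp1] [_ sp2]].
pose h1 := valL_ 0 (val \o (fst \o p) : U -> 'rV[R]_n).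
pose h2 := valL_ 0 (val \o (snd \o p) : U -> 'rV[R]_1).
have hE1 (u : U) : h1 (val u) = val (p u).1.
  rewrite /h1 (valLE _ (valP u)) /=; congr (val (p _).1); exact: val_inj.
have hE2 (u : U) : h2 (val u) = val (p u).2.
  rewrite /h2 (valLE _ (valP u)) /=; congr (val (p _).2); exact: val_inj.
have sh : smooth_on U (fun u => (h1 u, h2 u ord0 ord0)).
  move=> k; apply: ndifferentiable_pair => //.
  by apply: ndifferentiable_coord => //; exact: (sp2 k).
have hT u : U u -> box n (h1 u, h2 u ord0 ord0).
  move=> Uu; rewrite -[u]/(val (SigSub (mem_set Uu))) hE1 hE2.
  by split; [exact: set_valP|exact: (set_valP (p _).2)].
have := sf m U _ oU sh hT; congr plot; apply/funext => u /=.
by rewrite hE1 hE2.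
Qed.

End totalization.

Section homotopies.
Variables (R : realType) (X : diffeologicalType R).

Definition htpy n (x0 : X) (f g : 'rV[R]_n -> X) : Prop :=
  exists H : 'rV[R]_n * R -> X,
    [/\ smon (box n) H, forall x, cube R n x -> H (x, 0) = f x,
      forall x, cube R n x -> H (x, 1) = g x
      & forall x t, bd n x -> I01 t -> H (x, t) = x0].

Lemma htpy_refl n x0 (f : 'rV[R]_n -> X) : smon (cube R n) f ->
  (forall x, bd n x -> f x = x0) -> htpy x0 f f.
Proof.
move=> sf fb; exists (fun p => f p.1); split => //.
  by apply: (smon_comp sf (c := fst)); [solve_sm|move=> p []].
by move=> x t bx _; exact: fb.
Qed.

Lemma htpy_sym n x0 (f g : 'rV[R]_n -> X) : htpy x0 f g -> htpy x0 g f.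
Proof.
move=> [H [sH H0 H1 Hb]]; exists (fun p => H (p.1, 1 - p.2)); split.
- apply: (smon_comp sH (c := fun p : 'rV[R]_n * R => (p.1, 1 - p.2))); first by solve_sm.
  by move=> p [cp Ip]; split => //; exact: I01_onem.
- by move=> x cx; rewrite /= subr0 H1.
- by move=> x cx; rewrite /= subrr H0.
- by move=> x t bx It; rewrite Hb//; exact: I01_onem.
Qed.

Lemma htpy_trans n x0 (f g h : 'rV[R]_n -> X) : htpy x0 f g -> htpy x0 g h -> htpy x0 f h.
Proof.
move=> [H [sH H0 H1 Hb]] [K [sK K0 K1 Kb]].
(* Thanks to [step], both halves are constant for times between 1/3 and 2/3, so the concatenation is
   smooth at 1/2. *)
pose L (p : 'rV[R]_n * R) :=
  if p.2 < 2^-1 then H (p.1, step (2 * p.2)) else K (p.1, step (2 * p.2 - 1)).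
have LH x t : cube R n x -> t < 2 / 3 -> L (x, t) = H (x, step (2 * t)).
  move=> cx t3; rewrite /L /=; case: ltP => // t2.
  by rewrite step0 ?K0 ?[step (2 * t)]step1 ?H1//; lra.
have LK x t : cube R n x -> 3^-1 < t -> L (x, t) = K (x, step (2 * t - 1)).
  move=> cx t3; rewrite /L /=; case: ltP => // t2.
  by rewrite step1 ?H1 ?[step (2 * t - 1)]step0 ?K0//; lra.
exists L; split.
- apply: (@smon_glue _ _ _ _ _ (fun p : 'rV[R]_n * R => H (p.1, step (2 * p.2)))
    (fun p : 'rV[R]_n * R => K (p.1, step (2 * p.2 - 1)))
    [set p : 'rV[R]_n * R | p.2 < 2 / 3] [set p : 'rV[R]_n * R | 3^-1 < p.2]).
  + by apply: (topen_lt (a := snd)); solve_sm.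
  + by apply: (topen_gt (a := snd)); solve_sm.
  + by move=> [x t] _ /=; have [|] := ltP t (2 / 3); [left|right; lra].
  + apply: (smon_comp sH (c := fun p : 'rV[R]_n * R => (p.1, step (2 * p.2)))).
      by solve_sm.
    by move=> p [[cp _] _]; split => //; exact: step01.
  + apply: (smon_comp sK (c := fun p : 'rV[R]_n * R => (p.1, step (2 * p.2 - 1)))).
      by solve_sm.
    by move=> p [[cp _] _]; split => //; exact: step01.
  + by move=> [x t] [cx _] /=; exact: LH.
  + by move=> [x t] [cx _] /=; exact: LK.
- by move=> x cx; rewrite LH ?mulr0 ?step0 ?H0//; lra.
- by move=> x cx; rewrite LK ?mulr1 ?step1 ?K1//; lra.
- move=> x t bx It; rewrite /L /=.
  by case: ltP => _; [apply: Hb|apply: Kb] => //; exact: step01.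
Qed.

Lemma eq_htpy n x0 (f f' g g' : 'rV[R]_n -> X) :
  (forall x, cube R n x -> f x = f' x) -> (forall x, cube R n x -> g x = g' x) ->
  htpy x0 f g -> htpy x0 f' g'.
Proof.
move=> ff' gg' [H [sH H0 H1 Hb]]; exists H; split => // x cx.
  by rewrite H0// ff'.
by rewrite H1// gg'.
Qed.

Lemma cube_boundaryP n (x : cube R n) : cube_boundary x <-> bd n (val x).
Proof. by split=> [xb|[]//]; split => //; exact: set_valP. Qed.

Lemma pair_homotopicP n x0 (f g : cube R n -> X) :
  pair_homotopic x0 f g <-> htpy x0 (ext x0 f) (ext x0 g).
Proof.
have val01 : val (I0 R) ord0 ord0 = 0 /\ val (I1 R) ord0 ord0 = 1 by rewrite /= !mxE.
have [v0 v1] := val01.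
split=> [[H [sH H0 H1 Hb]]|[H [sH H0 H1 Hb]]].
  exists (ext2 x0 H); split; first exact: smooth_ext2.
  - by move=> x /mem_set cx; rewrite (extE _ _ cx) -H0 -(ext2E x0) v0.
  - by move=> x /mem_set cx; rewrite (extE _ _ cx) -H1 -(ext2E x0) v1.
  - move=> x t bx It; have cx := mem_set bx.1.
    pose t' : cube R 1 := SigSub (mem_set (cube_const It)).
    have -> : t = val t' ord0 ord0 by rewrite /= mxE.
    rewrite -[x]/(val (SigSub cx)) ext2E; apply: Hb.
    by apply/cube_boundaryP.
exists (fun q : cube R n * cube R 1 => H (val q.1, val q.2 ord0 ord0)); split.
- exact: smon_val2.
- by move=> x; rewrite v0 H0 ?ext_val//; exact: set_valP.
- by move=> x; rewrite v1 H1 ?ext_val//; exact: set_valP.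
- move=> x t /cube_boundaryP bx; apply: Hb => //.
  exact: (set_valP t).
Qed.

Lemma pair_map_ext n x0 (f : cube R n -> X) : pair_map x0 f ->
  smon (cube R n) (ext x0 f) /\ (forall x, bd n x -> ext x0 f x = x0).
Proof.
move=> [sf fb]; split; first exact: smooth_ext.
move=> x bx; rewrite (extE _ _ (mem_set bx.1)); apply: fb.
exact/cube_boundaryP.
Qed.

Lemma smon_pair_map n x0 (f : 'rV[R]_n -> X) : smon (cube R n) f ->
  (forall x, bd n x -> f x = x0) -> pair_map x0 (fun x : cube R n => f (val x)).
Proof.
by move=> sf fb; split; [exact: smon_val|move=> x /cube_boundaryP; exact: fb].
Qed.

Lemma pair_homotopic_refl n x0 (f : cube R n -> X) :
  pair_map x0 f -> pair_homotopic x0 f f.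
Proof. by move=> /pair_map_ext[? ?]; apply/pair_homotopicP; exact: htpy_refl. Qed.

Lemma pair_homotopic_sym n x0 (f g : cube R n -> X) :
  pair_homotopic x0 f g -> pair_homotopic x0 g f.
Proof. by move=> /pair_homotopicP/htpy_sym/pair_homotopicP. Qed.

Lemma pair_homotopic_trans n x0 (f g h : cube R n -> X) :
  pair_homotopic x0 f g -> pair_homotopic x0 g h -> pair_homotopic x0 f h.
Proof.
move=> /pair_homotopicP fg /pair_homotopicP gh; apply/pair_homotopicP.
exact: htpy_trans gh.
Qed.

Lemma eq_pin_class n x0 (f g : cube R n -> X) :
  pair_homotopic x0 f g -> pin_class x0 f = pin_class x0 g.
Proof.
move=> fg; apply/seteqP; split => h [ph] H; split => //.
  exact: pair_homotopic_trans (pair_homotopic_sym fg) H.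
exact: pair_homotopic_trans fg H.
Qed.

Lemma pin_class_id n x0 (f : cube R n -> X) : pair_map x0 f -> pin_class x0 f f.
Proof. by move=> pf; split => //; exact: pair_homotopic_refl. Qed.

Lemma pair_homotopic_pin_class n x0 (f g : cube R n -> X) : pair_map x0 g ->
  pin_class x0 f = pin_class x0 g -> pair_homotopic x0 f g.
Proof. by move=> pg E; have := pin_class_id pg; rewrite -E => -[]. Qed.

(** In degree 0 there is no boundary, so any [z] can serve as base point; paths inherit symmetry and
    transitivity from [htpy]. *)
Lemma smooth_pathP (x y z : X) :
  smooth_path x y <-> htpy z (fun _ : 'rV[R]_0 => x) (fun=> y).
Proof.
have c0 (u : 'rV[R]_0) : cube R 0 u by move=> [].
split=> [[g [sg g0 g1]]|[H [sH H0 H1 _]]].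
  exists (fun p => ext z g (const_mx p.2)); split.
  - apply: (smon_comp (smooth_ext z sg) (c := fun p : 'rV[R]_0 * R => const_mx p.2)).
      rewrite (_ : (fun _ => _) = fun p : 'rV[R]_0 * R => \row_i p.2); first by solve_sm.
      by apply/funext => p; apply/rowP => i; rewrite !mxE.
    by move=> p [_ Ip]; exact: cube_const.
  - by move=> u _; rewrite -g0 -(ext_val z).
  - by move=> u _; rewrite -g1 -(ext_val z).
  - by move=> u t [_ [[]]].
exists (fun t : cube R 1 => H (0, val t ord0 ord0)); split.
- apply: (smon_val (f := fun t : 'rV[R]_1 => H (0, t ord0 ord0))).
  apply: (smon_comp sH (c := fun t : 'rV[R]_1 => ((0 : 'rV[R]_0), t ord0 ord0))).
    by solve_sm.
  by move=> t ct; split; [exact: c0|exact: ct].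
- by rewrite /= mxE H0.
- by rewrite /= mxE H1.
Qed.

Lemma smooth_path_refl (x : X) : smooth_path x x.
Proof.
apply/(smooth_pathP _ _ x); apply: htpy_refl; first exact: smon_cst.
by move=> u [_ [[]]].
Qed.

Lemma smooth_path_sym (x y : X) : smooth_path x y -> smooth_path y x.
Proof. by move=> /(smooth_pathP _ _ x)/htpy_sym/(smooth_pathP _ _ x). Qed.

Lemma smooth_path_trans (x y z : X) :
  smooth_path x y -> smooth_path y z -> smooth_path x z.
Proof.
move=> /(smooth_pathP _ _ x) xy /(smooth_pathP _ _ x) yz.
by apply/(smooth_pathP _ _ x); exact: htpy_trans yz.
Qed.

Lemma eq_path_component (x y : X) :
  smooth_path x y -> path_component x = path_component y.
Proof.
move=> xy; apply/seteqP; split => z /= H.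
  exact: smooth_path_trans (smooth_path_sym xy) H.
exact: smooth_path_trans xy H.
Qed.

Lemma smooth_path_component (x y : X) :
  path_component x = path_component y -> smooth_path x y.
Proof. by move=> E; have := smooth_path_refl y; rewrite -[smooth_path y y]/(path_component y y) -E. Qed.

End homotopies.

Section induced.
Variables (R : realType) (X Y : diffeologicalType R) (phi : X -> Y).
Hypothesis phi_smooth : smooth phi.

Lemma pair_map_comp n x0 (f : cube R n -> X) :
  pair_map x0 f -> pair_map (phi x0) (phi \o f).
Proof.
move=> [sf fb]; split; last by move=> x /fb /= ->.
by move=> m U p pp; apply: phi_smooth; exact: sf.
Qed.

Lemma pair_homotopic_comp n x0 (f g : cube R n -> X) :
  pair_homotopic x0 f g -> pair_homotopic (phi x0) (phi \o f) (phi \o g).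
Proof.
move=> [H [sH H0 H1 Hb]]; exists (phi \o H); split => /=.
- by move=> m U p pp; apply: phi_smooth; exact: sH.
- by move=> x; rewrite H0.
- by move=> x; rewrite H1.
- by move=> x t /Hb ->.
Qed.

(** All representatives of a class have homotopic images, so the union that defines [pin_map] is a
    single class. *)
Lemma pin_map_class n x0 (f : cube R n -> X) : pair_map x0 f ->
  pin_map phi x0 (pin_class x0 f) = pin_class (phi x0) (phi \o f).
Proof.
move=> pf; apply/seteqP; split => [h [g [pg fg]]|h H].
  by rewrite (eq_pin_class (pair_homotopic_comp fg)).
by exists f => //; exact: pin_class_id.
Qed.

Lemma smooth_path_comp (x y : X) : smooth_path x y -> smooth_path (phi x) (phi y).
Proof.
move=> [g [sg <- <-]]; exists (phi \o g); split => //.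
by move=> m U p pp; apply: phi_smooth; exact: sg.
Qed.

Lemma pi0_map_component (x : X) :
  pi0_map phi (path_component x) = path_component (phi x).
Proof.
apply/seteqP; split => [h [y xy]|h H].
  by rewrite (eq_path_component (smooth_path_comp xy)).
by exists x => //; exact: smooth_path_refl.
Qed.

End induced.

(** * Lifting properties of a weak equivalence between subspaces *)

Section weak_equivalence_lifting.
Variables (R : realType) (X Y : diffeologicalType R) (phi : X -> Y).
Variables (A : set X) (B : set Y) (phiAB : set_fun A B phi).
Hypothesis W : weak_homotopy_equivalence (restriction phiAB).
Let r := restriction phiAB.

Lemma smooth_val (Z : diffeologicalType R) (C : set Z) : smooth (val : C -> Z).
Proof. by move=> n U p. Qed.

Let r_smooth : smooth r. Proof. by have [] := W 0. Qed.

Let box0 n (q : cube R n * cube R 1) : box n (val q.1, val q.2 ord0 ord0).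
Proof. by split; [exact: (set_valP q.1)|exact: (set_valP q.2 ord0)]. Qed.

Definition corestr (Z : Type) (C : set Z) n (f : 'rV[R]_n -> Z)
  (fC : forall x, cube R n x -> C (f x)) (x : cube R n) : C :=
  SigSub (mem_set (fC _ (set_valP x))).

Lemma corestr_pair_map (Z : diffeologicalType R) (C : set Z) n (c : C)
    (f : 'rV[R]_n -> Z) (fC : forall x, cube R n x -> C (f x)) :
  smon (cube R n) f -> (forall x, bd n x -> f x = val c) -> pair_map c (corestr fC).
Proof.
move=> sf fb; split; first by move=> m U p pp; exact: (smon_val sf pp).
by move=> x /cube_boundaryP bx; apply: val_inj; exact: fb.
Qed.

Lemma weak_pi0_lifting : pi0_lifting phi A B.
Proof.
move=> b Bb; have [_ _ surj _ _] := W 0.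
pose b' : B := SigSub (mem_set Bb).
have [] := surj (path_component b'); first by exists b'.
move=> _ [a' _ <-]; rewrite pi0_map_component// => E.
have [g [sg g0 g1]] := smooth_path_component (esym E).
pose p t := val (ext (r a') g (const_mx t : 'rV[R]_1)).
exists (val a'), p; split.
- exact: set_valP.
- apply: (smon_smooth (@smooth_val _ _)).
  apply: (smon_comp (smooth_ext (r a') sg) (c := fun t : R => const_mx t)).
    rewrite (_ : (fun _ => _) = fun t : R => \row_i t); first by solve_sm.
    by apply/funext => t; apply/rowP => i; rewrite !mxE.
  by move=> t It; exact: cube_const.
- by move=> t _; exact: set_valP.
- by rewrite /p -(ext_val (r a')) /= in g0 *; rewrite g0.
- by rewrite /p -(ext_val (r a')) /= in g1 *; rewrite g1.
Qed.

Lemma weak_null_lifting n : null_lifting phi A B n.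
Proof.
move=> a u N Aa su uA ua sN NB N0 N1 Nb.
(* An N-equivalence is injective only in degrees below N, so degree n calls for N = n + 1. *)
have [_ inj0 _ inj _] := W n.+1.
pose a' : A := SigSub (mem_set Aa).
case: n u N su uA ua sN NB N0 N1 Nb inj0 inj => [|n] u N su uA ua sN NB N0 N1 Nb inj0 inj.
  have c0 (y : 'rV[R]_0) : cube R 0 y by move=> [].
  have y0 (y : 'rV[R]_0) : y = 0 by apply/rowP => -[].
  pose u' : A := SigSub (mem_set (uA _ (c0 0))).
  have : path_component u' = path_component a'.
    apply: (inj0 isT); try by apply: mem_set; eexists.
    rewrite !pi0_map_component//; apply: eq_path_component.
    have Nc (t : cube R 1) : B (N (0, val t ord0 ord0)).
      by apply: NB; split => //; exact: (set_valP t).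
    exists (fun t => SigSub (mem_set (Nc t))); split.
    + move=> m U p pp; apply: (smon_val (f := fun t : 'rV[R]_1 => N (0, t ord0 ord0)) _ pp).
      apply: (smon_comp sN (c := fun t : 'rV[R]_1 => ((0 : 'rV[R]_0), t ord0 ord0))).
        by solve_sm.
      by move=> t ct; split; [exact: c0|exact: ct].
    + by apply: val_inj => /=; rewrite mxE N0.
    + by apply: val_inj => /=; rewrite mxE N1.
  move=> /smooth_path_component/(smooth_pathP _ _ a') [H [sH H0 H1 _]].
  exists (fun p => val (H p)); split.
  - by split; [exact: (smon_smooth (@smooth_val _ _))|move=> p _; exact: set_valP].
  - by move=> y cy; rewrite H0//= (y0 y).
  - by move=> y cy; rewrite H1.
  - by move=> y s [_ [[]]].
have pu : pair_map a' (corestr uA) by exact: corestr_pair_map.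
have pa : pair_map a' (fun _ : cube R n.+1 => a').
  by split => // m U p pp; apply: plot_cst; exact: plot_open pp.
have : pin_class a' (corestr uA) = pin_class a' (fun=> a').
  apply: (inj n.+1 a'); first by rewrite ltnS leqnn.
  - by apply: mem_set; exists (corestr uA).
  - by apply: mem_set; exists (fun=> a').
  rewrite !pin_map_class//; apply: eq_pin_class.
  exists (fun q => SigSub (mem_set (NB _ (box0 q)))); split.
  - by move=> m U p pp; exact: (smon_val2 sN pp).
  - by move=> x; apply: val_inj => /=; rewrite mxE N0//; exact: (set_valP x).
  - by move=> x; apply: val_inj => /=; rewrite mxE N1//; exact: (set_valP x).
  - move=> x t /cube_boundaryP bx; apply: val_inj => /=; rewrite Nb//.
    exact: (set_valP t ord0).
move=> /(pair_homotopic_pin_class pa)/pair_homotopicP [H [sH H0 H1 Hb]].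
exists (fun p => val (H p)); split.
- by split; [exact: (smon_smooth (@smooth_val _ _))|move=> p _; exact: set_valP].
- by move=> y cy; rewrite H0// (extE _ _ (mem_set cy)).
- by move=> y cy; rewrite H1// (extE _ _ (mem_set cy)).
- by move=> y s yb Is; rewrite Hb.
Qed.

Lemma weak_class_lifting n : class_lifting phi A B n.+1.
Proof.
move=> a f Aa sf fB fb.
have [_ _ _ _ surj] := W n.+1.
pose a' : A := SigSub (mem_set Aa).
have pf : pair_map (r a') (corestr fB) by exact: corestr_pair_map.
have [] := surj n.+1 a' _ (pin_class (r a') (corestr fB)); first by rewrite leqnn.
  by exists (corestr fB).
move=> _ [b pb <-]; rewrite pin_map_class// => E.
have := pair_homotopic_pin_class (pair_map_comp r_smooth pb) (esym E).
move=> /pair_homotopicP [H [sH H0 H1 Hb]].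
have [sb bb] := pair_map_ext pb.
exists (fun x => val (ext a' b x)), (fun p => val (H p)); split.
- by split; [exact: (smon_smooth (@smooth_val _ _))|move=> p _; exact: set_valP].
- by move=> y yb; rewrite bb.
- by split; [exact: (smon_smooth (@smooth_val _ _))|move=> p _; exact: set_valP].
- by move=> y cy; rewrite H0// H1// !(extE _ _ (mem_set cy)).
- by move=> y s yb Is; rewrite Hb.
Qed.

End weak_equivalence_lifting.

(** * Weak equivalences from relative lifting *)

Section from_lifting.
Variables (R : realType).

Lemma htpy_repar (X : diffeologicalType R) n (r : R -> R) (x0 : X) (f : 'rV[R]_n -> X) :
  repar r -> smon (cube R n) f -> (forall x, bd n x -> f x = x0) ->
  htpy x0 f (fun x => f (pw r x)).
Proof.
move=> rr sf fb; have sr := repar_sm rr.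
pose l (p : 'rV[R]_n * R) : 'rV[R]_n := \row_i lin p.2 (p.1 ord0 i) (r (p.1 ord0 i)).
exists (fun p => f (l p)); split.
- apply: (smon_comp sf (c := l)); first by rewrite /l /lin; solve_sm.
  move=> p [cp Ip] i; rewrite mxE; apply: lin01 => //; first exact: cp.
  by have [_ _ _] := rr; apply; exact: cp.
- move=> x cx; congr f; apply/rowP => i.
  by rewrite mxE /lin subr0 mul1r mul0r addr0.
- move=> x cx; congr f; apply/rowP => i.
  by rewrite !mxE /lin subrr mul1r mul0r add0r.
- by move=> x t bx It; apply: fb; exact: lin_repar_bd.
Qed.

Variables (X Y : diffeologicalType R) (phi : X -> Y).
Hypothesis phi_smooth : smooth phi.

(** The compression criterion for weak equivalences, up to a reparametrization [r]; the homotopy is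
    stationary on the boundary. *)
Definition relative_lifting : Prop :=
  forall n (f : 'rV[R]_n -> Y) (g : 'rV[R]_n -> X),
  smon (cube R n) f -> smon (bd n) g -> (forall x, bd n x -> f x = phi (g x)) ->
  exists r G (H : 'rV[R]_n * R -> Y),
    [/\ repar r, smon (cube R n) G, smon (box n) H,
        forall x, cube R n x -> H (x, 0) = f (pw r x) /\ H (x, 1) = phi (G x)
      & forall x, bd n x -> G x = g (pw r x) /\
          forall t, I01 t -> H (x, t) = phi (g (pw r x))].

Hypothesis lift : relative_lifting.

Lemma htpy_surj n (x0 : X) (f : 'rV[R]_n -> Y) : smon (cube R n) f ->
  (forall x, bd n x -> f x = phi x0) ->
  exists g : 'rV[R]_n -> X, [/\ smon (cube R n) g, forall x, bd n x -> g x = x0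
    & htpy (phi x0) f (phi \o g)].
Proof.
move=> sf fb.
have [r [G [H [rr sG sH H01 Hb]]]] := lift sf (@smon_cst _ _ _ (bd n) x0) fb.
exists G; split => //; first by move=> x /Hb[].
apply: htpy_trans (htpy_repar rr sf fb) _; exists H; split => //.
- by move=> x /H01[].
- by move=> x /H01[].
- by move=> x t /Hb[_]; exact.
Qed.

Lemma htpy_inj n (x0 : X) (u0 u1 : 'rV[R]_n -> X) :
  smon (cube R n) u0 -> (forall x, bd n x -> u0 x = x0) ->
  smon (cube R n) u1 -> (forall x, bd n x -> u1 x = x0) ->
  htpy (phi x0) (phi \o u0) (phi \o u1) -> htpy x0 u0 u1.
Proof.
move=> su0 u0b su1 u1b [H [sH H0 H1 Hb]].
pose f (x : 'rV[R]_n.+1) := H (init x, lst x).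
(* The jump at height 1/2 is harmless: a boundary point strictly between the two ends lies on a
   side, where both branches are [x0]. *)
pose g (x : 'rV[R]_n.+1) := if lst x < 2^-1 then u0 (init x) else u1 (init x).
have gb x : bd n (init x) -> g x = x0.
  by move=> xb; rewrite /g; case: ifP => _; [exact: u0b|exact: u1b].
have sf : smon (cube R n.+1) f.
  apply: (smon_comp sH (c := fun x : 'rV[R]_n.+1 => (init x, lst x))).
    by solve_sm; apply: sm_lst; solve_sm.
  by move=> x cx; split; [exact: cube_init|exact: cube_lst].
have g0 x : bd n.+1 x -> lst x < 1 -> g x = u0 (init x).
  move=> bx; rewrite /g; have [->|->|xb] := bdP bx.
  - by move=> _; rewrite ifT.
  - by rewrite ltxx.
  - by rewrite u0b// u1b//; case: ifP.
have g1 x : bd n.+1 x -> 0 < lst x -> g x = u1 (init x).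
  move=> bx; rewrite /g; have [->|->|xb] := bdP bx.
  - by rewrite ltxx.
  - by move=> _; rewrite ifF//; apply/negbTE; rewrite -leNgt; lra.
  - by rewrite u0b// u1b//; case: ifP.
have sg : smon (bd n.+1) g.
  have slst : sm (@lst R n) by exact: (@sm_coord R _ _ id).
  have sinit : sm (@init R n) by exact: (@sm_init R _ _ id).
  apply: (@smon_glue _ _ _ _ _ (fun x => u0 (init x)) (fun x => u1 (init x))
    [set x | lst x < 1] [set x | 0 < lst x]).
  - exact: topen_lt.
  - exact: topen_gt.
  - by move=> x _ /=; have [|] := ltP (lst x) 1; [left|right; lra].
  - by apply: (smon_comp su0 sinit) => x [[cx _] _]; exact: cube_init.
  - by apply: (smon_comp su1 sinit) => x [[cx _] _]; exact: cube_init.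
  - by move=> x bx /=; exact: g0.
  - by move=> x bx /=; exact: g1.
have fg x : bd n.+1 x -> f x = phi (g x).
  move=> bx; have cx := cube_init bx.1; rewrite /f.
  case: (bdP bx) => [x0'|x1'|xb].
  - by rewrite g0 ?x0' ?H0// ltr01.
  - by rewrite g1 ?x1' ?H1// ltr01.
  - by rewrite Hb ?gb//; exact: (cube_lst bx.1).
have [r [G [K [rr sG sK K01 Kb]]]] := lift sf sg fg.
have [_ r0 r1 _] := rr.
(* [G] joins the two maps after reparametrization by [r], which is undone at both ends. *)
apply: htpy_trans (htpy_repar rr su0 u0b) _.
apply: htpy_trans (htpy_sym (htpy_repar rr su1 u1b)).
exists (fun p => G (snoc p.1 p.2)); split.
- apply: (smon_comp sG (c := fun p : 'rV[R]_n * R => snoc p.1 p.2)).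
    by apply: sm_snoc; solve_sm.
  by move=> p [cp Ip]; exact: cube_snoc.
- move=> y cy; have b0 := bd_snoc0 cy; have [-> _] := Kb _ b0.
  rewrite g0 ?pw_snoc ?init_snoc ?lst_snoc ?r0//.
  by apply: bd_snoc0; exact: repar_cube.
- move=> y cy; have b1 := bd_snoc1 cy; have [-> _] := Kb _ b1.
  rewrite g1 ?pw_snoc ?init_snoc ?lst_snoc ?r1//.
  by apply: bd_snoc1; exact: repar_cube.
- move=> y t yb It; have [-> _] := Kb _ (bd_snocl yb It).
  by rewrite gb// pw_snoc init_snoc; exact: repar_bd.
Qed.

Lemma ext_comp n (x0 : X) (f : cube R n -> X) :
  ext (phi x0) (phi \o f) = phi \o ext x0 f.
Proof. by apply/funext => x; rewrite /ext /=; case: pselect. Qed.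

(** A lift on the boundary is a total function into [X], so [relative_lifting] says nothing when [X]
    is empty; surjectivity on pi_0 then has to come from elsewhere. *)
Hypothesis inhabited_dom : Y -> exists x : X, True.

Lemma weak_of_relative_lifting : weak_homotopy_equivalence phi.
Proof.
move=> N; split => //.
- move=> _ C D /set_mem[x _ <-] /set_mem[y _ <-].
  rewrite !pi0_map_component// => /smooth_path_component/(smooth_pathP _ _ (phi x)) H.
  apply/eq_path_component/(smooth_pathP _ _ x); apply: (htpy_inj _ _ _ _ H);
    by [exact: smon_cst|move=> ? [_ [[]]]].
- move=> _ [y _ <-]; have [x0 _] := inhabited_dom y.
  have [] := @htpy_surj 0 x0 (fun=> y); [exact: smon_cst|by move=> ? [_ [[]]]|].
  move=> g [sg _ [H [sH H0 H1 Hb]]].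
  exists (path_component (g 0)); first by exists (g 0).
  rewrite pi0_map_component//; apply/esym/eq_path_component.
  apply/(smooth_pathP _ _ (phi x0)); exists H; split => // u cu.
  by rewrite H1//= (_ : u = 0)//; apply/rowP => -[].
- move=> n x _ C D /set_mem[u pu <-] /set_mem[v pv <-].
  rewrite !pin_map_class// => E; apply/eq_pin_class/pair_homotopicP.
  have := pair_homotopic_pin_class (pair_map_comp phi_smooth pv) E.
  move=> /pair_homotopicP; rewrite !ext_comp.
  have [su ub] := pair_map_ext pu; have [sv vb] := pair_map_ext pv.
  exact: htpy_inj.
- move=> n x _ _ [f pf <-]; have [sf fb] := pair_map_ext pf.
  have [g [sg gb fg]] := htpy_surj sf fb.
  have pg := smon_pair_map sg gb.
  exists (pin_class x (fun c : cube R n => g (val c))); first by exists (fun c : cube R n => g (val c)).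
  rewrite pin_map_class//; apply/esym/eq_pin_class/pair_homotopicP.
  apply: eq_htpy fg => // y cy; rewrite ext_comp /=.
  by rewrite (extE _ _ (mem_set cy)).
Qed.

End from_lifting.

(** * Skeleta of a grid *)

Section grid.
Variables (R : realType) (n M : nat).
Notation step2 := (@step2 R).
Notation step3 := (@step3 R).
Implicit Types (x y : 'rV[R]_n) (t : R) (j : nat).

(* Locally constant near the integers in [0, M]: near any point of the grid,
   [pw gstep] takes values in a single closed face, which makes maps glued from
   faces smooth. *)
Definition gstep t : R := \sum_(k < M) step3 (t - k%:R).

Lemma sum_ltn_ord j : (j <= M)%N -> \sum_(k < M) (k < j)%N%:R = j%:R :> R.
Proof.
move=> jM; transitivity (\sum_(k < j) (1 : R)); last by rewrite sumr_const card_ord.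
rewrite (big_ord_widen M (fun=> 1) jM) [RHS]big_mkcond.
by apply: eq_bigr => k _; case: (k < j)%N.
Qed.

Lemma step3_eq0 t : t <= 4 / 9 -> step3 t = 0.
Proof. by move=> t0; rewrite /step3 step0//; lra. Qed.

Lemma step3_eq1 t : 5 / 9 <= t -> step3 t = 1.
Proof. by move=> t0; rewrite /step3 step1//; lra. Qed.

Lemma gstep_near j t : (j <= M)%N -> j%:R - 4 / 9 <= t <= j%:R + 4 / 9 ->
  gstep t = j%:R.
Proof.
move=> jM /andP[t0 t1]; rewrite -(sum_ltn_ord jM); apply: eq_bigr => k _.
case: (ltnP k j) => [kj|jk].
  rewrite step3_eq1//; have : (k%:R + 1 : R) <= j%:R by rewrite natr1 ler_nat.
  by move=> ?; lra.
rewrite step3_eq0//; have : (j%:R : R) <= k%:R by rewrite ler_nat.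
by move=> ?; lra.
Qed.

Lemma gstep_nat j : (j <= M)%N -> gstep j%:R = j%:R.
Proof. by move=> jM; apply: gstep_near => //; apply/andP; split; lra. Qed.

Lemma gstep_cell j t : (j < M)%N -> j%:R <= t <= j%:R + 1 ->
  gstep t = j%:R + step3 (t - j%:R).
Proof.
move=> jM /andP[t0 t1].
transitivity (\sum_(k < M) (k < j)%N%:R + step3 (t - j%:R)); last first.
  by rewrite sum_ltn_ord// ltnW.
rewrite /gstep (bigD1 (Ordinal jM))//= [in RHS](bigD1 (Ordinal jM))//= ltnn add0r.
rewrite [LHS]addrC; congr (_ + _); apply: eq_bigr => k; rewrite -val_eqE /= => kj.
case: (ltngtP k j) kj => [kj|jk|//] _.
  rewrite step3_eq1//; have : (k%:R + 1 : R) <= j%:R by rewrite natr1 ler_nat.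
  by move=> ?; lra.
rewrite step3_eq0//; have : (j%:R + 1 : R) <= k%:R by rewrite natr1 ler_nat.
by move=> ?; lra.
Qed.

Lemma sm_gstep : sm gstep.
Proof. by rewrite /gstep; apply: sm_sum => k; rewrite /step3; solve_sm. Qed.

Definition grid : set 'rV[R]_n := [set x | forall i, 0 <= x ord0 i <= M%:R].
Definition grid_bd : set 'rV[R]_n :=
  [set x | grid x /\ exists i, x ord0 i = 0 \/ x ord0 i = M%:R].

Definition unit_cube (k : 'I_n -> 'I_M) : set 'rV[R]_n :=
  [set x | forall i, (k i)%:R <= x ord0 i <= (k i)%:R + 1].

(* [face x] encodes the open face of the grid containing [x], and [cell (face x)]
   is the closure of that face. *)
Definition corner x : {ffun 'I_n -> nat} := [ffun i => Num.trunc (x ord0 i)].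
Definition dirs x : {set 'I_n} :=
  [set i | x ord0 i != (Num.trunc (x ord0 i))%:R].
Definition face x := (corner x, dirs x).

Definition cell (c : {ffun 'I_n -> nat} * {set 'I_n}) : set 'rV[R]_n :=
  [set x | forall i, if i \in c.2 then is_true ((c.1 i)%:R <= x ord0 i <= (c.1 i)%:R + 1)
                     else x ord0 i = (c.1 i)%:R].

(** The size of [dirs x] is the dimension of the open face of x. The strict inequality makes this
    the boundary of the grid for q = 0 and the whole grid for q = n + 1. *)
Definition skel (q : nat) : set 'rV[R]_n :=
  [set x | grid x /\ (grid_bd x \/ (#|dirs x| < q)%N)].

Lemma dirs_corner x i : grid x -> i \in dirs x ->
  (corner x i)%:R < x ord0 i < (corner x i)%:R + 1.
Proof.
move=> gx; rewrite inE => xi; have /andP[x0 _] := gx i.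
have /andP[h1 h2] := truncn_itv x0; rewrite ffunE -natr1 in h2 *.
by rewrite lt_neqAle eq_sym xi h1.
Qed.

Lemma ndirs_corner x i : i \notin dirs x -> x ord0 i = (corner x i)%:R.
Proof. by rewrite inE negbK => /eqP; rewrite ffunE. Qed.

Lemma dirs_lt x i : grid x -> i \in dirs x -> (corner x i < M)%N.
Proof.
move=> gx ix; have /andP[h _] := dirs_corner gx ix; have /andP[_ h'] := gx i.
by rewrite -(ltr_nat R); lra.
Qed.

Lemma ndirs_le x i : grid x -> i \notin dirs x -> (corner x i <= M)%N.
Proof.
move=> gx ix; have /andP[_ h'] := gx i.
by rewrite -(ler_nat R) -ndirs_corner.
Qed.

Lemma cell_face x : grid x -> cell (face x) x.
Proof.
move=> gx i /=; case: ifPn => [/(dirs_corner gx)/andP[h1 h2]|/ndirs_corner//].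
by rewrite !ltW.
Qed.

Lemma cell_grid x y : grid x -> cell (face x) y -> grid y.
Proof.
move=> gx cy i; have := cy i => /=; case: ifPn => [ix /andP[h1 h2]|ix ->].
  have := dirs_lt gx ix; rewrite -(ler_nat R) -natr1 => h.
  have h0 : (0 : R) <= (corner x i)%:R by rewrite ler0n.
  by apply/andP; split; lra.
by rewrite ler0n ler_nat ndirs_le.
Qed.

Lemma dirs_cell x y i : grid x -> cell (face x) y -> i \in dirs y -> i \in dirs x.
Proof.
move=> gx cy; apply: contraTT => ix; have := cy i; rewrite /= (negbTE ix) => yi.
by rewrite inE yi natrK eqxx.
Qed.

Lemma face_cell x y : grid x -> cell (face x) y ->
  face y = face x \/ exists2 i, i \in dirs x & i \notin dirs y.
Proof.
move=> gx cy; have gy := cell_grid gx cy.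
have [sxy|/subsetPn[i ix iy]] := boolP (dirs x \subset dirs y); last first.
  by right; exists i.
left; have exy : dirs y = dirs x.
  by apply/eqP; rewrite finset.eqEsubset sxy andbT; apply/fintype.subsetP => i; exact: dirs_cell.
congr (_, _) => //; apply/ffunP => i; have := cy i => /=.
case: ifPn => [ix|ix yi]; last by rewrite [LHS]ffunE yi natrK.
have iy : i \in dirs y by rewrite exy.
have /andP[h1 h2] := dirs_corner gy iy.
move=> /andP[h3 h4]; apply/eqP; rewrite eqn_leq; apply/andP.
by split; rewrite -ltnS -(ltr_nat R) -natr1; lra.
Qed.

Lemma card_dirs_cell x y i : grid x -> cell (face x) y ->
  i \in dirs x -> i \notin dirs y -> (#|dirs y| < #|dirs x|)%N.
Proof.
move=> gx cy ix iy; apply: proper_card; apply/properP; split; last by exists i.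
by apply/fintype.subsetP => k; exact: dirs_cell.
Qed.

Lemma leq_dirs_cell x y : grid x -> cell (face x) y -> (#|dirs y| <= #|dirs x|)%N.
Proof.
by move=> gx cy; apply/subset_leq_card/fintype.subsetP => k; exact: dirs_cell.
Qed.

Lemma grid_bd_cell x y : grid_bd x -> cell (face x) y -> grid_bd y.
Proof.
move=> [gx [i xi]] cy; split; first exact: cell_grid cy.
exists i; suff ix : i \notin dirs x.
  by have := cy i; rewrite /= (negbTE ix) => ->; rewrite -ndirs_corner.
by rewrite inE negbK; case: xi => ->; rewrite ?natrK// truncn0.
Qed.

Lemma skel_cell q x y : skel q x -> cell (face x) y -> skel q y.
Proof.
move=> [gx h] cy; split; first exact: cell_grid cy.
case: h => [bx|hq]; first by left; exact: grid_bd_cell cy.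
by right; apply: leq_ltn_trans hq; exact: leq_dirs_cell.
Qed.

Lemma unit_cube_cell k x y : grid x -> unit_cube k x -> cell (face x) y ->
  unit_cube k y.
Proof.
move=> gx kx cy i; have := cy i => /=; have /andP[k0 k1] := kx i.
case: ifPn => [ix|/ndirs_corner <- ->]; last exact: kx.
have /andP[h1 h2] := dirs_corner gx ix.
suff -> : corner x i = k i by [].
apply/eqP; rewrite eqn_leq; apply/andP.
by split; rewrite -ltnS -(ltr_nat R) -natr1; lra.
Qed.

Lemma ex_unit_cube x : grid x -> ~ grid_bd x -> exists k, unit_cube k x.
Proof.
move=> gx nbx.
have lt i : (Num.trunc (x ord0 i) < M)%N.
  have /andP[x0 xM] := gx i; rewrite truncn_lt_nat// lt_neqAle xM andbT.
  by apply/eqP => xi; apply: nbx; split => //; exists i; right.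
exists (fun i => Ordinal (lt i)) => i /=; have /andP[x0 _] := gx i.
by have /andP[h1 h2] := truncn_itv x0; rewrite h1 natr1 ltW.
Qed.

Lemma cell_gstep_near x : grid x -> exists Q : set 'rV[R]_n,
  [/\ topen Q, Q x & forall y, Q y -> cell (face x) (pw gstep y)].
Proof.
(* In the directions of the face, x lies strictly between consecutive integers. In the others the
   radius 1/3 is smaller than the 4/9 within which [gstep] is constant. *)
move=> gx; pose lo i := if i \in dirs x then (corner x i)%:R else (corner x i)%:R - 3^-1 : R.
pose hi i := if i \in dirs x then (corner x i)%:R + 1 else (corner x i)%:R + 3^-1 : R.
exists [set y : 'rV[R]_n | forall i, lo i < y ord0 i /\ y ord0 i < hi i]; split.
- apply: (@topen_forall _ _ _ (fun i => [set y : 'rV[R]_n | lo i < y ord0 i] `&`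
    [set y : 'rV[R]_n | y ord0 i < hi i])) => i; apply: topenI.
    by apply: (topen_gt (a := fun y : 'rV[R]_n => y ord0 i)); solve_sm.
  by apply: (topen_lt (a := fun y : 'rV[R]_n => y ord0 i)); solve_sm.
- move=> i; rewrite /lo /hi /=; case: ifPn => [/(dirs_corner gx)/andP[]//|/ndirs_corner ->].
  by split; lra.
- move=> y yQ i; rewrite mxE; have := yQ i; rewrite /lo /hi /=.
  case: ifPn => [ix [h1 h2]|ix [h1 h2]].
    rewrite (gstep_cell (dirs_lt gx ix))//; last by rewrite !ltW.
    by have /andP[s0 s1] := step01 (3 * (y ord0 i - (corner x i)%:R) - 1);
      rewrite lerDl lerD2l /step3 s0 s1.
  by apply: gstep_near; [exact: ndirs_le|apply/andP; split; lra].
Qed.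

Lemma cell_gstep x : grid x -> cell (face x) (pw gstep x).
Proof. by move=> /cell_gstep_near[Q [_ Qx]]; exact. Qed.

Lemma cell_pw_gstep x y : grid x -> cell (face x) y -> cell (face x) (pw gstep y).
Proof.
move=> gx cy i; have := cy i => /=; rewrite mxE; case: ifPn => [ix h|ix ->].
  rewrite (gstep_cell (dirs_lt gx ix))//.
  by have /andP[s0 s1] := step01 (3 * (y ord0 i - (corner x i)%:R) - 1);
    rewrite lerDl lerD2l /step3 s0 s1.
by rewrite gstep_nat// ndirs_le.
Qed.

Section face_chart.
Variable c : {ffun 'I_n -> nat} * {set 'I_n}.

(** The Kronecker symbols select the coordinate of [u] that belongs to direction i, if there is one;
    in this form smoothness is immediate. *)
Definition emb (u : 'rV[R]_#|c.2|) : 'rV[R]_n :=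
  \row_i ((c.1 i)%:R + \sum_(j < #|c.2|) (enum_val j == i)%:R * u ord0 j).

Definition prj x : 'rV[R]_#|c.2| :=
  \row_j (x ord0 (enum_val j) - (c.1 (enum_val j))%:R).

Lemma sm_emb : sm emb.
Proof. by rewrite /emb; solve_sm. Qed.

Lemma sm_prj : sm prj.
Proof. by rewrite /prj; solve_sm. Qed.

Lemma emb_dirs u (j : 'I_#|c.2|) : emb u ord0 (enum_val j) = (c.1 (enum_val j))%:R + u ord0 j.
Proof.
rewrite mxE (bigD1 j)//= eqxx mul1r big1 ?addr0// => k kj.
by rewrite (inj_eq enum_val_inj) (negbTE kj) mul0r.
Qed.

Lemma emb_ndirs u i : i \notin c.2 -> emb u ord0 i = (c.1 i)%:R.
Proof.
move=> ic; rewrite mxE big1 ?addr0// => j _; case: eqP => [e|_]; last by rewrite mul0r.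
by move: ic; rewrite -e enum_valP.
Qed.

Lemma enum_valE i : i \in c.2 -> exists j : 'I_#|c.2|, i = enum_val j.
Proof. by move=> ic; exists (enum_rank_in ic i); rewrite enum_rankK_in. Qed.

Lemma prjK x : cell c x -> emb (prj x) = x.
Proof.
move=> cx; apply/rowP => i; have := cx i.
case: ifPn => [/enum_valE[j ->] _|ic ->]; last by rewrite emb_ndirs.
by rewrite emb_dirs mxE addrC subrK.
Qed.

Lemma cube_prj x : cell c x -> cube R _ (prj x).
Proof.
move=> cx j; rewrite mxE; have := cx (enum_val j); rewrite enum_valP => /andP[h1 h2].
by apply/andP; split; lra.
Qed.

Lemma cell_emb u : cube R _ u -> cell c (emb u).
Proof.
move=> cu i; case: ifPn => [/enum_valE[j ->]|ic]; last exact: emb_ndirs.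
by rewrite emb_dirs; have /andP[h1 h2] := cu j; apply/andP; split; lra.
Qed.

End face_chart.

(** In the chart of any face, [gstep] becomes [step3], the reparametrization built into the
    extensions. One global function thus accounts for it on all faces simultaneously. *)
Lemma pw_gstep_emb x u : grid x -> cube R _ u ->
  pw gstep (emb (c := face x) u) = emb (pw step3 u).
Proof.
move=> gx cu; apply/rowP => i; rewrite mxE.
have [ix|ix] := boolP (i \in (face x).2); last first.
  by rewrite !emb_ndirs// gstep_nat// ndirs_le.
have [j ij] := enum_valE ix; have := cu j => /andP[h1 h2].
have lt := dirs_lt gx ix; rewrite ij in lt *; rewrite !emb_dirs (gstep_cell lt).
  by rewrite mxE [_ + u _ _]addrC addrK.
by rewrite lerDl lerD2l h1 h2.
Qed.

Lemma skel_emb x u : grid x -> bd _ u -> skel #|dirs x| (emb (c := face x) u).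
Proof.
move=> gx [cu [j uj]]; have ce := cell_emb cu; split; first exact: cell_grid ce.
right; apply: (card_dirs_cell gx ce (enum_valP j)).
rewrite inE negbK emb_dirs.
by case: uj => ->; rewrite ?addr0 ?natr1 natrK.
Qed.

(** As x is off the boundary of the grid, its open face misses this skeleton. So y has lost a
    direction of the face, and its coordinate there is one of the two end points. *)
Lemma bd_prj x y : grid x -> ~ grid_bd x -> cell (face x) y -> skel #|dirs x| y ->
  bd _ (prj (face x) y).
Proof.
move=> gx nbx cy sy; have gy := cell_grid gx cy.
split; first exact: cube_prj.
have [e|[i ix iy]] := face_cell gx cy.
  exfalso; case: sy => _ [bdy|].
    by apply: nbx; apply: grid_bd_cell bdy _; rewrite e; exact: cell_face.
  by case: e => _ ->; rewrite ltnn.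
have [j ij] := @enum_valE (face x) i ix; exists j; rewrite mxE -ij /=.
have := cy i; rewrite /= ix => /andP[h1 h2].
have yE := ndirs_corner iy.
have := h1; rewrite yE ler_nat leq_eqVlt => /orP[/eqP ->|lt].
  by left; rewrite subrr.
right; apply/eqP; rewrite eq_le; apply/andP; split; first by lra.
have : ((corner x i)%:R + 1 : R) <= (corner y i)%:R by rewrite natr1 ler_nat.
by move=> ?; lra.
Qed.

End grid.

(** * Induction over the skeleta *)

Section skeleton.
Variables (R : realType) (X Y : diffeologicalType R) (phi : X -> Y).
Notation step := (@step R).
Notation step2 := (@step2 R).
Notation step3 := (@step3 R).

Definition capfam (Z : Type) (A : bool -> set Z) (P : set bool) : set Z :=
  [set z | forall i, P i -> A i z].

Variables (A : bool -> set X) (B : bool -> set Y).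
Hypothesis lift : forall P : set bool, (exists i, P i) ->
  forall q F (g : 'rV[R]_q -> X), problem phi (capfam A P) (capfam B P) F g ->
    extends phi (capfam A P) (capfam B P)
      (fun p => F (pw step3 p.1, step2 p.2)) (fun x => g (pw step3 x)).

Variables (n M : nat) (io : ('I_n -> 'I_M) -> bool).
Notation gstep := (@gstep R M).
Notation grid := (@grid R n M).
Notation grid_bd := (@grid_bd R n M).
Notation skel := (@skel R n M).
Notation cell := (@cell R n).
Notation unit_cube := (@unit_cube R n M).
Variables (f : 'rV[R]_n -> Y) (g : 'rV[R]_n -> X).
Hypotheses (sf : smon grid f) (sg : smon grid_bd g).
Hypothesis fg : forall x, grid_bd x -> f x = phi (g x).
Hypothesis fB : forall k x, grid x -> unit_cube k x -> B (io k) (f x).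
Hypothesis gA : forall k x, grid_bd x -> unit_cube k x -> A (io k) (g x).

Definition grid_repar (r : R -> R) : Prop :=
  [/\ sm r, r 0 = 0, r M%:R = M%:R & forall t, 0 <= t <= M%:R -> 0 <= r t <= M%:R].

(** The whole bottom is kept because faces not yet treated still need a map on the bottom of their
    lifting problem. *)
Definition tower q : set ('rV[R]_n * R) :=
  [set p | [/\ grid p.1, I01 p.2 & p.2 = 0 \/ skel q p.1]].

Record stage q r (H : 'rV[R]_n * R -> Y) (G : 'rV[R]_n -> X) : Prop := Stage {
  stage_repar : grid_repar r ;
  stage_smonH : smon (tower q) H ;
  stage_smonG : smon (skel q) G ;
  stage_bottom : forall x, grid x -> H (x, 0) = f (pw r x) ;
  stage_top : forall x, skel q x -> H (x, 1) = phi (G x) ;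
  stage_bdG : forall x, grid_bd x -> G x = g (pw r x) ;
  stage_bdH : forall x t, grid_bd x -> I01 t -> H (x, t) = phi (g (pw r x)) ;
  stage_inB : forall p k, tower q p -> unit_cube k p.1 -> B (io k) (H p) ;
  stage_inA : forall x k, skel q x -> unit_cube k x -> A (io k) (G x) }.

Lemma grid_bd_skel q x : grid_bd x -> skel q x.
Proof. by move=> bx; split; [exact: bx.1|left]. Qed.

Lemma stage0 : stage 0 id (fun p => f p.1) g.
Proof.
have skel0 x : skel 0 x -> grid_bd x by move=> [_ []].
split => //.
- by split.
- apply: (smon_comp sf (c := fun p : 'rV[R]_n * R => p.1)); first by solve_sm.
  by move=> p [].
- by apply: sub_smon sg => x /skel0.
- by move=> x gx; rewrite pw_id.
- by move=> x /skel0; exact: fg.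
- by move=> x bx; rewrite pw_id.
- by move=> x t bx _; rewrite pw_id; exact: fg.
- by move=> p k [gp _ _]; exact: fB.
- by move=> x k /skel0; exact: gA.
Qed.

Lemma gstep_repar : grid_repar gstep.
Proof.
split; [exact: sm_gstep|exact: (@gstep_nat R M 0 (leq0n M))|exact: gstep_nat|].
move=> t _; rewrite /gstep; apply/andP; split.
  by apply: sumr_ge0 => i _; have /andP[] := step01 (3 * (t - i%:R) - 1).
rewrite -[leRHS](_ : \sum_(k < M) 1 = _); last by rewrite sumr_const card_ord.
by apply: ler_sum => i _; have /andP[] := step01 (3 * (t - i%:R) - 1).
Qed.

Lemma grid_repar_comp r r' : grid_repar r -> grid_repar r' -> grid_repar (r \o r').
Proof.
move=> [sr r0 r1 Ir] [sr' r0' r1' Ir']; split => /=; rewrite ?r0' ?r1'//.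
  exact: sm_comp.
by move=> t /Ir'/Ir.
Qed.

Lemma grid_pw r (x : 'rV[R]_n) : grid_repar r -> grid x -> grid (pw r x).
Proof. by move=> [_ _ _ rI] gx i; rewrite mxE; exact: rI. Qed.

Lemma grid_bd_pw r (x : 'rV[R]_n) : grid_repar r -> grid_bd x -> grid_bd (pw r x).
Proof.
move=> rr [gx [i xi]]; split; first exact: grid_pw.
by have [_ r0 r1 _] := rr; exists i; rewrite mxE; case: xi => ->; [left|right].
Qed.

Section next_stage.
Variables (q : nat) (r : R -> R) (H : 'rV[R]_n * R -> Y) (G : 'rV[R]_n -> X).
Hypothesis st : stage q r H G.

Record solution c (K : 'rV[R]_n * R -> Y) (L : 'rV[R]_n -> X) : Prop := Solution {
  solution_smonK : smon [set p | cell c p.1 /\ I01 p.2] K ;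
  solution_smonL : smon (cell c) L ;
  solution_inB : forall x t k, cell c `<=` unit_cube k -> cell c x -> I01 t ->
    B (io k) (K (x, t)) ;
  solution_inA : forall x k, cell c `<=` unit_cube k -> cell c x -> A (io k) (L x) ;
  solution_top : forall x, cell c x -> K (x, 1) = phi (L x) ;
  solution_pan : forall x t, cell c x -> I01 t -> t = 0 \/ skel q x ->
    K (x, t) = H (pw gstep x, step2 t) ;
  solution_bd : forall x, cell c x -> skel q x -> L x = G (pw gstep x) }.

Lemma ex_solution x0 : grid x0 -> ~ grid_bd x0 -> #|dirs x0| = q ->
  exists K L, solution (face x0) K L.
Proof.
move=> gx nbx cardx; set c := face x0.
(* The solution has to respect the index of every small cube containing this face, since it becomes
   boundary data for the larger faces of all these cubes. *)
pose P := [set i | exists2 k, cell c `<=` unit_cube k & io k = i].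
have exP : exists i, P i.
  have [k kx] := ex_unit_cube gx nbx; exists (io k), k => // y.
  exact: unit_cube_cell.
have gemb u : cube R _ u -> grid (emb (c := c) u).
  by move=> cu; apply: cell_grid gx _; exact: cell_emb.
have semb u : bd _ u -> skel q (emb (c := c) u).
  by move=> bu; rewrite -cardx; exact: skel_emb.
have tower_emb p : pan _ p -> tower q (emb (c := c) p.1, p.2).
  by move=> [[cp Ip] pp]; split => //=; [exact: gemb|case: pp; [left|right; exact: semb]].
have pb : problem phi (capfam A P) (capfam B P)
    (fun p => H (emb (c := c) p.1, p.2)) (fun u => G (emb (c := c) u)).
  split.
  - apply: (smon_comp (stage_smonH st) (c := fun p => (emb (c := c) p.1, p.2))).
      by have se := sm_emb (c := c); solve_sm.
    by move=> p; exact: tower_emb.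
  - by apply: (smon_comp (stage_smonG st) (sm_emb (c := c))) => u; exact: semb.
  - move=> p pp _ [k ck <-]; apply: (stage_inB st); first exact: tower_emb.
    by apply/ck/cell_emb; have [[]] := pp.
  - move=> u bu _ [k ck <-]; apply: (stage_inA st); first exact: semb.
    by apply/ck/cell_emb; have [] := bu.
  - by move=> u bu; apply: (stage_top st); exact: semb.
have [K [L [sK sL KB LA KL Kpan Lbd]]] := lift exP pb.
have cprj x : cell c x -> cube R _ (prj c x) by exact: cube_prj.
have sp := @sm_prj R n c.
have bprj x : cell c x -> skel q x -> bd _ (prj c x).
  by move=> cx sx; apply: (bd_prj gx nbx cx); rewrite cardx.
exists (fun p => K (prj c p.1, p.2)), (fun x => L (prj c x)); split.
- apply: (smon_comp sK (c := fun p => (prj c p.1, p.2))); first by solve_sm.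
  by move=> p [cp Ip]; split => //=; exact: cprj.
- by apply: (smon_comp sL sp).
- move=> x t k ck cx It; apply: KB; first by split => //=; exact: cprj.
  by exists k.
- by move=> x k ck cx; apply: LA; [exact: cprj|exists k].
- by move=> x cx; apply: KL; exact: cprj.
- move=> x t cx It h; rewrite Kpan /=.
    by rewrite -(pw_gstep_emb gx) ?prjK//; exact: cprj.
  split; first by split => //=; exact: cprj.
  by case: h => [|sx]; [left|right; exact: bprj].
- move=> x cx sx; rewrite Lbd; last exact: bprj.
  by rewrite -(pw_gstep_emb gx) ?prjK//; exact: cprj.
Qed.

(* The solution may only depend on the face of [x], so that it is smooth on
   closed faces. *)
Lemma ex_solutions : exists K L, forall x, grid x -> ~ grid_bd x ->
  #|dirs x| = q -> solution (face x) (K (face x)) (L (face x)).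
Proof.
have /choice[KL KLP] : forall c, exists KL : ('rV[R]_n * R -> Y) * ('rV[R]_n -> X),
    forall x, grid x -> ~ grid_bd x -> #|dirs x| = q -> face x = c ->
      solution c KL.1 KL.2.
  move=> c; have [[x [gx nbx cx <-]]|no] := pselect (exists x,
      [/\ grid x, ~ grid_bd x, #|dirs x| = q & face x = c]).
    by have [K [L KL]] := ex_solution gx nbx cx; exists (K, L).
  by exists (H, G) => x gx nbx cx e; exfalso; apply: no; exists x.
exists (fun c => (KL c).1), (fun c => (KL c).2) => x gx nbx cx.
exact: KLP gx nbx cx erefl.
Qed.

Variables (K : {ffun 'I_n -> nat} * {set 'I_n} -> 'rV[R]_n * R -> Y).
Variables (L : {ffun 'I_n -> nat} * {set 'I_n} -> 'rV[R]_n -> X).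
Hypothesis KL : forall x, grid x -> ~ grid_bd x -> #|dirs x| = q ->
  solution (face x) (K (face x)) (L (face x)).

Let H1 (p : 'rV[R]_n * R) := if `[< p.2 = 0 \/ skel q p.1 >]
  then H (pw gstep p.1, step2 p.2) else K (face p.1) p.
Let G1 x := if `[< skel q x >] then G (pw gstep x) else L (face x) x.

Let skelP x : skel q.+1 x -> skel q x \/ [/\ grid x, ~ grid_bd x & #|dirs x| = q].
Proof.
move=> [gx h]; have [sx|nsx] := pselect (skel q x); [by left|right].
have nbx : ~ grid_bd x by move/(grid_bd_skel q).
split => //; case: h => // h; apply/eqP; rewrite eqn_leq -ltnS h leqNgt.
by apply/negP => h'; apply: nsx; split => //; right.
Qed.

(** Although [H1] branches at each point, one formula is valid on a whole closed face: on the
    boundary of the face, [solution_pan] identifies the solution with the previous stage. *)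
Let H1E x y t : skel q.+1 x -> cell (face x) y -> I01 t ->
  H1 (y, t) = (if `[< skel q x >] then H (pw gstep y, step2 t) else K (face x) (y, t)).
Proof.
move=> sx cy It; have gx := sx.1; rewrite /H1 /=.
case: asboolP => [h|nh]; case: asboolP => // h'.
- have [//|[_ nbx cx]] := skelP sx.
  by rewrite (solution_pan (KL gx nbx cx)).
- by exfalso; apply: nh; right; exact: skel_cell cy.
have [//|[_ nbx cx]] := skelP sx.
have [->//|[i ix iy]] := face_cell gx cy.
exfalso; apply: nh; right; split; first exact: cell_grid cy.
by right; rewrite -cx; exact: card_dirs_cell cy ix iy.
Qed.

Let G1E x y : skel q.+1 x -> cell (face x) y ->
  G1 y = (if `[< skel q x >] then G (pw gstep y) else L (face x) y).
Proof.
move=> sx cy; have gx := sx.1; rewrite /G1.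
case: asboolP => [h|nh]; case: asboolP => // h'.
- have [//|[_ nbx cx]] := skelP sx.
  by rewrite (solution_bd (KL gx nbx cx)).
- by exfalso; apply: nh; exact: skel_cell cy.
have [//|[_ nbx cx]] := skelP sx.
have [->//|[i ix iy]] := face_cell gx cy.
exfalso; apply: nh; split; first exact: cell_grid cy.
by right; rewrite -cx; exact: card_dirs_cell cy ix iy.
Qed.

Let sm_g : sm gstep := sm_gstep M.

Let skel_gstep p x : skel p x -> skel p (pw gstep x).
Proof. by move=> sx; apply: skel_cell (sx) _; apply: cell_gstep; exact: sx.1. Qed.

Let step20 : step2 0 = 0. Proof. by have [] := repar_step2 R. Qed.
Let step21 : step2 1 = 1. Proof. by have [] := repar_step2 R. Qed.
Let stp0 : step 0 = 0. Proof. by have [] := repar_step R. Qed.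
Let stp1 : step 1 = 1. Proof. by have [] := repar_step R. Qed.

Let smon_nextG : smon (skel q.+1) (fun x => G1 (pw gstep x)).
Proof.
apply: smon_local => x0 sx0; have gx0 := sx0.1.
have [Q [oQ Qx0 Qc]] := cell_gstep_near gx0.
exists Q, (fun x => if `[< skel q x0 >] then G (pw gstep (pw gstep x))
                    else L (face x0) (pw gstep x)); split => //; last first.
  by move=> x sx Qx; rewrite (G1E sx0 (Qc _ Qx)).
case: asboolP => h.
  apply: (smon_comp (stage_smonG st) (c := fun x => pw gstep (pw gstep x))).
    by solve_sm.
  move=> x [_ /Qc cx]; apply: skel_gstep; exact: skel_cell cx.
have [//|[_ nbx cx]] := skelP sx0.
apply: (smon_comp (solution_smonL (KL gx0 nbx cx)) (c := fun x => pw gstep x)).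
  by solve_sm.
by move=> x [_ /Qc].
Qed.

Let smon_nextH : smon (tower q.+1) (fun p => H1 (pw gstep p.1, step p.2)).
Proof.
apply: smon_local => -[x0 t0] [/= gx0 It0 h0].
(* Below height 1/3 [step] is 0, so only bottom values occur. This settles the points over faces
   outside the new skeleton, where the tower consists of its bottom alone. *)
have [t03|t03] := ltP t0 3^-1.
  exists [set p | p.2 < 3^-1], (fun p => H (pw gstep (pw gstep p.1), 0)); split => //.
  - by apply: (topen_lt (a := snd)); solve_sm.
  - apply: (smon_comp (stage_smonH st) (c := fun p : 'rV[R]_n * R =>
      (pw gstep (pw gstep p.1), 0 : R))); first by solve_sm.
    move=> p [[gp _ _] _]; split => /=; [|exact: I01_0|by left].
    exact/(grid_pw gstep_repar)/(grid_pw gstep_repar).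
  - move=> p _ /= pt; rewrite /H1 /= step0; last exact: ltW.
    by case: asboolP => [_|[]]; [rewrite step20|left].
have sx0 : skel q.+1 x0 by case: h0 => // h; exfalso; lra.
have [Q [oQ Qx0 Qc]] := cell_gstep_near gx0.
exists ([set p | Q p.1] `&` [set p | 0 < p.2]),
  (fun p => if `[< skel q x0 >] then H (pw gstep (pw gstep p.1), step2 (step p.2))
            else K (face x0) (pw gstep p.1, step p.2)); split => //.
- apply: topenI; last by apply: (topen_gt (a := snd)); solve_sm.
  move=> m U h oU sh; apply: (oQ m U (fst \o h)) => //.
  by move=> k; exact: ndifferentiable_fst.
- by split => //=; lra.
- case: asboolP => h.
    apply: (smon_comp (stage_smonH st) (c := fun p : 'rV[R]_n * R =>
      (pw gstep (pw gstep p.1), step2 (step p.2)))).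
      by rewrite /step2; solve_sm.
    move=> p [_ [/= /Qc cx _]]; have sx := skel_gstep (skel_cell h cx).
    by split => /=; [exact: sx.1|exact: step01|right].
  have [//|[_ nbx cx]] := skelP sx0.
  apply: (smon_comp (solution_smonK (KL gx0 nbx cx))
    (c := fun p : 'rV[R]_n * R => (pw gstep p.1, step p.2))); first by solve_sm.
  by move=> p [_ [/= /Qc cx' _]]; split => //=; exact: step01.
- by move=> p _ [/= /Qc cx _]; rewrite (H1E sx0 cx)//; exact: step01.
Qed.

(** One [gstep] comes from the solutions, which match the previous stage only after [step3] in each
    chart; the other makes the glued maps smooth. In the height, [step2] and [step] play these two
    roles. *)
Lemma next_stage : stage q.+1 (r \o gstep \o gstep)
  (fun p => H1 (pw gstep p.1, step p.2)) (fun x => G1 (pw gstep x)).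
Proof.
have pw3 x : pw (r \o gstep \o gstep) x = pw r (pw gstep (pw gstep x)) :> 'rV[R]_n.
  by rewrite !pw_comp.
have bdg x : grid_bd x -> grid_bd (pw gstep x) by exact/grid_bd_pw/gstep_repar.
have gg x : grid x -> grid (pw gstep x) by exact/grid_pw/gstep_repar.
split.
- apply: grid_repar_comp gstep_repar; apply: grid_repar_comp gstep_repar.
  exact: stage_repar st.
- exact: smon_nextH.
- exact: smon_nextG.
- move=> x gx; rewrite /= stp0 /H1 /= asboolT; last by left.
  by rewrite step20 (stage_bottom st) ?pw3//; exact/gg/gg.
- move=> x sx; have cx := cell_gstep sx.1; rewrite /= stp1.
  rewrite (H1E sx cx (I01_1 R)) (G1E sx cx); case: asboolP => h.
    by rewrite step21 (stage_top st)//; exact/skel_gstep/skel_gstep.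
  have [//|[gx nbx fx]] := skelP sx.
  exact: (solution_top (KL gx nbx fx)).
- move=> x bx; rewrite /G1 asboolT; last exact/grid_bd_skel/bdg.
  by rewrite (stage_bdG st) ?pw3//; exact/bdg/bdg.
- move=> x t bx It; rewrite /H1 asboolT; last by right; exact/grid_bd_skel/bdg.
  by rewrite (stage_bdH st) ?pw3//=; [exact/bdg/bdg|exact: step01].
- move=> [x t] k [/= gx It h] kx; have cx := cell_gstep gx.
  have kc : cell (face x) `<=` unit_cube k by move=> y; exact: unit_cube_cell.
  have kgg : unit_cube k (pw gstep (pw gstep x)) by apply/kc/cell_pw_gstep.
  case: h => [->|sx].
    rewrite stp0 /H1 /= asboolT; last by left.
    apply: (stage_inB st) => //; split => /=; [exact/gg/gg|exact: step01|].
    by left; exact: step20.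
  rewrite (H1E sx cx (step01 _)); case: asboolP => h.
    apply: (stage_inB st) => //; split => /=; [exact/gg/gg|exact: step01|].
    by right; exact/skel_gstep/skel_gstep.
  have [//|[_ nbx fx]] := skelP sx.
  by apply: (solution_inB (KL gx nbx fx)) => //; exact: step01.
- move=> x k sx kx; have gx := sx.1; have cx := cell_gstep gx.
  have kc : cell (face x) `<=` unit_cube k by move=> y; exact: unit_cube_cell.
  have kgg : unit_cube k (pw gstep (pw gstep x)) by apply/kc/cell_pw_gstep.
  rewrite (G1E sx cx); case: asboolP => h.
    by apply: (stage_inA st) => //; exact/skel_gstep/skel_gstep.
  have [//|[_ nbx fx]] := skelP sx.
  exact: (solution_inA (KL gx nbx fx)).
Qed.

End next_stage.

Lemma ex_stage q : exists r H G, stage q r H G.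
Proof.
elim: q => [|q [r [H [G st]]]]; first by exists id, (fun p => f p.1), g; exact: stage0.
have [K [L KL]] := ex_solutions st.
by eexists; eexists; eexists; exact: (next_stage st KL).
Qed.

Lemma grid_lifting : exists r G (H : 'rV[R]_n * R -> Y),
  [/\ grid_repar r, smon grid G, smon [set p | grid p.1 /\ I01 p.2] H,
      forall x, grid x -> H (x, 0) = f (pw r x) /\ H (x, 1) = phi (G x)
    & forall x, grid_bd x -> G x = g (pw r x) /\
        forall t, I01 t -> H (x, t) = phi (g (pw r x))].
Proof.
have [r [H [G [rr sH sG H0 HT GB HB _ _]]]] := ex_stage n.+1.
have sk x : grid x -> skel n.+1 x.
  by move=> gx; split => //; right; rewrite ltnS -[leqRHS](card_ord n) max_card.
exists r, G, H; split => //.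
- by apply: sub_smon sG => x; exact: sk.
- by apply: sub_smon sH => p [gp Ip]; split => //; right; exact: sk.
- by move=> x gx; split; [exact: H0|exact/HT/sk].
- by move=> x bx; split; [exact: GB|move=> t; exact: HB].
Qed.

End skeleton.

(** * Excisive triads *)

Section cover.
Variables (R : realType) (X Y : diffeologicalType R) (phi : X -> Y).
Variables (A : bool -> set X) (B : bool -> set Y).
Hypothesis phiAB : forall i x, A i x -> B i (phi x).
Hypothesis coverA : forall x : X, exists i, interior (A i : set (Dspace X)) x.
Hypothesis coverB : forall y : Y, exists i, interior (B i : set (Dspace Y)) y.
Hypothesis lift : forall P : set bool, (exists i, P i) ->
  forall q F (g : 'rV[R]_q -> X), problem phi (capfam A P) (capfam B P) F g ->
    extends phi (capfam A P) (capfam B P)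
      (fun p => F (pw (@step3 R) p.1, step2 p.2)) (fun x => g (pw (@step3 R) x)).
Notation step := (@step R).

Lemma smooth_on_id n (W : set 'rV[R]_n) : smooth_on W id.
Proof.
case=> // k; split=> [x _|v]; first by have [] := is_diff_id x.
have -> : 'D_v (@id 'rV[R]_n) = cst v by apply/funext => x; rewrite derive_id.
exact: ndifferentiable_cst.
Qed.

(** A map smooth on an open set is itself a plot, so the D-topology supplies an open preimage of the
    interior. *)
Lemma near_interior (Z : diffeologicalType R) n (W : set 'rV[R]_n)
    (h : 'rV[R]_n -> Z) (C : set Z) x :
  open W -> W x -> smon W h -> interior (C : set (Dspace Z)) (h x) ->
  \forall y \near x, C (h y).
Proof.
move=> oW Wx sh Cx.
have oC : Dopen (interior (C : set (Dspace Z))).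
  exact (@open_interior (Dspace Z) C).
have pW : plot (fun u : W => h (val u)) by apply: (sh n W id oW) => //; exact: smooth_on_id.
have [V oV VE] := oC _ _ _ pW.
have Vx : V x.
  have : [set u : W | interior (C : set (Dspace Z)) (h (val u))] (SigSub (mem_set Wx)).
    exact: Cx.
  by rewrite -[X in X _]/((fun u : W => h (val u)) @^-1` _) -VE.
apply: filterS (open_nbhs_nbhs (conj (openI oW oV) (conj Wx Vx))) => y [Wy Vy].
apply: (@interior_subset (Dspace Z)).
have : ((set_val : W -> _) @^-1` V) (SigSub (mem_set Wy)) by exact: Vy.
by rewrite VE.
Qed.

Lemma open_coord_lt n i (a : R) : open [set y : 'rV[R]_n | y ord0 i < a].
Proof.
apply: (@open_comp _ _ (fun y : 'rV[R]_n => y ord0 i) [set t | t < a]).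
  by move=> y _; exact: coord_continuous.
exact: open_lt.
Qed.

Lemma open_coord_gt n i (a : R) : open [set y : 'rV[R]_n | a < y ord0 i].
Proof.
apply: (@open_comp _ _ (fun y : 'rV[R]_n => y ord0 i) [set t | a < t]).
  by move=> y _; exact: coord_continuous.
exact: open_gt.
Qed.

Section cube_cover.
Variables (n : nat) (f : 'rV[R]_n -> Y) (g : 'rV[R]_n -> X).
Hypotheses (sf : smon (cube R n) f) (sg : smon (bd n) g).
Hypothesis fg : forall x, bd n x -> f x = phi (g x).

Let good i y := B i (f (pw step y)) /\ (bd n y -> A i (g (pw step y))).

Let sm_pstep : sm (fun y : 'rV[R]_n => pw step y).
Proof. by rewrite /pw; solve_sm. Qed.

(* On the boundary the index is dictated by [g], as [phi] maps the interior of
   [A i] into [B i] but perhaps not into its interior; [pw step] provides a collar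
   on which f = phi g. *)
Lemma near_good x : cube R n x -> exists i, \forall y \near x, good i y.
Proof.
move=> cx; have [[_ [j xj]]|nbx] := pselect (bd n x).
  have [W [oW Wx Wb]] : exists W : set 'rV[R]_n,
      [/\ open W, W x & forall y, W y -> bd n (pw step y)].
    case: xj => xj.
      exists [set y | y ord0 j < 3^-1]; split; first exact: open_coord_lt.
        by rewrite /= xj; lra.
      by move=> y /= yj; apply: (bd_step (i := j)); left; exact: ltW.
    exists [set y | 2 / 3 < y ord0 j]; split; first exact: open_coord_gt.
      by rewrite /= xj; lra.
    by move=> y /= yj; apply: (bd_step (i := j)); right; exact: ltW.
  have [i Ai] := coverA (g (pw step x)); exists i.
  have sW : smon W (fun y => g (pw step y)) by exact: (smon_comp sg sm_pstep).
  have nW := open_nbhs_nbhs (conj oW Wx).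
  apply: filterS2 (near_interior oW Wx sW Ai) nW => y Ay /Wb bY.
  by split => //; rewrite fg//; exact: phiAB.
have [i Bi] := coverB (f (pw step x)); exists i.
have sT : smon setT (fun y => f (pw step y)).
  by apply: (smon_comp sf sm_pstep) => y _; exact: cube_step.
(* Close to an interior point the condition on the boundary is vacuous, and the index can be taken
   from [B] alone. *)
have nb : \forall y \near x, ~ bd n y.
  have : nbhs x [set y : 'rV[R]_n | forall j, 0 < y ord0 j < 1].
    apply: (@filter_forall _ _ (fun j (y : 'rV[R]_n) => 0 < y ord0 j < 1) (nbhs x)) => j.
    have /andP[x0 x1] := cx j.
    have {}x0 : 0 < x ord0 j.
      by rewrite lt_neqAle x0 andbT; apply/eqP => e; apply: nbx; split => //; exists j; left.
    have {}x1 : x ord0 j < 1.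
      by rewrite lt_neqAle x1 andbT; apply/eqP => e; apply: nbx; split => //; exists j; right.
    apply: filterS2 (open_nbhs_nbhs (conj (@open_coord_lt n j 1) x1))
      (open_nbhs_nbhs (conj (@open_coord_gt n j 0) x0)) => y /= -> ->//.
  by apply: filterS => y y01 [_ [j []]] yj; have := y01 j; rewrite yj ltxx ?andbF.
apply: filterS2 (near_interior (@openT _) I sT Bi) nb => y By nby.
by split.
Qed.

(** The Lebesgue number of the cover by the neighbourhoods of [near_good]. The point y may leave the
    cube, as [pw step] brings it back. *)
Lemma lebesgue : exists m, forall x, cube R n x -> exists i, forall y : 'rV[R]_n,
  (forall j, `|x ord0 j - y ord0 j| <= m.+1%:R^-1) -> good i y.
Proof.
have K : compact (cube R n).
  apply: (@rV_compact R n (fun=> [set t : R | 0 <= t <= 1])) => _.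
  have -> : [set t : R | 0 <= t <= 1] = `[0, 1]%classic.
    by apply/seteqP; split => t; rewrite /= in_itv.
  exact: segment_compact.
have /compact_near_coveringP/(_ _ \oo
  (fun m (x : 'rV[R]_n) => exists i, forall y : 'rV[R]_n,
    (forall j, `|x ord0 j - y ord0 j| <= m.+1%:R^-1) -> good i y)) := K.
case.
  move=> x cx; have [i /nbhs_ballP[e /= e0 xe]] := near_good cx.
  have e2 : 0 < e / 2 by rewrite divr_gt0.
  (* One half of [e] is spent on moving the centre away from [x], the other on the mesh. *)
  exists (ball x (e / 2), [set m | m.+1%:R^-1 < e / 2]); first split => /=.
  - exact: nbhsx_ballx.
  - near=> m; rewrite /= invf_plt ?posrE//.
    near: m; exists (Num.trunc (e / 2)^-1) => // m /= hm.
    by apply: (lt_le_trans (truncnS_gt _)); rewrite ler_nat ltnS.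
  - move=> [y m] [/= [_ xy] hm]; exists i => z yz; apply: xe; split => // a j.
    have := xy a j; rewrite (ord1 a) /ball /= => h.
    have := ler_distD (y ord0 j) (x ord0 j) (z ord0 j).
    move=> h'; apply: le_lt_trans h' _; rewrite [e]splitr ltrD//.
    by apply: le_lt_trans hm; exact: yz.
move=> m _ /(_ m) H; exists m => x cx; exact: (H (leqnn m) x cx).
Unshelve. all: by end_near. Qed.

End cube_cover.

Lemma cover_relative_lifting : relative_lifting phi.
Proof.
move=> n f g sf sg fg; have [m leb] := lebesgue sf sg fg.
pose M := m.+1; have M0 : (0 : R) < M%:R by rewrite ltr0n.
pose scl (t : R) : R := t / M%:R; pose uns (t : R) : R := M%:R * t.
have s_scl : sm (fun x : 'rV[R]_n => pw scl x) by rewrite /pw /scl; solve_sm.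
have s_uns : sm (fun x : 'rV[R]_n => pw uns x) by rewrite /pw /uns; solve_sm.
have sclK t : uns (scl t) = t by rewrite /uns /scl mulrC divfK ?gt_eqF.
have unsK t : scl (uns t) = t by rewrite /uns /scl mulrAC divff ?mul1r ?gt_eqF.
have scl01 t : 0 <= t <= M%:R -> 0 <= scl t <= 1.
  by rewrite /scl => /andP[t0 tM]; rewrite divr_ge0 ?ler_pdivrMr ?mul1r// ltW.
have uns01 t : 0 <= t <= 1 -> 0 <= uns t <= M%:R.
  move=> /andP[t0 t1]; rewrite /uns mulr_ge0 ?(ltW M0)//=.
  by rewrite -[leRHS]mulr1 ler_wpM2l ?(ltW M0).
have cube_scl (x : 'rV[R]_n) : grid M x -> cube R n (pw scl x).
  by move=> gx i; rewrite mxE; exact: scl01.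
have bd_scl (x : 'rV[R]_n) : grid_bd M x -> bd n (pw scl x).
  move=> [gx [i xi]]; split; first exact: cube_scl.
  exists i; rewrite mxE /scl; case: xi => ->; [left|right]; first by rewrite mul0r.
  by rewrite divff// gt_eqF.
have grid_uns (x : 'rV[R]_n) : cube R n x -> grid M (pw uns x).
  by move=> cx i; rewrite mxE; exact: uns01.
have bd_uns (x : 'rV[R]_n) : bd n x -> grid_bd M (pw uns x).
  move=> [cx [i xi]]; split; first exact: grid_uns.
  exists i; rewrite mxE /uns; case: xi => ->; [left|right]; first by rewrite mulr0.
  by rewrite mulr1.
have /choice[io ioP] : forall k : 'I_n -> 'I_M, exists i : bool, forall x : 'rV[R]_n,
    unit_cube k x -> B i (f (pw step (pw scl x))) /\
      (bd n (pw scl x) -> A i (g (pw step (pw scl x)))).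
  (* [z] is the lowest corner of the small cube: after scaling, all its points are within [1 / M] of
     [z] in each coordinate. *)
  move=> k; pose z : 'rV[R]_n := \row_i (k i)%:R.
  have cz : cube R n (pw scl z).
    apply: cube_scl => i; rewrite mxE ler0n ler_nat.
    exact: ltnW.
  have [i iP] := leb _ cz; exists i => x kx; apply: iP => j.
  rewrite !mxE /scl -mulrBl normrM [`|_^-1|]ger0_norm ?invr_ge0 ?ler0n//.
  rewrite -[leRHS]mul1r ler_wpM2r ?invr_ge0 ?ler0n//.
  have /andP[h1 h2] := kx j; rewrite ler_norml; apply/andP; split; lra.
have [sr0 _ _ _] := repar_step R.
(* The maps are taken after [step], the form in which [lebesgue] controls them; this [step] is
   absorbed into [r'] below. *)
have sf2 : smon (grid M) (fun x : 'rV[R]_n => f (pw step (pw scl x))).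
  apply: (smon_comp sf (c := fun x : 'rV[R]_n => pw step (pw scl x))); first by solve_sm.
  by move=> x _; exact: cube_step.
have sg2 : smon (grid_bd M) (fun x : 'rV[R]_n => g (pw step (pw scl x))).
  apply: (smon_comp sg (c := fun x : 'rV[R]_n => pw step (pw scl x))); first by solve_sm.
  by move=> x bx; apply/(repar_bd (repar_step R))/bd_scl.
have [r [G [H [[sr r0 rM rI] sG sH H01 Hb]]]] := grid_lifting lift (io := io) sf2 sg2
  (fun x bx => fg _ (repar_bd (repar_step R) (bd_scl _ bx)))
  (fun k x _ kx => (ioP k x kx).1)
  (fun k x bx kx => (ioP k x kx).2 (bd_scl _ bx)).
pose r' t := step (scl (r (uns t))).
have pwr' (x : 'rV[R]_n) : pw step (pw scl (pw r (pw uns x))) = pw r' x.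
  by rewrite !pw_comp.
exists r', (fun x => G (pw uns x)), (fun p => H (pw uns p.1, p.2)); split.
- split.
  + by rewrite /r' /scl /uns; solve_sm.
  + by rewrite /r' /uns mulr0 r0 /scl mul0r; have [_ ->] := repar_step R.
  + rewrite /r' /uns mulr1 rM /scl divff ?gt_eqF//.
    by have [_ _ ->] := repar_step R.
  + by move=> t _; exact: step01.
- by apply: (smon_comp sG s_uns) => x; exact: grid_uns.
- apply: (smon_comp sH (c := fun p : 'rV[R]_n * R => (pw uns p.1, p.2))).
    by rewrite /uns; solve_sm.
  by move=> p [cp Ip]; split => //=; exact: grid_uns.
- by move=> x cx; have [h0 h1] := H01 _ (grid_uns _ cx); rewrite -pwr' -h0.
- move=> x bx; have [h0 h1] := Hb _ (bd_uns _ bx).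
  by rewrite -pwr'; split => // t It; rewrite h1.
Qed.

End cover.

Theorem theorem6p5 (R : realType) (X Y : diffeologicalType R)
  (A1 A2 : set X) (B1 B2 : set Y)
  (exA : excisive_triad A1 A2) (exB : excisive_triad B1 B2)
  (phi : X -> Y) (phi_smooth : smooth phi)
  (phi1 : set_fun A1 B1 phi) (phi2 : set_fun A2 B2 phi) :
  weak_homotopy_equivalence (restriction phi1) ->
  weak_homotopy_equivalence (restriction phi2) ->
  weak_homotopy_equivalence (restriction (set_funI phi1 phi2)) ->
  weak_homotopy_equivalence phi.
Proof.
move=> W1 W2 W12.
pose A b := if b then A1 else A2; pose B b := if b then B1 else B2.
have phiAB i x : A i x -> B i (phi x) by case: i; [exact: phi1|exact: phi2].
have coverA x : exists i, interior (A i : set (Dspace X)) x.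
  have : (interior (A1 : set (Dspace X)) `|` interior (A2 : set (Dspace X))) x by rewrite exA.
  by case; [exists true|exists false].
have coverB y : exists i, interior (B i : set (Dspace Y)) y.
  have : (interior (B1 : set (Dspace Y)) `|` interior (B2 : set (Dspace Y))) y by rewrite exB.
  by case; [exists true|exists false].
have lift_of (C : set X) (D : set Y) (h : set_fun C D phi) :
    weak_homotopy_equivalence (restriction h) ->
    forall q F (g : 'rV[R]_q -> X), problem phi C D F g ->
    extends phi C D (fun p => F (pw (@step3 R) p.1, step2 p.2))
      (fun x => g (pw (@step3 R) x)).
  move=> W; apply: problem_extends => //; first exact: weak_pi0_lifting W.
    by move=> n; exact: (weak_null_lifting W).
  by move=> n; exact: (weak_class_lifting W).
apply: weak_of_relative_lifting => //; last first.
  (* The point lies in one of the [B i], and surjectivity on pi_0 over that piece produces a point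
     of [X]. *)
  move=> y; have [i /(@interior_subset (Dspace Y)) By] := coverB y.
  case: i By => By.
    by have [a _] := weak_pi0_lifting W1 By; exists a.
  by have [a _] := weak_pi0_lifting W2 By; exists a.
apply: (cover_relative_lifting phiAB coverA coverB) => P exP.
have [Pt|Pt] := pselect (P true); have [Pf|Pf] := pselect (P false).
- have -> : capfam A P = A1 `&` A2.
    apply/seteqP; split => [x Hx|x [h1 h2] [] _//].
    by split; [exact: Hx Pt|exact: Hx Pf].
  have -> : capfam B P = B1 `&` B2.
    apply/seteqP; split => [x Hx|x [h1 h2] [] _//].
    by split; [exact: Hx Pt|exact: Hx Pf].
  exact: (lift_of _ _ _ W12).
- have -> : capfam A P = A1.
    by apply/seteqP; split => [x Hx|x h1 []//]; exact: Hx Pt.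
  have -> : capfam B P = B1.
    by apply/seteqP; split => [x Hx|x h1 []//]; exact: Hx Pt.
  exact: (lift_of _ _ _ W1).
- have -> : capfam A P = A2.
    by apply/seteqP; split => [x Hx|x h1 []//]; exact: Hx Pf.
  have -> : capfam B P = B2.
    by apply/seteqP; split => [x Hx|x h1 []//]; exact: Hx Pf.
  exact: (lift_of _ _ _ W2).
- by case: exP => -[].
Qed.
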